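(* For each of the following values of $(p,q,r;\lambda)$, $\overline{\mathcal{F}(p,q,r;\lambda,3)}$ is an irreducible component of $\mathscr{F}_2(3,3)$: $(7,6,4;8)$, $(7,3,2;4)$, $(6,5,2;4)$, $(4,3,2;4)$, $(4,2,1;2)$, $(3,2,1;2)$. For each of the following values of $(p,q,r;\lambda)$, $\overline{\mathcal{F}(p,q,r;\lambda,4)}$ is an irreducible component of $\mathscr{F}_2(4,3)$: $(13,12,9;27)$, $(13,8,6;18)$, $(13,4,3;9)$, $(12,7,3;9)$, $(9,8,6;18)$, $(9,6,4;12)$, $(9,4,3;9)$, $(9,3,2;6)$, $(8,3,2;6)$, $(6,5,3;9)$, $(6,3,2;6)$, $(4,3,2;6)$, $(3,2,1;3)$.
   Context: $R_{4}$ is the radial vector field on $\mathbb{C}^{4}$, $i_Z$ is contraction by $Z$, and $\mathrm{Sing}$ of a form is its zero set. A two-dimensional holomorphic foliation of degree $e$ on $\mathbb{P}^3$ (complex projective space) is given by an integrable $1$-form $\Omega$ on $\mathbb{C}^{4}$ ($\Omega\wedge d\Omega=0$), with homogeneous polynomial coefficients of degree $e+1$, with $i_{R_4}\Omega=0$ and $\mathrm{codim}\,\mathrm{Sing}(\Omega)\ge 2$; $\Omega$ is taken up to multiplication by a nonzero scalar. The set of these foliations is $\mathscr{F}_2(e,3)$, a Zariski open subset of a projective variety. An affine chart is the composition of $(x_1,x_2,x_3)\mapsto(x_1:x_2:x_3:1)$ with an automorphism of $\mathbb{P}^3$. For relatively prime positive integers $p>q>r$ (i.e. $\gcd(p,q,r)=1$),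 let $S=p x_1\,\partial/\partial x_1+q x_2\,\partial/\partial x_2+r x_3\,\partial/\partial x_3$ on $\mathbb{C}^3$ and $\nu_3=dx_1\wedge dx_2\wedge dx_3$. For $\lambda\in\mathbb{Z}$, $\mathcal{F}(p,q,r;\lambda,d+1)$ is the set of $\mathcal{F}\in\mathscr{F}_2(d+1,3)$ that in some affine chart are defined by $\omega=i_Si_X\nu_3$ for some polynomial vector field $X$ on $\mathbb{C}^3$ with $[S,X]=\lambda X$. The bar denotes Zariski closure in $\mathscr{F}_2(d+1,3)$. *)

(* Defs.v *)
From HB Require Import structures.
From mathcomp Require Import all_boot all_order all_algebra.
From mathcomp Require Import boolp classical_sets reals topology_structure.
From mathcomp Require Import complex mpoly.

Set Implicit Arguments.
Unset Strict Implicit.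
Unset Printing Implicit Defensive.

Import GRing.Theory.
Local Open Scope classical_set_scope.
Local Open Scope ring_scope.

Section Irreducibility.
Variable T : topologicalType.

Definition irreducible_set (A : set T) : Prop :=
  A !=set0 /\
  forall B C : set T, closed B -> closed C ->
    A `<=` B `|` C -> A `<=` B \/ A `<=` C.

Definition irreducible_component (A : set T) : Prop :=
  irreducible_set A /\
  forall B : set T, irreducible_set B -> A `<=` B -> B = A.

(* The codimension of Z is the infimum, over the irreducible closed Y in Z, of
   the lengths k of chains Y = W 0 < ... < W k of irreducible closed subsets of
   T; it is infinite if Z is empty. *)
Definition codim_ge (k : nat) (Z : set T) : Prop :=
  forall Y : set T, closed Y -> irreducible_set Y -> Y `<=` Z ->
  exists W : nat -> set T,
    [/\ W 0%N = Y,
        forall i, (i <= k)%N -> closed (W i) /\ irreducible_set (W i) &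
        forall i, (i < k)%N -> W i `<` W i.+1].

End Irreducibility.

(* Topologies whose closed sets are the common zero loci of sets of equations
   taken from a class H: "van P t" means that P vanishes at t. *)
Section ZeroLocusTopology.
Variables (T Q : Type) (H : set Q) (van : Q -> T -> Prop).

Definition zero_locus (I : set Q) : set T :=
  [set t | forall P, I P -> van P t].

Definition zero_locus_open (A : set T) : Prop :=
  exists2 I : set Q, I `<=` H & ~` A = zero_locus I.

Hypothesis van1 : exists2 P, H P & forall t, ~ van P t.
Hypothesis vanM : forall P P', H P -> H P' ->
  exists2 P'', H P'' & forall t, van P'' t <-> van P t \/ van P' t.

Lemma zero_locus_openT : zero_locus_open setT.
Proof.
have [P HP vP] := van1; exists [set P]; first by move=> _ ->.
by apply/seteqP; split=> t; [case | move=> /(_ P erefl) /vP].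
Qed.

Lemma zero_locus_openI : setI_closed zero_locus_open.
Proof.
move=> A B [I IH eA] [J JH eB].
exists [set P | H P /\ exists P1 P2, [/\ I P1, J P2 &
                 forall t, van P t <-> van P1 t \/ van P2 t]].
  by move=> P [].
rewrite setCI eA eB; apply/seteqP; split=> t.
  move=> tIJ P [_ [P1 [P2 [IP1 JP2 vP]]]]; apply/vP.
  by case: tIJ => [/(_ _ IP1)|/(_ _ JP2)]; [left|right].
move=> h; have [|/existsNP[P1 /not_implyP[IP1 nP1]]] := pselect (zero_locus I t).
  by left.
right=> P2 JP2; have [P HP vP] := vanM (IH _ IP1) (JH _ JP2).
have : van P t by apply: h; split=> //; exists P1, P2.
by move/vP => [].
Qed.

Lemma zero_locus_open_bigU (L : Type) (f : L -> set T) :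
  (forall l, zero_locus_open (f l)) -> zero_locus_open (\bigcup_l f l).
Proof.
move=> fo; exists [set P | H P /\ exists l, ~` f l `<=` van P].
  by move=> P [].
rewrite setC_bigcup; apply/seteqP; split=> t.
  by move=> tf P [_ [l]]; apply; apply: tf.
move=> h l _; have [I IH e] := fo l; rewrite e => P IP; apply: h.
by split; [exact: IH | exists l; rewrite e => s; apply].
Qed.

End ZeroLocusTopology.

(* K^n with the Zariski topology *)
Definition affine_space (K : fieldType) (n : nat) : Type := 'I_n -> K.

Section AffineZariski.
Variables (K : fieldType) (n : nat).

Definition affine_vanish (P : {mpoly K[n]}) (x : affine_space K n) : Prop :=
  P.@[x] = 0.

Definition affine_open : set (set (affine_space K n)) :=
  zero_locus_open setT affine_vanish.

Let van1 : exists2 P, [set: {mpoly K[n]}] P & forall x, ~ affine_vanish P x.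
Proof.
by exists 1 => // x; rewrite /affine_vanish meval1; apply/eqP/oner_neq0.
Qed.

Let vanM (P P' : {mpoly K[n]}) : [set: {mpoly K[n]}] P -> setT P' ->
  exists2 P'', [set: {mpoly K[n]}] P'' &
    forall x, affine_vanish P'' x <-> affine_vanish P x \/ affine_vanish P' x.
Proof.
move=> _ _; exists (P * P') => // x; rewrite /affine_vanish mevalM.
split; first by move/eqP; rewrite mulf_eq0 => /orP[]/eqP; [left|right].
by case=> ->; rewrite ?mul0r ?mulr0.
Qed.

HB.instance Definition _ := gen_eqMixin (affine_space K n).
HB.instance Definition _ := gen_choiceMixin (affine_space K n).
HB.instance Definition _ := isOpenTopological.Build (affine_space K n)
  (zero_locus_openT van1) (zero_locus_openI vanM)
  (@zero_locus_open_bigU _ _ setT affine_vanish).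

End AffineZariski.

(* Polynomial differential forms on K^n: the form with coefficients a is the
   sum over S = {i_1 < ... < i_k} of a S dx_(i_1) /\ ... /\ dx_(i_k). *)
Definition diff_form (K : fieldType) (n : nat) : Type :=
  {ffun {set 'I_n} -> {mpoly K[n]}}.

Definition vector_field (K : fieldType) (n : nat) : Type :=
  {ffun 'I_n -> {mpoly K[n]}}.

HB.instance Definition _ (K : fieldType) (n : nat) :=
  GRing.Lmodule.copy (diff_form K n) {ffun {set 'I_n} -> {mpoly K[n]}}.
HB.instance Definition _ (K : fieldType) (n : nat) :=
  GRing.Lmodule.copy (vector_field K n) {ffun 'I_n -> {mpoly K[n]}}.

Section ExteriorCalculus.
Variables (K : fieldType) (n : nat).
Implicit Types (a b : diff_form K n) (X Y : vector_field K n).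
Implicit Types (f : {mpoly K[n]}) (S : {set 'I_n}).

Definition is_kform (k : nat) a : Prop := forall S, #|S| != k -> a S = 0.

Definition form0 f : diff_form K n :=
  [ffun S : {set 'I_n} => if S == finset.set0 then f else 0].

(* dx_1 /\ ... /\ dx_n *)
Definition volume_form : diff_form K n :=
  [ffun S : {set 'I_n} => if S == finset.setT then 1 else 0].

(* The exponent of -1 counts the inversions between the index sets. *)
Definition wedge a b : diff_form K n :=
  [ffun S : {set 'I_n} => \sum_(I : {set 'I_n} | I \subset S)
     (-1) ^+ #|[set ij in finset.setX I (S :\: I) | (ij.2 < ij.1)%N]%SET|
     * a I * b (S :\: I)%SET].

Definition ext_deriv a : diff_form K n :=
  [ffun S : {set 'I_n} => \sum_(i in S)
     (-1) ^+ #|[set j in S | (j < i)%N]%SET| * (a (S :\ i)%SET)^`M(i)].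

Definition contract X a : diff_form K n :=
  [ffun S : {set 'I_n} => \sum_(i | i \notin S)
     (-1) ^+ #|[set j in S | (j < i)%N]%SET| * X i * a (i |: S)%SET].

Definition lie_bracket X Y : vector_field K n :=
  [ffun i => \sum_j (X j * (Y i)^`M(j) - Y j * (X i)^`M(j))].

Definition radial_field : vector_field K n := [ffun i => 'X_i].

Definition Sing a : set (affine_space K n) := [set x | forall S, (a S).@[x] = 0].

End ExteriorCalculus.

Definition pullback (K : fieldType) (n m : nat)
    (phi : n.-tuple {mpoly K[m]}) (a : diff_form K n) : diff_form K m :=
  \sum_(S : {set 'I_n})
     wedge (form0 (a S \mPo phi))
       (\big[@wedge K m/form0 1]_(i in S) ext_deriv (form0 (tnth phi i))).

Section Foliations.
Variables (K : fieldType) (e : nat).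

Definition foliation_form (Omega : diff_form K 4) : Prop :=
  [/\ is_kform 1 Omega,
      forall i, Omega [set i]%SET \is e.+1.-homog,
      wedge Omega (ext_deriv Omega) = 0,
      contract (@radial_field K 4) Omega = 0 &
      codim_ge 2 (Sing Omega)].

(* A two-dimensional foliation of degree e on P^3: a form as above up to a
   nonzero scalar, i.e. a point of the projective space of 1-forms. *)
Record foliation := Foliation {
  defining_forms : set (diff_form K 4);
  defining_formsP : exists2 Omega, foliation_form Omega &
    defining_forms = [set c *: Omega | c in [set c : K | c != 0]]
}.

(* Homogeneous coordinates on that projective space: the coefficients of the
   monomials of degree at most e + 1 in Omega_1, ..., Omega_4. Those of degree
   less than e + 1 are zero. *)
Definition coord_index := ('I_4 * 'X_{1..4 < e.+2})%type.
Definition ncoords : nat := #|{: coord_index}|.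
Definition coords (Omega : diff_form K 4) : 'I_ncoords -> K :=
  fun k => (Omega [set (enum_val k).1]%SET)@_((enum_val k).2).

Definition homogeneous : set {mpoly K[ncoords]} :=
  [set P | exists h : nat, P \is h.-homog].

Definition foliation_vanish (P : {mpoly K[ncoords]}) (F : foliation) : Prop :=
  forall Omega, defining_forms F Omega -> P.@[coords Omega] = 0.

Definition foliation_open : set (set foliation) :=
  zero_locus_open homogeneous foliation_vanish.

Lemma coordsZ (c : K) (Omega : diff_form K 4) :
  coords (c *: Omega) =1 fun k => c * coords Omega k.
Proof. by move=> k; rewrite /coords ffunE mcoeffZ. Qed.

Lemma homog_mevalZ m h (P : {mpoly K[m]}) (c : K) (v w : 'I_m -> K) :
  P \is h.-homog -> (forall i, w i = c * v i) -> P.@[w] = c ^+ h * P.@[v].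
Proof.
move=> /dhomogP Ph wE; rewrite !mevalE big_distrr /=.
rewrite big_seq [RHS]big_seq; apply: eq_bigr => u /Ph /= <-.
rewrite mulrCA; congr (_ * _); rewrite mdegE -prodrXr -big_split /=.
by apply: eq_bigr => i _; rewrite wE exprMn.
Qed.

Lemma foliation_vanishP (P : {mpoly K[ncoords]}) (F : foliation) Omega :
  homogeneous P -> defining_forms F Omega ->
  foliation_vanish P F <-> P.@[coords Omega] = 0.
Proof.
move=> [h Ph] FO; split=> [/(_ _ FO)//|P0 O2].
case: F FO => _ /= [O1 _ ->] [c /= c0 eO] [c' _ <-].
rewrite (homog_mevalZ Ph (coordsZ _ _)).
move: P0; rewrite -eO (homog_mevalZ Ph (coordsZ _ _)) => /eqP.
by rewrite mulf_eq0 expf_eq0 (negPf c0) andbF /= => /eqP ->; rewrite mulr0.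
Qed.

Lemma defining_forms_neq0 (F : foliation) : exists Omega, defining_forms F Omega.
Proof.
case: F => _ /= [O1 _ ->]; exists O1, 1; first exact: oner_neq0.
by rewrite scale1r.
Qed.

Let van1 : exists2 P, homogeneous P & forall F, ~ foliation_vanish P F.
Proof.
exists 1; first by exists 0%N; exact: dhomog1.
move=> F; have [O FO] := defining_forms_neq0 F.
by move=> /(_ _ FO) /eqP; rewrite meval1 oner_eq0.
Qed.

Let vanM (P P' : {mpoly K[ncoords]}) : homogeneous P -> homogeneous P' ->
  exists2 P'', homogeneous P'' & forall F,
    foliation_vanish P'' F <-> foliation_vanish P F \/ foliation_vanish P' F.
Proof.
move=> hP hP'; have [h Ph] := hP; have [h' Ph'] := hP'.
have hPP : homogeneous (P * P') by exists (h + h')%N; exact: dhomogM.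
exists (P * P') => // F; have [O FO] := defining_forms_neq0 F.
split.
  move/(foliation_vanishP hPP FO)/eqP; rewrite mevalM mulf_eq0.
  case/orP=> /eqP P0; [left|right].
    exact/(foliation_vanishP hP FO).
  exact/(foliation_vanishP hP' FO).
by move=> PF; apply/(foliation_vanishP hPP FO); rewrite mevalM;
  case: PF => /(_ _ FO) ->; rewrite ?mul0r ?mulr0.
Qed.

HB.instance Definition _ := gen_eqMixin foliation.
HB.instance Definition _ := gen_choiceMixin foliation.
HB.instance Definition _ := isOpenTopological.Build foliation
  (zero_locus_openT van1) (zero_locus_openI vanM)
  (@zero_locus_open_bigU _ _ homogeneous foliation_vanish).

End Foliations.

Section QuasiHomogeneous.
Variable K : fieldType.

(* (x_1, x_2, x_3) |-> A (x_1, x_2, x_3, 1): a lift to K^4 of the affine chart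
   obtained by composing with the automorphism of P^3 induced by A *)
Definition chart (A : 'M[K]_4) : 4.-tuple {mpoly K[3]} :=
  [tuple \sum_(j < 4) A i j *: oapp (fun l : 'I_3 => 'X_l) 1 (unlift ord_max j)
     | i < 4].

(* p x_1 d/dx_1 + q x_2 d/dx_2 + r x_3 d/dx_3 *)
Definition diag_field (p q r : nat) : vector_field K 3 :=
  [ffun i => (tnth [tuple p; q; r] i)%:R *: 'X_i].

(* F(p, q, r; lambda, e). Since the zero set of Omega has codimension at least
   two, a form without divisorial zeros defines the same foliation as the
   pullback of Omega iff it is a nonzero scalar multiple of that pullback, and
   the scalar is absorbed in the choice of Omega. *)
Definition quasi_homogeneous_foliations (p q r : nat) (lambda : int) (e : nat) :
    set (foliation K e) :=
  [set F | exists A : 'M[K]_4, A \in unitmx /\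
     exists2 Omega, defining_forms F Omega &
     exists2 X : vector_field K 3,
       lie_bracket (diag_field p q r) X = lambda%:~R *: X &
       pullback (chart A) Omega
       = contract (diag_field p q r) (contract X (@volume_form K 3))].

End QuasiHomogeneous.

(* Main.v *)
(* Let Omega define a member of the family and let P be an equation of the
   family. Suppose that every solution tau of the equations of foliations
   linearized at Omega is the velocity at Omega of a curve in the family, obtained
   by moving the chart and the field X. Then the leading form of P at Omega
   vanishes on all tau, so it lies in the ideal of the linear parts of the
   equations, and subtracting a combination of the equations raises the order of
   P; by induction P lies in every power of the maximal ideal at Omega, modulo
   the equations. By Krull's intersection theorem sP is a combination of the
   equations for some s with s(Omega) != 0. Hence P vanishes on every irreducible
   set of foliations containing the family.

   Both requirements on Omega are finite computations for one explicit integral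
   form per weight: the tangency of all tau is a rank condition on an integer
   matrix, and the singular set has codimension at least 2 because two
   combinations of the coefficients have a nonzero resultant on a line. *)

(* The scheme cut out by the equations is not known in advance to be reduced at Omega, and no
   dimension is computed: the equality of two linear spaces, the solutions of the linearized
   equations and the velocities of curves in the family, does the work of a dimension count. The
   curves are polynomial in t, given by a matrix A(t) and a form f(t) in a vector space attached to
   the weights; membership in the family can fail only where det A(t) times one resultant vanishes,
   so an equation of the family vanishes identically along such a curve as soon as this product is
   nonzero at one t. Omega itself provides that point. The multiplier s has no reason to be
   homogeneous, whereas closed sets of foliations are cut out by homogeneous equations; it is
   replaced by a homogeneous component that does not vanish at Omega. On the arithmetic side,
   elimination serves only to conclude that unknowns are zero. A successful run over the integers is
   therefore a certificate valid over every [numFieldType], in particular over the complex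
   numbers. *)
Require Import Defs.
From Stdlib Require Import ZArith.
From HB Require Import structures.
From mathcomp Require Import all_boot all_order all_algebra.
From mathcomp Require Import boolp classical_sets reals topology_structure.
From mathcomp Require Import complex mpoly.
From mathcomp Require Import zify ssrZ ring.

Set Implicit Arguments.
Unset Strict Implicit.
Unset Printing Implicit Defensive.
Import Order.TTheory GRing.Theory Num.Theory.

(** * Integer linear algebra *)

(* A row is a linear form with integer coefficients in unknowns indexed by keys. *)
Definition row : Type := seq (seq nat * Z).

Fixpoint row_add (k : seq nat) (c : Z) (r : row) : row :=
  match r with
  | [::] => if Z.eqb c Z0 then [::] else [:: (k, c)]
  | (k', c') :: r' =>
    if k == k' then
      let s := Z.add c c' in if Z.eqb s Z0 then r' else (k, s) :: r'
    else (k', c') :: row_add k c r'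
  end.

Definition row_collect (r : row) : row := foldr (fun x => row_add x.1 x.2) [::] r.

Definition row_comb (a : Z) (r : row) (b : Z) (s : row) : row :=
  foldr (fun x => row_add x.1 (Z.mul a x.2)) [seq (x.1, Z.mul b x.2) | x <- s] r.

(** Dividing by the content keeps the integers small in the course of elimination. *)
Definition row_primitive (r : row) : row :=
  let g := foldr (fun x => Z.gcd x.2) Z0 r in
  if Z.eqb g Z0 then r else [seq (x.1, Z.div x.2 g) | x <- r].

Fixpoint row_split (k : seq nat) (r : row) : Z * row :=
  match r with
  | [::] => (Z0, [::])
  | (k', c) :: r' =>
    if k == k' then (c, r')
    else let: (c0, r0) := row_split k r' in (c0, (k', c) :: r0)
  end.

Fixpoint find_pivot (k : seq nat) (rs : seq row) : option (Z * row * seq row) :=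
  match rs with
  | [::] => None
  | r :: rs' =>
    let: (c, r') := row_split k r in
    if Z.eqb c Z0 then
      if find_pivot k rs' is Some (p, rs'') then Some (p, r :: rs'') else None
    else Some (c, r', rs')
  end.

Definition eliminate (k : seq nat) (c : Z) (p r : row) : row :=
  let: (c', r') := row_split k r in
  if Z.eqb c' Z0 then r else row_primitive (row_comb c r' (Z.opp c') p).

(* Gaussian elimination: the unknowns left without a pivot. *)
Fixpoint free_keys (ks : seq (seq nat)) (rs : seq row) : seq (seq nat) :=
  match ks with
  | [::] => [::]
  | k :: ks' =>
    match find_pivot k rs with
    | Some (c, p, rs') =>
      if all (fun x => x.1 \in ks') p
      then free_keys ks' [seq r <- [seq eliminate k c p r | r <- rs'] | ~~ nilp r]
      else k :: free_keys ks' rs'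
    | None => k :: free_keys ks' rs
    end
  end.

(** * Forms and linearized equations as lists of integer monomials *)

Definition exp_add (s t : seq nat) : seq nat := mkseq (fun i => nth 0 s i + nth 0 t i)%N 4.
Definition exp_unit (i : nat) : seq nat := mkseq (fun j => nat_of_bool (i == j)) 4.
Definition exp_sub (s t : seq nat) : option (seq nat) :=
  if all (fun i => nth 0 t i <= nth 0 s i)%N (iota 0 4)
  then Some (mkseq (fun i => nth 0 s i - nth 0 t i)%N 4) else None.

(** The fourth weight belongs to the homogenizing coordinate: S is extended to C^4 with eigenvalue 0
    on it. *)
Definition weights (p q r : nat) : seq nat := [:: p; q; r; 0].

(* With R the radial field, S the diagonal one and X = x^n d/dx_c, the
   contraction of the volume form by R, S, X has dx_i-component
   (w_b - w_a) x_a x_b x^n, where (i, c, a, b) is the entry of this table. *)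
Definition faces : seq (nat * nat * (nat * nat)) :=
  [:: (0, 3, (1, 2)); (0, 1, (2, 3)); (0, 2, (3, 1));
      (1, 3, (2, 0)); (1, 0, (3, 2)); (1, 2, (0, 3));
      (2, 3, (0, 1)); (2, 0, (1, 3)); (2, 1, (3, 0));
      (3, 2, (1, 0)); (3, 0, (2, 1)); (3, 1, (0, 2))]%N.

Definition monomial_form (w : seq nat) (n : seq nat) (c : nat) : row :=
  [seq (x.1.1 :: exp_add n (exp_add (exp_unit x.2.1) (exp_unit x.2.2)),
        Z.sub (Z.of_nat (nth 0 w x.2.2)) (Z.of_nat (nth 0 w x.2.1)))
    | x <- faces & x.1.2 == c].

Fixpoint exponents (k d : nat) : seq (seq nat) :=
  match k with
  | 0 => if d is 0 then [:: [::]] else [::]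
  | k'.+1 => flatten [seq [seq (d - a)%N :: m | m <- exponents k' a] | a <- iota 0 d.+1]
  end.

(** The monomial fields x^n d/dx_c of degree [d] on C^4 with [S, x^n d/dx_c] = l x^n d/dx_c: the
    bracket multiplies by the weight of x^n minus that of x_c. *)
Definition weight_basis (p q r l d : nat) : seq (seq nat * nat) :=
  [seq x <- [seq (n, c) | n <- exponents 4 d, c <- iota 0 4] |
    p * nth 0 x.1 0 + q * nth 0 x.1 1 + r * nth 0 x.1 2 == l + nth 0 (weights p q r) x.2]%N.

(* The powers of 2 make this member general enough for all the weights considered. *)
Definition base_form (p q r l d : nat) : row :=
  let B := weight_basis p q r l d in
  row_collect (flatten [seq
    [seq (y.1, Z.mul (Z.pow 2 (Z.of_nat x.1)) y.2)
      | y <- monomial_form (weights p q r) x.2.1 x.2.2] | x <- zip (iota 0 (size B)) B]).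

(** Indices above 3 are folded to 3, in agreement with [o4], which interprets them in ['I_4]. *)
Definition component (j : nat) (V : row) : row :=
  [seq (behead x.1, x.2) | x <- V & minn (head 0 x.1) 3 == j].

Definition poly_deriv (k : nat) (P : row) : row :=
  flatten [seq (if exp_sub x.1 (exp_unit k) is Some t
                then [:: (t, Z.mul (Z.of_nat (nth 0 x.1 k)) x.2)] else [::]) | x <- P].

Definition poly_opp (P : row) : row := [seq (x.1, Z.opp x.2) | x <- P].

(* The coefficient of the monomial m in the product of P by a polynomial g, where
   f n c stands for c times the coefficient of n in g. *)
Definition mul_row (P : row) (m : seq nat) (f : seq nat -> Z -> seq nat * Z) : row :=
  flatten [seq (if exp_sub m x.1 is Some n then [:: f n x.2] else [::]) | x <- P].

Definition radial_row (m : seq nat) : row :=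
  flatten [seq (if exp_sub m (exp_unit i) is Some n then [:: (i :: n, Zpos xH)] else [::])
          | i <- iota 0 4].

(** One cyclic term of Omega /\ d eta + eta /\ d Omega: the coefficient of x^m in O (d_b eta_c - d_c
    eta_b) + Q eta_a, as a linear form in the coefficients of eta. The factor n_b + 1 comes from
    differentiating x^n x_b. *)
Definition wedge_row (O Q : row) (m : seq nat) (a b c : nat) : row :=
  mul_row O m (fun n z => (c :: exp_add n (exp_unit b), Z.mul z (Z.of_nat (nth 0 n b).+1)))
  ++ mul_row O m (fun n z => (b :: exp_add n (exp_unit c),
                              Z.opp (Z.mul z (Z.of_nat (nth 0 n c).+1))))
  ++ mul_row Q m (fun n z => (a :: n, z)).

(** The linearization at [V] of the coefficient of dx_0 /\ dx_1 /\ dx_2 in Omega /\ d Omega; [Q0],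
    [Q1], [Q2] are the components of the curl of [V]. *)
Definition integrability_rows (V : row) (d : nat) : seq row :=
  let O0 := component 0 V in let O1 := component 1 V in let O2 := component 2 V in
  let Q0 := poly_deriv 1 O2 ++ poly_opp (poly_deriv 2 O1) in
  let Q1 := poly_deriv 2 O0 ++ poly_opp (poly_deriv 0 O2) in
  let Q2 := poly_deriv 0 O1 ++ poly_opp (poly_deriv 1 O0) in
  [seq row_collect (wedge_row O0 Q0 m 0 1 2 ++ wedge_row O1 Q1 m 1 2 0 ++ wedge_row O2 Q2 m 2 0 1)
    | m <- exponents 4 d].

(* The key i :: n stands for the coefficient of x^n dx_i. *)
Definition form_keys (d : nat) : seq (seq nat) := [seq i :: n | i <- iota 0 4, n <- exponents 4 d].

Definition lie_form (V : row) (k l : nat) : row :=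
  flatten [seq [seq (j :: exp_add x.1 (exp_unit l), x.2) | x <- poly_deriv k (component j V)]
           ++ (if j == l then [seq (j :: x.1, x.2) | x <- component k V] else [::])
          | j <- iota 0 4].

Definition proper_key (k : seq nat) : bool := (size k == 5) && (head 0 k < 4)%N.

(* The coordinates in C determine a solution of the linearized equations; the
   last test says that the tangent vectors J to the family attain all values there. *)
Definition tangent_check (p q r l d : nat) : bool :=
  let V := base_form p q r l d in
  let C := free_keys (form_keys d.+2)
             ([seq radial_row m | m <- exponents 4 d.+3] ++ integrability_rows V (d + d).+3) in
  let J := [seq monomial_form (weights p q r) x.1 x.2 | x <- weight_basis p q r l d]
           ++ [seq lie_form V k i | k <- iota 0 4, i <- iota 0 4] in
  [&& uniq C, all proper_key C, all (all (fun x => proper_key x.1)) J &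
      nilp (free_keys C [seq row_collect [seq x <- T | x.1 \in C] | T <- J])].

Fixpoint list_add (s t : seq Z) : seq Z :=
  match s, t with
  | [::], _ => t
  | _, [::] => s
  | x :: s', y :: t' => Z.add x y :: list_add s' t'
  end.

Definition list_scale (c : Z) (s : seq Z) : seq Z := [seq Z.mul c x | x <- s].

(* Coefficients on the line t |-> (1, 1, 1, 1) + t (1, 2, 3, 5). *)
Definition direction : seq nat := [:: 1; 2; 3; 5].

Definition line_monomial (n : seq nat) : seq Z :=
  foldr (fun i s => iter (nth 0 n i) (fun s =>
    list_add s (Z0 :: list_scale (Z.of_nat (nth 0 direction i)) s)) s) [:: Zpos xH] (iota 0 4).

Definition line_coefs (c : seq nat) (V : row) : seq Z :=
  foldr (fun x s => list_add (list_scale (Z.mul (Z.of_nat (nth 0 c (minn (head 0 x.1) 3))) x.2)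
    (line_monomial (behead x.1))) s) [::] V.

(** The rows of the Sylvester matrix, read as homogeneous equations in the unknowns [[:: b]]: the
    resultant is nonzero once elimination leaves no free unknown. *)
Definition sylvester_rows (D : nat) (s t : seq Z) : seq row :=
  [seq row_collect [seq ([:: b], nth Z0 (nseq k Z0 ++ u) b) | b <- iota 0 (D + D)]
    | u <- [:: s; t], k <- iota 0 D].

(** With [direction], small integers that are generic enough for all the weights considered;
    [line_check] certifies this case by case. *)
Definition combo1 : seq nat := [:: 1; 2; 0; 1].
Definition combo2 : seq nat := [:: 0; 1; 1; 3].

Definition line_check (D : nat) (V : row) : bool :=
  nilp (free_keys [seq [:: b] | b <- iota 0 (D + D)]
          (sylvester_rows D (line_coefs combo1 V) (line_coefs combo2 V))).

(** Here [d] is the degree of the homogeneous field on C^4: the foliation has degree d + 1 and the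
    coefficients of its form have degree d + 2. *)
Definition component_check (p q r l d : nat) : bool :=
  [&& ~~ nilp (weight_basis p q r l d), tangent_check p q r l d &
      line_check d.+2 (base_form p q r l d)].

Local Open Scope classical_set_scope.
Local Open Scope ring_scope.

(** * Hilbert basis theorem *)

Section Span.
Variable A : comNzRingType.
Implicit Types (g : nat -> A) (p q : A).

Definition in_span g m p := exists c : nat -> A, p = \sum_(i < m) c i * g i.

Lemma in_span0 g m : in_span g m 0.
Proof. by exists (fun=> 0); rewrite big1 // => i _; rewrite mul0r. Qed.

Lemma in_spanD g m p q : in_span g m p -> in_span g m q -> in_span g m (p + q).
Proof.
move=> [c ->] [d ->]; exists (fun i => c i + d i).
by rewrite -big_split; apply: eq_bigr => i _; rewrite mulrDl.
Qed.

Lemma in_spanM g m a p : in_span g m p -> in_span g m (a * p).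
Proof.
move=> [c ->]; exists (fun i => a * c i).
by rewrite mulr_sumr; apply: eq_bigr => i _; rewrite mulrA.
Qed.

Lemma in_span_sum g m (I : Type) (r : seq I) (P : pred I) (F : I -> A) :
  (forall i, P i -> in_span g m (F i)) -> in_span g m (\sum_(i <- r | P i) F i).
Proof. by move=> h; elim/big_ind: _ => //; [exact: in_span0|exact: in_spanD]. Qed.

Lemma in_span_gen g m i : (i < m)%N -> in_span g m (g i).
Proof.
move=> im; exists (fun j => (j == i)%:R).
rewrite (bigD1 (Ordinal im)) //= eqxx mul1r big1 ?addr0 // => j.
by rewrite -val_eqE /= => /negPf ->; rewrite mul0r.
Qed.

Lemma in_span_trans g m h n p :
  (forall i, (i < m)%N -> in_span h n (g i)) -> in_span g m p -> in_span h n p.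
Proof. by move=> gh [c ->]; apply: in_span_sum => i _; apply/in_spanM/gh. Qed.

Lemma in_span_le g m n p : (m <= n)%N -> in_span g m p -> in_span g n p.
Proof.
by move=> mn; apply: in_span_trans => i im; exact/in_span_gen/(leq_trans im).
Qed.

End Span.

(** The ascending chain condition, phrased for sequences: Krull's theorem is obtained by applying it
    to a sequence of graded lifts. *)
Definition noetherian (A : comNzRingType) :=
  forall f : nat -> A, exists m, in_span f m (f m).

Lemma noetherian_field (K : fieldType) : noetherian K.
Proof.
move=> f; have [f0|f0] := eqVneq (f 0%N) 0.
  by exists 0%N; rewrite f0; exact: in_span0.
exists 1%N, (fun=> f 1%N / f 0%N); by rewrite big_ord1 divfK.
Qed.

Lemma noetherian_surj (A B : comNzRingType) (phi : {rmorphism A -> B}) :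
  (forall b, exists a, phi a = b) -> noetherian A -> noetherian B.
Proof.
move=> /choice[psi psiK] nA f; have [m [c e]] := nA (psi \o f).
exists m, (phi \o c); rewrite -[f m]psiK -/((psi \o f) m) e rmorph_sum.
by apply: eq_bigr => i _; rewrite rmorphM /= psiK.
Qed.

Section HilbertBasis.
Variables (A : comNzRingType) (f : nat -> {poly A}).
Hypothesis nA : noetherian A.
Hypothesis fn : forall m, ~ in_span f m (f m).

Let I p := exists m, in_span f m p.

(** Hilbert's minimal choice: an element of the ideal [I] of least size among those outside the
    ideal generated by [s]. *)
Let least (s : seq {poly A}) p :=
  [/\ I p, ~ in_span (nth 0 s) (size s) p &
      forall q, I q -> ~ in_span (nth 0 s) (size s) q -> (size p <= size q)%N].

(** A finite [s] in [I] lies in the span of the first [M] terms of [f] for some [M], and [f M] is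
    not in that span, so the set to be minimized over is nonempty. *)
Let least_ex s : exists p, (forall x, x \in s -> I x) -> least s p.
Proof.
have [sI|] := pselect (forall x, x \in s -> I x); last first.
  by move=> h; exists 0 => /h.
have [M sM] : exists M, forall x, x \in s -> in_span f M x.
  elim: s sI => [|x s IHs] sI; first by exists 0%N.
  have [|M hM] := IHs; first by move=> y ys; apply: sI; rewrite inE ys orbT.
  have [N xN] : I x by apply: sI; rewrite mem_head.
  exists (maxn M N) => y; rewrite inE => /predU1P[->|/hM].
    exact/in_span_le/xN/leq_maxr.
  exact/in_span_le/leq_maxl.
pose P n := `[< exists p, [/\ I p, ~ in_span (nth 0 s) (size s) p & size p = n] >].
have exP : exists n, P n.
  exists (size (f M)); apply/asboolP; exists (f M); split=> //.
    by exists M.+1; exact: in_span_gen.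
  move=> sf; apply: (fn (m := M)); apply: in_span_trans sf => i im.
  exact/sM/mem_nth.
case: (ex_minnP exP) => n /asboolP[p [Ip sp <-]] pmin.
exists p => _; split=> // q Iq sq; apply: pmin; apply/asboolP.
by exists q.
Qed.

(** The leading coefficients of the successive minimal choices [g k] lie in a Noetherian ring, so
    that of some [g m] is a combination of the earlier ones. Cancelling the leading term of [g m]
    gives a smaller element of [I] that is still outside the span, against minimality. *)
Lemma hilbert_contra : False.
Proof.
have [pick pickP] := choice least_ex.
(* [G k] lists the first [k] choices, so that each new choice depends on all previous ones. *)
pose G := fix G k := if k is k'.+1 then rcons (G k') (pick (G k')) else [::].
pose g k := pick (G k).
have GE k : G k = mkseq g k.
  elim: k => // k IHk; rewrite [LHS]/= -/(g k) IHk.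
  by rewrite /mkseq -(addn1 k) iotaD map_cat cats1.
have gP k : least (mkseq g k) (g k).
  rewrite -GE; elim: k {-2}k (leqnn k) => [|n IHn] k.
    by rewrite leqn0 => /eqP->; apply: pickP.
  move=> kn; apply: pickP => x; rewrite GE => /mapP[j].
  rewrite mem_iota => /andP[_ jk] ->.
  by case: (IHn j) => //; rewrite -ltnS (leq_trans jk).
have spE k p : in_span (nth 0 (mkseq g k)) (size (mkseq g k)) p <-> in_span g k p.
  rewrite size_mkseq; split=> -[c ->]; exists c; apply: eq_bigr => i _;
    by rewrite nth_mkseq.
have [m [c e]] := nA (lead_coef \o g).
have gle i : (i <= m)%N -> (size (g i) <= size (g m))%N.
  move=> im; have [_ _] := gP i; apply; first by case: (gP m).
  by case: (gP m) => _ + _; apply: contra_not => /spE/(in_span_le im)/spE.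
(* The sizes of the [g i] do not decrease, so a power of X brings [g i] to the degree of [g m], and
   the leading term of [g m] cancels in [h]. *)
pose q i := (c i)%:P * 'X^(size (g m) - size (g i)).
pose h := g m - \sum_(i < m) q i * g i.
have qs : in_span g m (\sum_(i < m) q i * g i) by exists q.
have gm : ~ in_span g m (g m) by case: (gP m) => _ + _; apply: contra_not => /spE.
have hn : ~ in_span g m h.
  by move=> hs; apply: gm; rewrite -[g m](subrK (\sum_(i < m) q i * g i)); exact: in_spanD.
have Ih : I h.
  have gI i : I (g i) by case: (gP i).
  have /choice[M gM] := gI.
  pose N := (\max_(i < m.+1) M i)%N.
  have gN i : (i < m.+1)%N -> in_span f N (g i).
    by move=> im; apply: in_span_le (gM i); exact: (leq_bigmax (Ordinal im)).
  exists N; apply: in_spanD; first exact: gN.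
  rewrite -mulN1r; apply/in_spanM/(in_span_trans _ qs) => i im.
  by apply: gN; apply: ltnW.
have [_ _ /(_ h Ih)] := gP m; have hn' := hn; rewrite -spE in hn' => /(_ hn').
have gm0 : g m != 0 by apply/eqP => g0; apply: gm; rewrite g0; exact: in_span0.
rewrite leqNgt => /negP; apply.
have [n sE] : exists n, size (g m) = n.+1.
  by exists (size (g m)).-1; rewrite prednK ?size_poly_gt0.
have gle' i : (i <= m)%N -> (size (g i) <= n.+1)%N by rewrite -sE; exact: gle.
rewrite sE ltnS; apply/leq_sizeP => j nj; rewrite coefB coef_sum.
move: nj; rewrite leq_eqVlt => /predU1P[<-|nj].
  rewrite -[n]/(n.+1.-1) -sE -lead_coefE [lead_coef _]e.
  rewrite -sumrB big1 // => i _.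
  rewrite /q -mulrA coefCM coefXnM /= sE.
  have si := gle' i (ltnW (ltn_ord i)).
  have gi0 : g i != 0.
    apply/eqP => g0; case: (gP i) => _ + _; apply; rewrite g0; exact: in_span0.
  have sp : (0 < size (g i))%N by rewrite size_poly_gt0.
  have -> : (n < n.+1 - size (g i))%N = false by lia.
  have -> : (n - (n.+1 - size (g i)))%N = (size (g i)).-1 by lia.
  by rewrite lead_coefE subrr.
rewrite [(g m)`_j]nth_default ?sE // sub0r big1 ?oppr0 // => i _.
rewrite /q -mulrA coefCM coefXnM; case: ifP => _; rewrite ?mulr0 //.
rewrite [(g i)`_ _]nth_default ?mulr0 //.
have si := gle' i (ltnW (ltn_ord i)).
rewrite sE; move: si; set s := size _ => si; lia.
Qed.

End HilbertBasis.

Lemma noetherian_poly (A : comNzRingType) : noetherian A -> noetherian {poly A}.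
Proof.
move=> nA f; apply: contrapT => fn.
by apply: (@hilbert_contra A f nA) => m fm; apply: fn; exists m.
Qed.

(** The ring in n + 1 variables is the image of polynomials in one variable over the ring in n
    variables, that variable being sent to the last one. *)
Lemma noetherian_mpoly (K : fieldType) n : noetherian {mpoly K[n]}.
Proof.
elim: n => [|n IHn].
  apply: (noetherian_surj (phi := @mpolyC 0 K)); last exact: noetherian_field.
  by move=> b; exists b@_0%MM; rewrite [RHS]nvar0_mpolyC.
pose phi : {rmorphism {poly {mpoly K[n]}} -> {mpoly K[n.+1]}} :=
  horner_eval 'X_ord_max \o map_poly (@mwiden n K).
apply: (noetherian_surj (phi := phi)); last exact: noetherian_poly.
pose im p := exists a, phi a = p.
have imM p q : im p -> im q -> im (p * q).
  by move=> [a <-] [b <-]; exists (a * b); rewrite rmorphM.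
have im1 : im 1 by exists 1; rewrite rmorph1.
have imC c : im c%:MP.
  by exists (c%:MP)%:P; rewrite /= map_polyC /horner_eval hornerC /= mwidenC.
have imX i : im 'X_i.
  case: (unliftP ord_max i) => [j|] ->.
    exists ('X_j)%:P; rewrite /= map_polyC /horner_eval hornerC /= mwidenX.
    by rewrite mnmwiden1; congr 'X_[_]; apply/mnmP => k; congr (U_(_)%MM k);
      apply/val_inj; rewrite /= /bump leqNgt ltn_ord.
  by exists 'X; rewrite /= map_polyX /horner_eval hornerX.
move=> p; rewrite (mpolyE p) -/(im _).
elim/big_ind: _ => [|x y [a <-] [b <-]|m _].
- by exists 0; rewrite rmorph0.
- by exists (a + b); rewrite rmorphD.
- rewrite -mul_mpolyC; apply/imM => //; rewrite mpolyXE_id.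
  apply: big_ind => // i _; elim: (m i) => [|k IHk]; first by rewrite expr0.
  by rewrite exprS; apply: imM.
Qed.

(** * Evaluation, composition and derivatives of polynomials *)

Lemma poly_nonroot_nat (K : numFieldType) (p : {poly K}) :
  p != 0 -> exists k : nat, p.[k%:R] != 0.
Proof.
move=> p0; apply: contrapT => /forallNP h.
pose s := [seq k%:R : K | k <- iota 0 (size p)].
have /(max_poly_roots p0) : all (root p) s.
  by apply/allP => _ /mapP[k _ ->]; apply/negPn/negP/h.
rewrite size_map size_iota ltnn map_inj_uniq ?iota_uniq => [/(_ isT)//|i j /eqP].
by rewrite eqr_nat => /eqP.
Qed.

Lemma poly_eq0_horner (K : numFieldType) (p : {poly K}) :
  (forall t, p.[t] = 0) -> p = 0.
Proof.
move=> h; apply/eqP/negPn/negP => /poly_nonroot_nat[k].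
by rewrite h eqxx.
Qed.

Section Mpoly.
Variable K : comNzRingType.

Lemma meval_muni n (p : {mpoly K[n.+1]}) (x : 'I_n.+1 -> K) :
  p.@[x] = (map_poly (meval (fun i : 'I_n => x (widen_ord (leqnSn n) i))) (muni p)).[x ord_max].
Proof.
rewrite muniE rmorph_sum horner_sum mevalE; apply: eq_bigr => m _.
rewrite /= map_polyZ hornerZ map_polyXn hornerXn /= mevalZ mevalX -mulrA; congr (_ * _).
rewrite big_ord_recr; congr (_ * _).
by apply: eq_bigr => i _; rewrite mnmE.
Qed.

Lemma muni_eq0 n (p : {mpoly K[n.+1]}) : muni p = 0 -> p = 0.
Proof.
move=> p0; apply/mpolyP => m; rewrite mcoeff0.
pose m' := [multinom m (widen_ord (leqnSn n) i) | i < n].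
have : ((muni p)`_(m ord_max))@_m' = 0 by rewrite p0 coef0 mcoeff0.
rewrite muniE coef_sum raddf_sum /=.
have [mp|/memN_msupp_eq0 //] := boolP (m \in msupp p).
rewrite (bigD1_seq m) ?msupp_uniq //= coefZ coefXn eqxx mulr1 mcoeffZ mcoeffX eqxx mulr1.
rewrite big1 ?addr0 // => u um.
rewrite coefZ coefXn; case: eqP => [e|]; last by rewrite mulr0 mcoeff0.
rewrite mulr1 mcoeffZ mcoeffX; case: eqP => [e'|]; last by rewrite mulr0.
case/eqP: um; apply/mnmP => i; case: (unliftP ord_max i) => [j|] -> //.
have := congr1 (fun v : 'X_{1..n} => v j) e'; rewrite !mnmE.
by suff -> : widen_ord (leqnSn n) j = lift ord_max j by [];
  apply/val_inj; rewrite /= /bump leqNgt ltn_ord.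
Qed.

Lemma comp_mpolyA n k l (p : {mpoly K[n]}) (t : n.-tuple {mpoly K[k]})
    (u : k.-tuple {mpoly K[l]}) :
  (p \mPo t) \mPo u = p \mPo [tuple tnth t i \mPo u | i < n].
Proof.
elim/mpolyind: p => [|c m p _ _ IHp]; first by rewrite !comp_mpoly0.
rewrite !comp_mpolyD IHp; congr (_ + _).
rewrite !comp_mpolyZ !comp_mpolyX rmorph_prod; congr (_ *: _).
by apply: eq_bigr => i _; rewrite rmorphXn tnth_mktuple.
Qed.

Lemma mderiv_comp n k (p : {mpoly K[n]}) (t : n.-tuple {mpoly K[k]}) (j : 'I_k) :
  (p \mPo t)^`M(j) = \sum_i (p^`M(i) \mPo t) * (tnth t i)^`M(j).
Proof.
elim/mpolyind: p => [|c m p _ _ IHp].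
  by rewrite comp_mpoly0 mderiv0 big1 // => i _; rewrite mderiv0 comp_mpoly0 mul0r.
rewrite comp_mpolyD mderivD IHp.
under [in RHS]eq_bigr => i _ do rewrite mderivD comp_mpolyD mulrDl.
rewrite big_split /=; congr (_ + _) => {p IHp}.
rewrite comp_mpolyZ mderivZ.
under eq_bigr => i _ do rewrite mderivZ comp_mpolyZ -scalerAl.
rewrite -scaler_sumr; congr (_ *: _).
have [d] := ubnP (mdeg m); elim: d m => // d IHd m md.
have [->|m0] := eqVneq m 0%MM.
  rewrite mpolyX0 comp_mpoly1 -[1]/(1%:MP) mderivC big1 // => i _.
  by rewrite -[1]/(1%:MP) mderivC comp_mpoly0 mul0r.
have [i mi] : exists i, m i != 0%N.
  apply/existsP; apply: contraNT m0; rewrite negb_exists => /forallP h.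
  by apply/eqP/mnmP => i; rewrite mnm0E; apply/eqP; move: (h i); rewrite negbK.
have em : m = (U_(i) + (m - U_(i)))%MM by rewrite addmC submK // lep1mP.
have {}md : (mdeg (m - U_(i)) < d)%N.
  by move: md; rewrite {1}em mdegD mdeg1; lia.
rewrite {}em; move: {m m0 mi}(_ - _)%MM md => m /IHd IHm.
rewrite mpolyXD rmorphM /= mderivM IHm comp_mpolyXU -tnth_nth.
under [RHS]eq_bigr => l _ do rewrite mderivM rmorphD !rmorphM /= mulrDl.
rewrite big_split /=; congr (_ + _).
  rewrite (bigD1 i) //= big1 => [|l li]; rewrite mderivX.
    have -> : (U_(i) - U_(i) = 0)%MM by apply/mnmP => k'; rewrite !mnmE subnn.
    by rewrite mnmE eqxx scale1r mpolyX0 rmorph1 mul1r addr0 mulrC.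
  by rewrite mnmE eq_sym (negPf li) scale0r comp_mpoly0 !mul0r.
rewrite mulr_sumr; apply: eq_bigr => l _.
by rewrite comp_mpolyXU -tnth_nth mulrA.
Qed.

Lemma meval0_mcoeff n (p : {mpoly K[n]}) : p.@[fun=> 0] = p@_0%MM.
Proof.
elim/mpolyind: p => [|c m p _ _ IHp]; first by rewrite meval0 mcoeff0.
rewrite mevalD mcoeffD IHp mevalZ mcoeffZ; congr (_ * _ + _).
rewrite mevalX mcoeffX; have [->|m0] := eqVneq.
  by rewrite big1 // => i _; rewrite mnm0E.
have [i mi] : exists i, m i != 0%N.
  apply/existsP; apply: contraNT m0; rewrite negb_exists => /forallP h.
  by apply/eqP/mnmP => i; rewrite mnm0E; apply/eqP; move: (h i); rewrite negbK.
by rewrite (bigD1 i) //= expr0n (negPf mi) mul0r.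
Qed.

End Mpoly.

Lemma mpoly_eq0_meval (K : numFieldType) n (p : {mpoly K[n]}) :
  (forall x, p.@[x] = 0) -> p = 0.
Proof.
elim: n p => [|n IHn] p p0.
  have := p0 (fun=> 0); rewrite meval0_mcoeff => e.
  by rewrite [p]nvar0_mpolyC e.
apply: muni_eq0; apply/polyP => k; rewrite coef0; apply: IHn => x.
have /poly_eq0_horner h : forall t, (map_poly (meval x) (muni p)).[t] = 0.
  move=> t; pose y (i : 'I_n.+1) := oapp x t (unlift ord_max i).
  have := p0 y; rewrite meval_muni {2}/y unlift_none /= => e.
  rewrite -[RHS]e; congr (_.[_]); apply: eq_map_poly => q.
  apply: meval_eq => i; rewrite /y.
  have -> : widen_ord (leqnSn n) i = lift ord_max i.
    by apply/val_inj; rewrite /= /bump leqNgt ltn_ord.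
  by rewrite liftK.
by rewrite -[RHS](coef0 _ k) -h coef_map.
Qed.

(** * Krull's intersection theorem and tangent vectors *)

Section Order.
Variables (K : comNzRingType) (N : nat).
Implicit Types (p q : {mpoly K[N]}).

(** Membership in the k-th power of the maximal ideal of the origin. *)
Definition ord_ge k p := forall m, (mdeg m < k)%N -> p@_m = 0.

Lemma ord_ge0 p : ord_ge 0 p. Proof. by []. Qed.

Lemma ord_ge_zero k : ord_ge k 0. Proof. by move=> m _; rewrite mcoeff0. Qed.

Lemma ord_geW k l p : (k <= l)%N -> ord_ge l p -> ord_ge k p.
Proof. by move=> kl h m mk; apply: h; apply: leq_trans kl. Qed.

Lemma ord_geD k p q : ord_ge k p -> ord_ge k q -> ord_ge k (p + q).
Proof. by move=> hp hq m mk; rewrite mcoeffD hp // hq // addr0. Qed.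

Lemma ord_geZ k c p : ord_ge k p -> ord_ge k (c *: p).
Proof. by move=> hp m mk; rewrite mcoeffZ hp // mulr0. Qed.

Lemma ord_geN k p : ord_ge k p -> ord_ge k (- p).
Proof. by rewrite -scaleN1r; apply: ord_geZ. Qed.

Lemma ord_ge_sum (I : Type) (r : seq I) (P : pred I) (F : I -> {mpoly K[N]}) k :
  (forall i, P i -> ord_ge k (F i)) -> ord_ge k (\sum_(i <- r | P i) F i).
Proof. by move=> h; elim/big_ind: _ => //; [exact: ord_ge_zero|exact: ord_geD]. Qed.

Lemma ord_geM k l p q : ord_ge k p -> ord_ge l q -> ord_ge (k + l) (p * q).
Proof.
move=> hp hq m mkl; rewrite mcoeffM big1 // => -[m1 m2] /= /eqP em.
have [m1k|m1k] := ltnP (mdeg m1) k; first by rewrite hp ?mul0r.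
rewrite hq ?mulr0 //; have := congr1 (@mdeg N) em; rewrite mdegD; lia.
Qed.

Lemma ord_geX m : ord_ge (mdeg m) 'X_[m].
Proof.
move=> u um; rewrite mcoeffX; case: eqP => // e.
by move: um; rewrite e ltnn.
Qed.

Lemma ord_ge_comp n k (p : {mpoly K[n]}) (t : n.-tuple {mpoly K[N]}) :
  (forall i, ord_ge 1 (tnth t i)) ->
  (forall m, (mdeg m < k)%N -> p@_m = 0) -> ord_ge k (p \mPo t).
Proof.
move=> ht hp; rewrite comp_mpolyEX; rewrite big_seq; apply: ord_ge_sum => m mp.
apply: ord_geZ; have km : (k <= mdeg m)%N.
  by rewrite leqNgt; apply/negP => /hp e; move: mp; rewrite mcoeff_msupp e eqxx.
apply: ord_geW km _; rewrite comp_mpolyX mdegE.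
elim/big_rec2: _ => [|i d q _ IH]; first exact: ord_ge0.
apply: ord_geM IH; elim: (m i) => [|e IHe]; first exact: ord_ge0.
by rewrite exprS -add1n; apply: ord_geM.
Qed.

Lemma ord_ge_monomials k (P : {mpoly K[N]} -> Prop) :
  P 0 -> (forall q r, P q -> P r -> P (q + r)) ->
  (forall c m, (k <= mdeg m)%N -> P (c *: 'X_[m])) ->
  forall p, ord_ge k p -> P p.
Proof.
move=> P0 PD PX p hp; rewrite (mpolyE p) big_seq.
apply: big_ind => // m mp; apply: PX.
by rewrite leqNgt; apply/negP => /hp e; move: mp; rewrite mcoeff_msupp e eqxx.
Qed.

(** On monomials, one variable is split off at a time: X_i m - t_i m(t) = (X_i - t_i) m + t_i (m -
    m(t)), and the cofactors lose only one order. *)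
Lemma ord_ge_telescope k p (t : N.-tuple {mpoly K[N]}) :
  (forall i, ord_ge 1 (tnth t i)) -> ord_ge k p ->
  exists R : 'I_N -> {mpoly K[N]}, (forall i, ord_ge k.-1 (R i)) /\
    p - (p \mPo t) = \sum_i ('X_i - tnth t i) * R i.
Proof.
move=> ht; move: p; apply: ord_ge_monomials.
- exists (fun=> 0); split=> [i|]; first exact: ord_ge_zero.
  by rewrite comp_mpoly0 subr0 big1 // => i _; rewrite mulr0.
- move=> q r [Q [hQ eQ]] [R [hR eR]]; exists (fun i => Q i + R i); split=> [i|].
    exact: ord_geD.
  rewrite comp_mpolyD opprD addrACA eQ eR -big_split.
  by apply: eq_bigr => i _; rewrite mulrDr.
move=> c m km.
suff [R [hR eR]] : exists R : 'I_N -> {mpoly K[N]},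
    (forall i, ord_ge (mdeg m).-1 (R i)) /\
    'X_[m] - ('X_[m] \mPo t) = \sum_i ('X_i - tnth t i) * R i.
  exists (fun i => c *: R i); split=> [i|].
    by apply/ord_geZ/(ord_geW _ (hR i)); lia.
  rewrite comp_mpolyZ -scalerBr eR scaler_sumr.
  by apply: eq_bigr => i _; rewrite scalerAr.
move: {km}m => m; have [d] := ubnP (mdeg m); elim: d m => // d IHd m md.
have [->|m0] := eqVneq m 0%MM.
  exists (fun=> 0); split=> [i|]; first exact: ord_ge_zero.
  by rewrite mpolyX0 comp_mpoly1 subrr big1 // => i _; rewrite mulr0.
have [i mi] : exists i, m i != 0%N.
  apply/existsP; apply: contraNT m0; rewrite negb_exists => /forallP h.
  by apply/eqP/mnmP => i; rewrite mnm0E; apply/eqP; move: (h i); rewrite negbK.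
have em : m = (U_(i) + (m - U_(i)))%MM by rewrite addmC submK // lep1mP.
have {}md : (mdeg (m - U_(i)) < d)%N by move: md; rewrite {1}em mdegD mdeg1; lia.
rewrite {}em; move: {m m0 mi}(_ - _)%MM md => m /IHd[R [hR eR]].
exists (fun j => (j == i)%:R * 'X_[m] + tnth t i * R j); split=> [j|].
  rewrite mdegD mdeg1 add1n /=; apply: ord_geD.
    by rewrite -[mdeg m]add0n; apply: ord_geM; [exact: ord_ge0|exact: ord_geX].
  by apply: (@ord_geW _ (1 + (mdeg m).-1)); [lia|exact: ord_geM].
under eq_bigr => j _ do rewrite mulrDr mulrCA [_ * (tnth t i * _)]mulrCA.
rewrite big_split /= -mulr_sumr -eR (bigD1 i) //= eqxx mul1r big1 => [|j /negPf ->].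
  by rewrite addr0 mpolyXD rmorphM /= comp_mpolyXU -tnth_nth mulrBl mulrBr addrA subrK.
by rewrite mul0r.
Qed.

Lemma pihomog_mcoeff d p m : (pihomog mdeg d p)@_m = if mdeg m == d then p@_m else 0.
Proof.
elim/mpolyind: p => [|c u p _ _ IHp]; first by rewrite pihomog0 mcoeff0 if_same.
rewrite pihomogD !mcoeffD IHp linearZ /= !mcoeffZ pihomogX.
have [<-|um] := eqVneq u m.
  by case: ifP => _; rewrite ?mcoeffX ?mcoeff0 ?mulr0 ?add0r ?eqxx.
have -> : (if mdeg u == d then 'X_[u] else 0)@_m = 0 :> K.
  by case: ifP => _; rewrite ?mcoeff0 // mcoeffX (negPf um).
by rewrite mcoeffX (negPf um) mulr0 !add0r.
Qed.

Lemma pihomogMX d p m :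
  pihomog mdeg (d + mdeg m) (p * 'X_[m]) = pihomog mdeg d p * 'X_[m].
Proof.
elim/mpolyind: p => [|c u p _ _ IHp]; first by rewrite pihomog0 !mul0r pihomog0.
rewrite mulrDl !pihomogD mulrDl IHp; congr (_ + _).
rewrite -scalerAl !linearZ /= -scalerAl; congr (_ *: _).
by rewrite -mpolyXD !pihomogX /= mdegD eqn_add2r; case: ifP; rewrite ?mul0r // mpolyXD.
Qed.

End Order.

(* Krull's intersection theorem at the origin, by grading K[x][u] with deg x_i = 1
   and deg u = -1: the polynomial [grade k q] is q(u x) / u^k, of degree k. *)
Section Krull.
Variables (K : fieldType) (N : nat).
Let A := {mpoly K[N]}.
Implicit Types (p q : A) (F : {poly A}).

Let grade k q : {poly A} :=
  \sum_(m <- msupp q) (q@_m *: 'X_[m])%:P * 'X^(mdeg m - k).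

(** The homogeneous part of degree [d] of [F] for this grading, evaluated at u = 1: next to u^k
    stands a polynomial of degree d + k in x. *)
Let lam (d : nat) F : A := \sum_(k < size F) pihomog mdeg (d + k) F`_k.

Let lamE d F n : (size F <= n)%N -> lam d F = \sum_(k < n) pihomog mdeg (d + k) F`_k.
Proof.
move=> Fn; rewrite /lam (big_ord_widen _ (fun k => pihomog mdeg (d + k) F`_k) Fn) big_mkcond.
apply: eq_bigr => k _; case: ltnP => // /(nth_default 0) ->.
by rewrite pihomog0.
Qed.

Let lamD d F G : lam d (F + G) = lam d F + lam d G.
Proof.
pose n := maxn (size F) (size G).
rewrite (@lamE d (F + G) n) ?size_polyD // (@lamE d F n) ?leq_maxl //.
rewrite (@lamE d G n) ?leq_maxr // -big_split.
by apply: eq_bigr => k _; rewrite coefD pihomogD.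
Qed.

Let lam_sum d (I : Type) (r : seq I) (P : pred I) (F : I -> {poly A}) :
  lam d (\sum_(i <- r | P i) F i) = \sum_(i <- r | P i) lam d (F i).
Proof.
elim/big_rec2: _ => [|i x y _ <-]; last exact: lamD.
by rewrite /lam size_poly0 big_ord0.
Qed.

(** [grade k q] is homogeneous of degree [k] and becomes [q] at u = 1, so multiplying by it only
    shifts the projection. *)
Let lam_grade d k F q :
  ord_ge k q -> lam (d + k) (F * grade k q) = lam d F * q.
Proof.
move=> hq; rewrite [in RHS](mpolyE q) mulr_sumr mulr_sumr lam_sum big_seq [RHS]big_seq.
apply: eq_bigr => m mq; have km : (k <= mdeg m)%N.
  by rewrite leqNgt; apply/negP => /hq e; move: mq; rewrite mcoeff_msupp e eqxx.
set c := _ *: _; set e := (_ - _)%N.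
rewrite (@lamE _ _ (e + size F)); last first.
  rewrite mulrA (leq_trans (size_polyMleq _ _)) // size_polyXn addnS /= addnC leq_add2l.
  by rewrite mulrC mul_polyC size_scale_leq.
rewrite big_split_ord big1 /= ?add0r => [|i _]; last first.
  by rewrite mulrA coefMXn /= ltn_ord pihomog0.
rewrite /lam mulr_suml. apply: eq_bigr => i _.
rewrite mulrA coefMXn /= ltnNge leq_addr /= addKn coefMC /c.
rewrite -scalerAr linearZ /= -scalerAr; congr (_ *: _).
by rewrite -pihomogMX; congr (pihomog mdeg _ _); rewrite /e; lia.
Qed.

Let lam_gradeE k q : ord_ge k q -> lam k (grade k q) = q.
Proof.
move=> hq; rewrite -[grade k q]mul1r -{1}[k]add0n lam_grade //.
rewrite /lam size_poly1 big_ord1 coef1 eqxx pihomog_dE ?mul1r //.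
exact: dhomog1.
Qed.

Let lam_ord d F : ord_ge d (lam d F).
Proof.
apply: ord_ge_sum => k _ m md; rewrite pihomog_mcoeff.
by case: eqP => // e; move: md; rewrite e; lia.
Qed.

(** Some graded lift of [q m] is a combination of the earlier lifts; its part of degree [m] at u = 1
    reads q_m = sum of D_i q_i with D_i of order m - i > 0. Modulo [G] every q_i is [p], so 1 - sum
    of D_i kills [p]. *)
Lemma krull (G : nat -> A) g p :
  (forall k, exists2 q, ord_ge k q & in_span G g (p - q)) ->
  exists2 s, s@_0%MM = 1 & in_span G g (s * p).
Proof.
move=> h; have /choice[q qP] : forall k, exists q, ord_ge k q /\ in_span G g (p - q).
  by move=> k; have [q qo qp] := h k; exists q.
have qo k : ord_ge k (q k) by case: (qP k).
have qp k : in_span G g (p - q k) by case: (qP k).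
have [m [c e]] := noetherian_poly (@noetherian_mpoly K N) (fun k => grade k (q k)).
pose D i := lam (m - i) (c i).
have qm : q m = \sum_(i < m) D i * q i.
  rewrite -{1}(lam_gradeE (qo m)) e lam_sum; apply: eq_bigr => i _.
  by rewrite /D -(@lam_grade _ i _ _ (qo i)) subnK // ltnW.
exists (1 - \sum_(i < m) D i).
  rewrite mcoeffB mcoeff1 eqxx raddf_sum /= big1 ?subr0 // => i _.
  by apply: lam_ord; rewrite mdeg0 subn_gt0.
rewrite mulrBl mul1r -[p in p - _](subrK (q m)) -addrA; apply: in_spanD => //.
rewrite {1}qm mulr_suml -sumrB; apply: in_span_sum => i _.
by rewrite -mulrBr -opprB mulrN -mulNr; apply: in_spanM.
Qed.

End Krull.

(** * Polynomial curves and the tangent criterion *)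

Section Curves.
Variables (K : numFieldType) (N : nat).
Implicit Types (gam : 'I_N -> {poly K}) (p q : {mpoly K[N]}).

Definition along gam p : {poly K} := mmap (@polyC K) gam p.

HB.instance Definition _ gam := GRing.RMorphism.copy (along gam) (mmap (@polyC K) gam).

Lemma horner_along gam p t : (along gam p).[t] = p.@[fun i => (gam i).[t]].
Proof.
rewrite /along /mmap mevalE horner_sum; apply: eq_bigr => m _.
rewrite hornerM hornerC /mmap1 horner_prod; congr (_ * _).
by apply: eq_bigr => i _; rewrite horner_exp.
Qed.

(** Along a curve through the origin, a polynomial of order [k] starts at t^k, with coefficient its
    form of degree [k] evaluated at the velocity. *)
Lemma along_coef gam (del : 'I_N -> {poly K}) k q :
  (forall i, gam i = 'X * del i) -> ord_ge k q ->
  (along gam q)`_k = (pihomog mdeg k q).@[fun i => (del i)`_0].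
Proof.
move=> gd; move: q; apply: ord_ge_monomials => [|q r hq hr|c m km].
- by rewrite rmorph0 coef0 pihomog0 meval0.
- by rewrite rmorphD coefD pihomogD mevalD hq hr.
rewrite /along mmapZ coefCM linearZ /= mevalZ; congr (_ * _).
rewrite mmapX pihomogX /mmap1.
under eq_bigr => i _ do rewrite gd exprMn.
rewrite big_split /= prodrXr -mdegE coefXnM.
case: ltngtP km => // [mk _|-> _]; first by rewrite meval0.
rewrite subnn mevalX -horner_coef0 horner_prod.
by apply: eq_bigr => i _; rewrite horner_exp horner_coef0.
Qed.

Lemma linear_part p : p@_0%MM = 0 ->
  ord_ge 2 (p - \sum_i p@_U_(i) *: 'X_i).
Proof.
move=> p0 m; rewrite mcoeffB raddf_sum /=; case e: (mdeg m) => [|[|//]] _.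
  move/eqP: e; rewrite mdeg_eq0 => /eqP->; rewrite p0 big1 ?subr0 // => i _.
  by rewrite mcoeffZ mcoeffX mnm1_eq0 mulr0.
have /mdeg1P[i /eqP ->] : mdeg m == 1%N by rewrite e.
rewrite (bigD1 i) //= mcoeffZ mcoeffX eqxx mulr1 big1 ?addr0 ?subrr // => j ji.
by rewrite mcoeffZ mcoeffX eq_mnm1 (negPf ji) mulr0.
Qed.

Section Origin.
Variables (G : seq {mpoly K[N]}) (P : {mpoly K[N]}).
Hypothesis curves : forall tau : 'I_N -> K,
  (forall g, g \in G -> \sum_i g@_U_(i) * tau i = 0) ->
  exists gam, [/\ forall i, (gam i)`_0 = 0, forall i, (gam i)`_1 = tau i,
    forall g, g \in G -> along gam g = 0 & along gam P = 0].

Let span p := in_span (nth 0 G) (size G) p.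

(** The zero vector solves the linear equations, and [g] vanishes along its curve, which passes
    through the origin. *)
Let G0 g : g \in G -> g@_0%MM = 0.
Proof.
move=> gG; have [|gam [g0 _ /(_ _ gG) + _]] := curves (tau := fun=> 0).
  by move=> h _; rewrite big1 // => i _; rewrite mulr0.
move=> e; rewrite -meval0_mcoeff -[RHS](horner0 0) -e horner_along.
by apply: meval_eq => i; rewrite horner_coef0 g0.
Qed.

Let L : 'M[K]_(N, size G) := \matrix_(i, j) (nth 0 G j)@_U_(i).
(** [pinvmx] is a generalized inverse, so [pr] is a projector with pr L = 0: every row vector x pr
    solves the linear equations, and the substitution [t] below replaces x by x pr. *)
Let pr : 'M[K]_N := 1%:M - L *m pinvmx L.
Let t : N.-tuple {mpoly K[N]} := [tuple \sum_j pr j i *: 'X_j | i < N].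

Let prL : pr *m L = 0.
Proof. by rewrite /pr mulmxBl mul1mx mulmxKpV ?submx_refl // subrr. Qed.

Let t1 i : ord_ge 1 (tnth t i).
Proof.
rewrite tnth_mktuple; apply: ord_ge_sum => j _; apply: ord_geZ.
by rewrite -(mdeg1 j); exact: ord_geX.
Qed.

Let Xt i : 'X_i - tnth t i =
  \sum_(j < size G) pinvmx L j i *: \sum_l (nth 0 G j)@_U_(l) *: 'X_l.
Proof.
rewrite tnth_mktuple.
under [in RHS]eq_bigr => j _ do rewrite scaler_sumr.
rewrite exchange_big /= -{1}[ i]/(idfun i).
have -> : 'X_(idfun i) = \sum_l (l == i)%:R *: 'X_l :> {mpoly K[N]}.
  rewrite (bigD1 i) //= eqxx scale1r big1 ?addr0 // => l /negPf ->.
  by rewrite scale0r.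
rewrite -sumrB; apply: eq_bigr => l _.
rewrite -scalerBl /pr !mxE opprB addrC subrK.
rewrite scaler_suml; apply: eq_bigr => j _.
by rewrite scalerA [in RHS]mulrC; congr (_ * _ *: _); rewrite mxE.
Qed.

(** The polynomial q differs from q(t) by a combination of the linear parts of [G], because X_i -
    t_i is one. The order of q(t) exceeds [k], since its form of degree [k] at x is that of q at the
    tangent vector x pr. *)
Let jet_step k q : ord_ge k q -> span (P - q) ->
  exists2 q', ord_ge k.+1 q' & span (P - q').
Proof.
move=> qk Pq.
have [R [Rk eR]] := ord_ge_telescope t1 qk.
pose lin j := \sum_l (nth 0 G j)@_U_(l) *: 'X_l : {mpoly K[N]}.
pose E j := \sum_i pinvmx L j i *: R i.
have qE : q = (q \mPo t) + \sum_(j < size G) lin j * E j.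
  apply/eqP; rewrite addrC -subr_eq; apply/eqP; rewrite eR.
  under eq_bigr => i _ do rewrite Xt mulr_suml.
  rewrite exchange_big; apply: eq_bigr => j _; rewrite mulr_sumr.
  by apply: eq_bigr => i _; rewrite -scalerAl scalerAr.
(* Completing the linear parts to the equations themselves changes [q] by a combination of [G]; the
   correction consists of products of orders 2 and k - 1. *)
exists ((q \mPo t) - \sum_(j < size G) (nth 0 G j - lin j) * E j).
  apply: ord_geD; last first.
    apply/ord_geN/ord_ge_sum => j _.
    apply: (@ord_geW _ _ _ (2 + k.-1)); first by lia.
    apply: ord_geM; first exact/linear_part/G0/mem_nth.
    by apply: ord_ge_sum => i _; apply: ord_geZ.
  have qtk : ord_ge k (q \mPo t) by apply: ord_ge_comp => //; exact: t1.
  suff h0 : pihomog mdeg k (q \mPo t) = 0.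
    move=> m; rewrite ltnS leq_eqVlt => /predU1P[mk|]; last exact: qtk.
    by have := congr1 (mcoeff m) h0; rewrite pihomog_mcoeff mk eqxx mcoeff0.
  apply: mpoly_eq0_meval => x.
  (* The vector x pr is the velocity of a curve along which [P] and [G] vanish, hence also [q],
     which is [P] modulo [G]. *)
  pose tau i := \sum_j x j * pr j i.
  have [|gam [g0 g1 gG gP]] := curves (tau := tau).
    move=> g gG; rewrite -(nth_index 0 gG); set j := index _ _.
    have jG : (j < size G)%N by rewrite index_mem.
    pose xr := \row_i x i.
    have : (xr *m (pr *m L)) 0 (Ordinal jG) = 0 by rewrite prL mulmx0 mxE.
    rewrite mulmxA mxE => e; rewrite -[RHS]e; apply: eq_bigr => i _.
    rewrite mulrC /L !mxE; congr (_ * _).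
    by apply: eq_bigr => l _; rewrite [xr 0 l]mxE.
  have gd (c : 'I_N -> {poly K}) : (forall i, (c i)`_0 = 0) ->
      forall i, c i = 'X * \poly_(n < size (c i)) (c i)`_n.+1.
    move=> c0 i; apply/polyP => -[|n]; rewrite coefXM //= ?c0 // coef_poly.
    by case: ltnP => // /leqW /(nth_default 0).
  have h1 : (along gam q)`_k = 0.
    have -> : q = P - (P - q) by rewrite opprB addrC subrK.
    have [c ->] := Pq; rewrite rmorphB /= gP rmorph_sum big1 ?subrr ?coef0 // => j _.
    by rewrite rmorphM /= (gG _ (mem_nth 0 _)) ?mulr0.
  rewrite (along_coef (gd _ g0) qk) in h1.
  have lin0 (c : 'I_N -> K) i : (c i *: 'X : {poly K})`_0 = 0.
    by rewrite coefZ coefX mulr0.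
  have cmp : along (fun i => x i *: 'X) (q \mPo t) = along (fun i => tau i *: 'X) q.
    apply/eqP; rewrite -subr_eq0; apply/eqP/poly_eq0_horner => s.
    rewrite hornerD hornerN !horner_along comp_mpoly_meval.
    apply/eqP; rewrite subr_eq0; apply/eqP/meval_eq => i.
    rewrite tnth_mktuple rmorph_sum /= hornerZ hornerX mulr_suml.
    by apply: eq_bigr => j _; rewrite mevalZ mevalXU hornerZ hornerX mulrCA mulrA.
  have := congr1 (fun f : {poly K} => f`_k) cmp.
  rewrite (along_coef (gd _ (lin0 x)) qtk) (along_coef (gd _ (lin0 tau)) qk).
  have sz (c : K) : (\poly_(n < size (c *: 'X : {poly K})) (c *: 'X : {poly K})`_n.+1)`_0 = c.
    rewrite coef_poly coefZ coefX mulr1; case: ltnP => //.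
    by rewrite leqn0 size_poly_eq0 => /eqP /(congr1 (fun f : {poly K} => f`_1));
      rewrite coefZ coefX mulr1 coef0 => ->.
  rewrite (meval_eq _ (fun i => sz (x i))) => ->.
  rewrite -[RHS]h1; apply: meval_eq => i; rewrite sz coef_poly -g1.
  by case: ltnP => // /leqW /(nth_default 0).
have -> : \sum_(j < size G) (nth 0 G j - lin j) * E j =
          \sum_(j < size G) E j * nth 0 G j - (q - (q \mPo t)).
  rewrite [X in _ - (X - _)]qE [X in _ - (X - _)]addrC addrK -sumrB.
  by apply: eq_bigr => j _; rewrite mulrBl mulrC.
rewrite [X in span X](_ : _ = (P - q) + \sum_(j < size G) E j * nth 0 G j); last by ring.
apply: in_spanD => //; exists (fun n => oapp E 0 (insub n)).
by apply: eq_bigr => j _; rewrite valK.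
Qed.

Lemma tangent_criterion_origin : exists2 s, s@_0%MM = 1 & span (s * P).
Proof.
apply: krull; elim=> [|k [q qk Pq]]; last exact: jet_step Pq.
by exists P; [exact: ord_ge0 | rewrite subrr; exact: in_span0].
Qed.

End Origin.

(** Translation of [v0] to the origin. As [s] is nonzero near [v0], the conclusion says that [P]
    vanishes near [v0] on the common zeros of [G]. *)
Theorem tangent_criterion (v0 : 'I_N -> K) (G : seq {mpoly K[N]}) (P : {mpoly K[N]}) :
  (forall tau : 'I_N -> K,
     (forall g, g \in G -> \sum_i g^`M(i).@[v0] * tau i = 0) ->
     exists gam, [/\ forall i, (gam i)`_0 = v0 i, forall i, (gam i)`_1 = tau i,
       forall g, g \in G -> along gam g = 0 & along gam P = 0]) ->
  exists2 s : {mpoly K[N]}, s.@[v0] != 0 &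
    forall b, (forall g, g \in G -> g.@[b] = 0) -> (s * P).@[b] = 0.
Proof.
move=> h; pose tr : N.-tuple {mpoly K[N]} := [tuple 'X_i + (v0 i)%:MP | i < N].
have trE p x : (p \mPo tr).@[x] = p.@[fun i => x i + v0 i].
  rewrite comp_mpoly_meval; apply: meval_eq => i.
  by rewrite tnth_mktuple mevalD mevalXU mevalC.
have trd p i : (p \mPo tr)@_U_(i) = p^`M(i).@[v0].
  have : (p \mPo tr)^`M(i)@_0%MM = (p \mPo tr)@_U_(i).
    by rewrite mcoeff_deriv add0m mnm0E mulr1n.
  move=> <-; rewrite -meval0_mcoeff mderiv_comp (bigD1 i) //= big1 ?addr0.
    rewrite tnth_mktuple mderivD mderivC addr0 mderivX mnmE eqxx scale1r.
    have -> : (U_(i) - U_(i) = 0)%MM by apply/mnmP => k; rewrite !mnmE subnn.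
    by rewrite mpolyX0 mulr1 trE; apply: meval_eq => j; rewrite add0r.
  move=> j ji; rewrite tnth_mktuple mderivD mderivC addr0 mderivX mnmE (negPf ji).
  by rewrite scale0r mulr0.
have [|s s0 [c sP]] := @tangent_criterion_origin [seq g \mPo tr | g <- G] (P \mPo tr).
  move=> tau tau0; have [|gam [g0 g1 gG gP]] := h tau.
    move=> g gG; rewrite -[RHS](tau0 (g \mPo tr)) ?map_f //.
    by apply: eq_bigr => i _; rewrite trd.
  have atr p : along (fun i => gam i - (v0 i)%:P) (p \mPo tr) = along gam p.
    apply/eqP; rewrite -subr_eq0; apply/eqP/poly_eq0_horner => u.
    rewrite hornerD hornerN !horner_along trE; apply/eqP; rewrite subr_eq0; apply/eqP.
    by apply: meval_eq => i; rewrite hornerD hornerN hornerC subrK.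
  exists (fun i => gam i - (v0 i)%:P); split.
  - by move=> i; rewrite coefB coefC g0 subrr.
  - by move=> i; rewrite coefB coefC g1 subr0.
  - by move=> _ /mapP[g gG' ->]; rewrite atr gG.
  - by rewrite atr.
pose rt : N.-tuple {mpoly K[N]} := [tuple 'X_i - (v0 i)%:MP | i < N].
have rtE p x : (p \mPo rt).@[x] = p.@[fun i => x i - v0 i].
  rewrite comp_mpoly_meval; apply: meval_eq => i.
  by rewrite tnth_mktuple mevalB mevalXU mevalC.
exists (s \mPo rt).
  rewrite rtE (meval_eq _ (v2 := fun=> 0)) => [|i]; last by rewrite subrr.
  by rewrite meval0_mcoeff s0 oner_eq0.
move=> b bG; have := congr1 (meval (fun i => b i - v0 i)) sP.
rewrite !mevalM rtE trE => e.
rewrite (meval_eq (v2 := b) P) in e => [|i]; last by rewrite subrK.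
rewrite e rmorph_sum big1 // => i _; rewrite /= mevalM.
have iG : (i < size G)%N by case: i => i; rewrite size_map.
rewrite (nth_map 0) //= trE (meval_eq (v2 := b)) => [|j]; last by rewrite subrK.
by rewrite bG ?mulr0 // mem_nth.
Qed.

End Curves.

(** * Polynomial dependence on a parameter *)

Section RegularFunctions.
Variables (K : fieldType) (T : Type) (S : (T -> K) -> Prop).

(** Dependence on a parameter is treated at once for two algebras of functions: polynomials in one
    variable, for curves, and polynomials on K^n, for a resultant as a function of the base point of
    a line. *)
Record function_algebra : Prop := FunctionAlgebra {
  regC : forall c, S (fun=> c);
  regD : forall f g, S f -> S g -> S (fun t => f t + g t);
  regM : forall f g, S f -> S g -> S (fun t => f t * g t) }.

Hypothesis SA : function_algebra.

Lemma reg_ext f g : (forall t, f t = g t) -> S f -> S g.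
Proof. by move=> /funext ->. Qed.

Lemma reg_sum (I : Type) (r : seq I) (P : pred I) (F : I -> T -> K) :
  (forall i, P i -> S (F i)) -> S (fun t => \sum_(i <- r | P i) F i t).
Proof.
move=> h; elim: r => [|i r IHr].
  by apply: reg_ext (regC SA 0) => t; rewrite big_nil.
have [Pi|Pi] := boolP (P i).
  by apply: reg_ext (regD SA (h i Pi) IHr) => t; rewrite big_cons Pi.
by apply: reg_ext IHr => t; rewrite big_cons (negPf Pi).
Qed.

Lemma reg_prod (I : Type) (r : seq I) (P : pred I) (F : I -> T -> K) :
  (forall i, P i -> S (F i)) -> S (fun t => \prod_(i <- r | P i) F i t).
Proof.
move=> h; elim: r => [|i r IHr].
  by apply: reg_ext (regC SA 1) => t; rewrite big_nil.
have [Pi|Pi] := boolP (P i).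
  by apply: reg_ext (regM SA (h i Pi) IHr) => t; rewrite big_cons Pi.
by apply: reg_ext IHr => t; rewrite big_cons (negPf Pi).
Qed.

Lemma reg_det n (A : T -> 'M[K]_n) :
  (forall i j, S (fun t => A t i j)) -> S (fun t => \det (A t)).
Proof.
move=> h; apply: reg_sum => s _; apply: regM => //; first exact: regC.
by apply: reg_prod.
Qed.

Section Multivariate.
Variable n : nat.

Definition reg_mpoly (h : T -> {mpoly K[n]}) := forall m, S (fun t => (h t)@_m).

Lemma reg_mpoly_ext f g : (forall t, f t = g t) -> reg_mpoly f -> reg_mpoly g.
Proof. by move=> /funext ->. Qed.

Lemma reg_mpolyC p : reg_mpoly (fun=> p).
Proof. by move=> m; exact: regC. Qed.

Lemma reg_mpolyD f g : reg_mpoly f -> reg_mpoly g -> reg_mpoly (fun t => f t + g t).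
Proof.
by move=> hf hg m; apply: reg_ext (regD SA (hf m) (hg m)) => t; rewrite mcoeffD.
Qed.

Lemma reg_mpolyM f g : reg_mpoly f -> reg_mpoly g -> reg_mpoly (fun t => f t * g t).
Proof.
move=> hf hg m; apply: reg_ext; first by move=> t; rewrite mcoeffM.
by apply: reg_sum => k _; apply: regM.
Qed.

Lemma reg_mpolyZ c f : S c -> reg_mpoly f -> reg_mpoly (fun t => c t *: f t).
Proof.
by move=> hc hf m; apply: reg_ext (regM SA hc (hf m)) => t; rewrite mcoeffZ.
Qed.

Lemma reg_mpoly_sum (I : Type) (r : seq I) (P : pred I) (F : I -> T -> {mpoly K[n]}) :
  (forall i, P i -> reg_mpoly (F i)) -> reg_mpoly (fun t => \sum_(i <- r | P i) F i t).
Proof.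
move=> h; elim: r => [|i r IHr].
  by apply: reg_mpoly_ext (reg_mpolyC 0) => t; rewrite big_nil.
have [Pi|Pi] := boolP (P i).
  by apply: reg_mpoly_ext (reg_mpolyD (h i Pi) IHr) => t; rewrite big_cons Pi.
by apply: reg_mpoly_ext IHr => t; rewrite big_cons (negPf Pi).
Qed.

Lemma reg_mpolyX f k : reg_mpoly f -> reg_mpoly (fun t => f t ^+ k).
Proof.
move=> hf; elim: k => [|k IHk]; first exact: reg_mpolyC.
by apply: reg_mpoly_ext (reg_mpolyM hf IHk) => t; rewrite exprS.
Qed.

Lemma reg_mpoly_prod (I : Type) (r : seq I) (P : pred I) (F : I -> T -> {mpoly K[n]}) :
  (forall i, P i -> reg_mpoly (F i)) -> reg_mpoly (fun t => \prod_(i <- r | P i) F i t).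
Proof.
move=> h; elim: r => [|i r IHr].
  by apply: reg_mpoly_ext (reg_mpolyC 1) => t; rewrite big_nil.
have [Pi|Pi] := boolP (P i).
  by apply: reg_mpoly_ext (reg_mpolyM (h i Pi) IHr) => t; rewrite big_cons Pi.
by apply: reg_mpoly_ext IHr => t; rewrite big_cons (negPf Pi).
Qed.

End Multivariate.

(** The uniform bound [b] makes the substitution a sum over one finite set of monomials, the same
    for all parameters. *)
Lemma reg_mpoly_comp n k b (f : T -> {mpoly K[n]}) (u : T -> n.-tuple {mpoly K[k]}) :
  (forall t, (msize (f t) <= b)%N) -> reg_mpoly f ->
  (forall i, reg_mpoly (fun t => tnth (u t) i)) -> reg_mpoly (fun t => f t \mPo u t).
Proof.
move=> fb hf hu; apply: reg_mpoly_ext.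
  by move=> t; rewrite (comp_mpolywE _ (fb t)).
apply: reg_mpoly_sum => m _; apply: reg_mpolyZ; first exact: hf.
by apply: reg_mpoly_prod => i _; apply: reg_mpolyX.
Qed.

Definition reg_poly (h : T -> {poly K}) := forall k, S (fun t => (h t)`_k).

Lemma reg_poly_ext f g : (forall t, f t = g t) -> reg_poly f -> reg_poly g.
Proof. by move=> /funext ->. Qed.

Lemma reg_polyC p : reg_poly (fun=> p).
Proof. by move=> k; exact: regC. Qed.

Lemma reg_poly_const c : S c -> reg_poly (fun t => (c t)%:P).
Proof.
move=> hc [|k]; first by apply: reg_ext hc => t; rewrite coefC.
by apply: reg_ext (regC SA 0) => t; rewrite coefC.
Qed.

Lemma reg_polyD f g : reg_poly f -> reg_poly g -> reg_poly (fun t => f t + g t).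
Proof.
by move=> hf hg k; apply: reg_ext (regD SA (hf k) (hg k)) => t; rewrite coefD.
Qed.

Lemma reg_polyM f g : reg_poly f -> reg_poly g -> reg_poly (fun t => f t * g t).
Proof.
move=> hf hg k; apply: reg_ext; first by move=> t; rewrite coefM.
by apply: reg_sum => i _; apply: regM.
Qed.

Lemma reg_poly_mmap n b (f : T -> {mpoly K[n]}) (x : T -> 'I_n -> {poly K}) :
  (forall t, (msize (f t) <= b)%N) -> reg_mpoly f ->
  (forall i, reg_poly (fun t => x t i)) ->
  reg_poly (fun t => mmap (@polyC K) (x t) (f t)).
Proof.
move=> fb hf hx; apply: reg_poly_ext; first by move=> t; rewrite (mmapE _ (fb t)).
elim: (index_enum _) => [|m r IHr].
  by apply: reg_poly_ext (reg_polyC 0) => t; rewrite big_nil.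
apply: reg_poly_ext; first by move=> t; rewrite big_cons.
apply: reg_polyD => //; apply: reg_polyM; first exact/reg_poly_const/hf.
rewrite /mmap1; elim: (index_enum _) => [|i s IHs].
  by apply: reg_poly_ext (reg_polyC 1) => t; rewrite big_nil.
apply: reg_poly_ext; first by move=> t; rewrite big_cons.
apply: reg_polyM => //; elim: (bmnm m i) => [|d IHd]; first exact: reg_polyC.
by apply: reg_poly_ext (reg_polyM (hx i) IHd) => t; rewrite exprS.
Qed.

End RegularFunctions.

Definition polynomial1 (K : fieldType) (f : K -> K) :=
  exists p : {poly K}, forall t, f t = p.[t].

Lemma polynomial1_algebra (K : fieldType) : function_algebra (@polynomial1 K).
Proof.
split=> [c|f g [p fp] [q gq]|f g [p fp] [q gq]].
- by exists c%:P => t; rewrite hornerC.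
- by exists (p + q) => t; rewrite hornerD fp gq.
- by exists (p * q) => t; rewrite hornerM fp gq.
Qed.

Definition polynomialn (K : fieldType) n (f : ('I_n -> K) -> K) :=
  exists p : {mpoly K[n]}, forall x, f x = p.@[x].

Lemma polynomialn_algebra (K : fieldType) n : function_algebra (@polynomialn K n).
Proof.
split=> [c|f g [p fp] [q gq]|f g [p fp] [q gq]].
- by exists c%:MP => t; rewrite mevalC.
- by exists (p + q) => t; rewrite mevalD fp gq.
- by exists (p * q) => t; rewrite mevalM fp gq.
Qed.

(** * Codimension of singular sets *)

Section Irreducible.
Variable T : topologicalType.
Implicit Types A B : set T.

Lemma irreducible_closure A : irreducible_set A -> irreducible_set (closure A).
Proof.
move=> [[a Aa] irr]; split; first by exists a; exact: subset_closure.
move=> B C cB cC ABC.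
by case: (irr B C cB cC (subset_trans (@subset_closure _ A) ABC)) => AB; [left|right];
  [rewrite closureE|rewrite closureE] => x; apply.
Qed.

End Irreducible.

Section Sylvester.
Variables (K : fieldType) (D : nat).
Implicit Types f g : {poly K}.

Definition sylvester f g : 'M[K]_(D + D) :=
  \matrix_(a, b) match split a with
                 | inl k => (f * 'X^k)`_b
                 | inr k => (g * 'X^k)`_b
                 end.

(** The vector of powers (1, c, c^2, ...) is in the kernel. *)
Lemma sylvester_root f g c : (0 < D)%N -> (size f <= D.+1)%N -> (size g <= D.+1)%N ->
  f.[c] = 0 -> g.[c] = 0 -> \det (sylvester f g) = 0.
Proof.
move=> D0 sf sg fc gc; apply/eqP; rewrite -det_tr; apply/det0P.
exists (\row_b c ^+ b).
  have D2 : (0 < D + D)%N by lia.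
  apply/eqP => /rowP /(_ (Ordinal D2)); rewrite !mxE expr0 => /eqP.
  by rewrite oner_eq0.
apply/rowP => a; rewrite !mxE.
have h (p : {poly K}) (k : 'I_D) : (size p <= D.+1)%N -> p.[c] = 0 ->
    \sum_(b < D + D) (\row_b c ^+ b) 0 b * (p * 'X^k)`_b = 0.
  move=> sp pc; under eq_bigr => b _ do rewrite mxE mulrC.
  rewrite -horner_coef_wide ?hornerM ?pc ?mul0r //.
  rewrite (leq_trans (size_polyMleq _ _)) // size_polyXn.
  by have := ltn_ord k; lia.
case e: (split a) => [k|k]; [rewrite -[RHS](h f k)//|rewrite -[RHS](h g k)//];
  by apply: eq_bigr => b _; rewrite !mxE e.
Qed.

(** A common root at infinity: when both degrees drop, the last column is zero. *)
Lemma sylvester_infty f g : (0 < D)%N -> (size f <= D)%N -> (size g <= D)%N ->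
  \det (sylvester f g) = 0.
Proof.
move=> D0 sf sg; apply/eqP; rewrite -det_tr; apply/det0P.
have lt : ((D + D).-1 < D + D)%N by lia.
exists (delta_mx 0 (Ordinal lt)).
  apply/eqP => /rowP /(_ (Ordinal lt)); rewrite !mxE !eqxx => /eqP.
  by rewrite oner_eq0.
apply/rowP => a; rewrite -rowE !mxE.
have Dk (k : 'I_D) : (D <= (D + D).-1 - k)%N by have := ltn_ord k; lia.
by case: (split a) => k; rewrite coefMXn /=; case: ifP => // _;
  apply: nth_default; rewrite (leq_trans _ (Dk k)).
Qed.

End Sylvester.

Section TopCoefficient.
Variable K : comNzRingType.
Implicit Types f g : {poly K}.

Definition top_coef d f c := (size f <= d.+1)%N /\ f`_d = c.

Lemma top_coef1 : top_coef 0 1 1.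
Proof. by rewrite /top_coef size_poly1 coef1. Qed.

Lemma top_coefM a b f g c d :
  top_coef a f c -> top_coef b g d -> top_coef (a + b) (f * g) (c * d).
Proof.
move=> [sf <-] [sg <-]; split.
  by rewrite (leq_trans (size_polyMleq _ _)) //; lia.
have lt : (a < (a + b).+1)%N by lia.
rewrite coefM (bigD1 (Ordinal lt)) //= addKn big1 ?addr0 // => i.
rewrite -val_eqE /= => ia; have [ai|ai] := ltnP a i.
  by rewrite nth_default ?mul0r // (leq_trans sf).
by rewrite [g`__]nth_default ?mulr0 // (leq_trans sg) //; lia.
Qed.

Lemma top_coefX a f c k : top_coef a f c -> top_coef (k * a) (f ^+ k) (c ^+ k).
Proof.
move=> h; elim: k => [|k IHk]; first exact: top_coef1.
by rewrite !exprS mulSn; apply: top_coefM.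
Qed.

Lemma top_coef_prod (I : Type) (r : seq I) (d : I -> nat) F c :
  (forall i, top_coef (d i) (F i) (c i)) ->
  top_coef (\sum_(i <- r) d i) (\prod_(i <- r) F i) (\prod_(i <- r) c i).
Proof.
move=> h; elim: r => [|i r IHr]; first by rewrite !big_nil; exact: top_coef1.
by rewrite !big_cons; apply: top_coefM.
Qed.

Lemma top_coef_sum (I : eqType) (r : seq I) d F c :
  (forall i, i \in r -> top_coef d (F i) (c i)) ->
  top_coef d (\sum_(i <- r) F i) (\sum_(i <- r) c i).
Proof.
move=> h; rewrite big_seq [\sum_(i <- r) c i]big_seq.
apply: (big_ind2 (fun f c => top_coef d f c)) => //.
  by rewrite /top_coef size_poly0 coef0.
move=> f1 c1 f2 c2 [s1 <-] [s2 <-]; split; last by rewrite coefD.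
by rewrite (leq_trans (size_polyD _ _)) // geq_max s1.
Qed.

End TopCoefficient.

Section Restriction.
Variables (K : numFieldType) (n : nat).
Implicit Types (p : {mpoly K[n]}) (x v : 'I_n -> K).

Definition on_line x v p : {poly K} := along (fun i => (x i)%:P + v i *: 'X) p.

Lemma horner_on_line x v p t : (on_line x v p).[t] = p.@[fun i => x i + t * v i].
Proof.
rewrite horner_along; apply: meval_eq => i.
by rewrite hornerD hornerC hornerZ hornerX mulrC.
Qed.

(** The coefficient of t^D does not depend on the base point [x], which allows parallel lines to be
    compared. *)
Lemma on_line_homog x v p D : p \is D.-homog ->
  top_coef D (on_line x v p) (p.@[v]).
Proof.
move=> /dhomogP pD; rewrite mevalE; apply: top_coef_sum => m /pD /= mD.
rewrite -[D]add0n; apply: top_coefM.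
  by rewrite /top_coef size_polyC leq_b1 coefC.
rewrite -mD mdegE /mmap1; apply: top_coef_prod => i.
rewrite -[X in top_coef X]muln1; apply: top_coefX; split.
  rewrite (leq_trans (size_polyD _ _)) // geq_max size_polyC.
  by rewrite (leq_trans (leq_b1 _)) // (leq_trans (size_scale_leq _ _)) // size_polyX.
by rewrite coefD coefC coefZ coefX add0r mulr1.
Qed.

End Restriction.

Section AffineClosed.
Variables (K : numFieldType) (n : nat).
Implicit Types (x v w : 'I_n -> K) (Z : set (affine_space K n)).

Lemma affine_closedP Z : closed Z <-> exists I, Z = zero_locus (@affine_vanish K n) I.
Proof.
split=> [/closed_openC [I _ e]|[I ->]].
  by exists I; rewrite -e setCK.
by rewrite -openC; exists I => //; rewrite setCK.
Qed.

Lemma irreducible_affine_space : irreducible_set [set: affine_space K n].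
Proof.
split; first by exists (fun=> 0).
move=> B C /affine_closedP[I ->] /affine_closedP[J ->] IJ.
apply: contrapT => /not_orP[].
move=> /existsNP[x /not_implyP[_ /existsNP[p /not_implyP[Ip px]]]].
move=> /existsNP[y /not_implyP[_ /existsNP[q /not_implyP[Jq qy]]]].
have /eqP : p * q = 0.
  apply: mpoly_eq0_meval => z; rewrite mevalM.
  by have [/(_ p Ip)|/(_ q Jq)] := IJ z Logic.I; rewrite /affine_vanish => ->;
    rewrite ?mul0r ?mulr0.
rewrite mulf_eq0 => /orP[]/eqP e.
  by apply: px; rewrite /affine_vanish e meval0.
by apply: qy; rewrite /affine_vanish e meval0.
Qed.

Definition cylinder v Z : set (affine_space K n) :=
  [set x | exists2 y, Z y & exists t, x = (fun i => y i + t * v i)].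

(** A line is irreducible, so each line of the cylinder lies in one of two closed sets that cover
    it. The base points whose line lies in a given closed set form a closed set, the [core], and
    irreducibility of [Z] applies to the two cores. *)
Lemma irreducible_cylinder v Z : irreducible_set Z -> irreducible_set (cylinder v Z).
Proof.
move=> [[z Zz] irr]; split.
  by exists z, z => //; exists 0; apply: funext => i; rewrite mul0r addr0.
move=> B C /affine_closedP[I ->] /affine_closedP[J ->] IJ.
pose core (A : set {mpoly K[n]}) : set (affine_space K n) :=
  [set y | forall p t, A p -> p.@[fun i => y i + t * v i] = 0].
have core_closed A : closed (core A).
  apply/affine_closedP.
  exists [set q | exists p t, A p /\ q = (p \mPo [tuple 'X_i + (t * v i)%:MP | i < n])].
  have e p t y : (p \mPo [tuple 'X_i + (t * v i)%:MP | i < n]).@[y] =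
      p.@[fun i => y i + t * v i].
    rewrite comp_mpoly_meval; apply: meval_eq => i.
    by rewrite tnth_mktuple mevalD mevalXU mevalC.
  apply/seteqP; split=> y.
    by move=> yA _ [p [t [Ap ->]]]; rewrite /affine_vanish e; exact: yA.
  by move=> h p t Ap; rewrite -e; apply: h; exists p, t.
have [||y Zy|h|h] := irr (core I) (core J); [exact: core_closed|exact: core_closed| | |].
- apply: contrapT => /not_orP[].
  move=> /existsNP[p /existsNP[t /not_implyP[Ip pt]]].
  move=> /existsNP[q /existsNP[s /not_implyP[Jq qs]]].
  have p0 : on_line y v p != 0.
    by apply/eqP => e; apply: pt; rewrite -horner_on_line e horner0.
  have q0 : on_line y v q != 0.
    by apply/eqP => e; apply: qs; rewrite -horner_on_line e horner0.
  have [k] := poly_nonroot_nat (mulf_neq0 p0 q0).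
  rewrite hornerM mulf_eq0 !horner_on_line => /norP[/eqP pk /eqP qk].
  have [|/(_ p Ip)|/(_ q Jq)] := IJ (fun i => y i + k%:R * v i).
  + by exists y => //; exists k%:R.
  + exact: pk.
  + exact: qk.
- by left=> _ [y Zy [t ->]] p Ip; exact: (h _ Zy).
- by right=> _ [y Zy [t ->]] p Ip; exact: (h _ Zy).
Qed.

(* The chain is [Y], the closure of the cylinder over [Y] in the direction [v],
   the whole space: the resultant of the restrictions of [F] and [G] to lines of
   direction [v] vanishes on the cylinder and not at [w]. *)
Lemma codim_ge2_resultant (F G : {mpoly K[n]}) D (w v : 'I_n -> K) Z :
  (0 < D)%N -> F \is D.-homog -> G \is D.-homog ->
  (forall x, Z x -> F.@[x] = 0 /\ G.@[x] = 0) ->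
  \det (sylvester D (on_line w v F) (on_line w v G)) != 0 ->
  codim_ge 2 Z.
Proof.
move=> D0 FD GD FG nd Y cY iY YZ; exists (fun i =>
  if i is 0 then Y else if i is 1 then closure (cylinder v Y) else setT).
have iC := irreducible_cylinder v iY.
split=> // [[|[|[|]]] // _|[|[|]] // _].
- by split; [exact: closed_closure|exact: irreducible_closure].
- by split; [exact: closedT|exact: irreducible_affine_space].
- split=> [y Yy|sub].
    by apply: subset_closure; exists y => //; exists 0;
      apply: funext => i; rewrite mul0r addr0.
  have [[y Yy] _] := iY.
  (* If the closed cylinder stayed inside [Y], then [H] would vanish on a line of direction [v], so
     H(v) = 0, and the restriction to the line through [w] would have degree below [D]. *)
  have h (H : {mpoly K[n]}) : H \is D.-homog -> (forall x, Z x -> H.@[x] = 0) ->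
      (size (on_line w v H) <= D)%N.
    move=> HD HZ; have H0 : on_line y v H = 0.
      apply: poly_eq0_horner => t; rewrite horner_on_line; apply/HZ/YZ/sub.
      by apply: subset_closure; exists y => //; exists t.
    have [_] := on_line_homog y v HD; rewrite H0 coef0 => v0.
    have [s t] := on_line_homog w v HD; rewrite leq_eqVlt in s.
    case/predU1P: s => // s.
    have : lead_coef (on_line w v H) == 0 by rewrite lead_coefE s t -v0.
    by rewrite lead_coef_eq0 => /eqP ->; rewrite size_poly0.
  move/eqP: nd; apply; apply: sylvester_infty => //; apply: h => // x /FG[].
    by [].
  by [].
- split=> // /(_ w Logic.I) wC.
  have [R RE] : polynomialn (fun x : 'I_n -> K =>
      \det (sylvester D (on_line x v F) (on_line x v G))).
    have SA := polynomialn_algebra K n.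
    apply: (reg_det SA) => a b.
    have ol H : reg_poly (@polynomialn K n) (fun x => on_line x v H).
      apply: (reg_poly_mmap SA (b := msize H)) => // [|i]; first exact: reg_mpolyC.
      apply: (reg_polyD SA); last exact: reg_polyC.
      by apply: (reg_poly_const SA); exists 'X_i => x; rewrite mevalXU.
    have sh H k : polynomialn (fun x => (on_line x v H * 'X^k)`_b).
      by apply: (reg_polyM SA) => //; exact: reg_polyC.
    case e : (split a) => [k|k].
      by apply: reg_ext (sh F k) => x; rewrite mxE e.
    by apply: reg_ext (sh G k) => x; rewrite mxE e.
  suff /(_ w wC) : closure (cylinder v Y) `<=` [set x | R.@[x] = 0].
    by rewrite /= -RE; apply/eqP.
  rewrite closureE => x; apply; split.
    apply/affine_closedP; exists [set R]; apply/seteqP; split=> z.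
      by move=> Rx _ ->.
    by apply.
  move=> _ [y Yy [t ->]] /=; rewrite -RE.
  (* The point [y] itself is the common root: on the line based at y + t v it has parameter - t. *)
  have h (H : {mpoly K[n]}) : H \is D.-homog -> H.@[y] = 0 ->
      (size (on_line (fun i => (y i + t * v i)%R) v H) <= D.+1)%N /\
      (on_line (fun i => (y i + t * v i)%R) v H).[- t] = 0.
    move=> HD Hy; split; first by case: (on_line_homog (fun i => (y i + t * v i)%R) v HD).
    rewrite horner_on_line -[RHS]Hy; apply: meval_eq => i.
    by rewrite mulNr addrK.
  have [Fy Gy] := FG _ (YZ _ Yy).
  have [sF rF] := h F FD Fy; have [sG rG] := h G GD Gy.
  exact: sylvester_root rF rG.
Qed.

End AffineClosed.

(** * One-forms and pullbacks *)

Section OneForms.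
Variables (K : fieldType) (n : nat).
Implicit Types (a b : diff_form K n) (f g : 'I_n -> {mpoly K[n]}) (S : {set 'I_n}).

(** The sum has at most one nonzero term; this avoids extracting the element of a singleton. *)
Definition one_form f : diff_form K n :=
  [ffun S : {set 'I_n} => \sum_i if S == [set i]%SET then f i else 0].

Lemma one_formE f i : one_form f [set i]%SET = f i.
Proof.
rewrite ffunE (bigD1 i) //= eqxx big1 ?addr0 // => j ji.
by rewrite (inj_eq set1_inj) eq_sym (negPf ji).
Qed.

Lemma one_form_kform f : is_kform 1 (one_form f).
Proof.
move=> S S1; rewrite ffunE big1 // => i _; case: eqP => // e.
by move: S1; rewrite e cards1.
Qed.

Lemma one_formK a : is_kform 1 a -> one_form (fun i => a [set i]%SET) = a.
Proof.
move=> a1; apply/ffunP => S; have [/cards1P[i ->]|S1] := boolP (#|S| == 1%N).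
  by rewrite one_formE.
by rewrite a1 // one_form_kform.
Qed.

Lemma one_form_ext f g : (forall i, f i = g i) -> one_form f = one_form g.
Proof. by move=> /funext ->. Qed.

Lemma sum_sub_set1 (V : nmodType) S (F : {set 'I_n} -> V) :
  (forall I : {set 'I_n}, #|I| != 1%N -> F I = 0) ->
  \sum_(I : {set 'I_n} | I \subset S) F I = \sum_(i in S) F [set i]%SET.
Proof.
move=> F0; rewrite -(big_imset F (h := fun i => [set i]%SET)); last first.
  by move=> i j _ _; apply: set1_inj.
rewrite big_mkcond [RHS]big_mkcond; apply: eq_bigr => I _.
have [/cards1P[i ->]|I1] := boolP (#|I| == 1%N); last by rewrite F0 ?if_same.
by rewrite finset.sub1set (mem_imset _ _ set1_inj).
Qed.

Lemma wedge_one_form a b S : is_kform 1 a ->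
  wedge a b S = \sum_(i in S) (-1) ^+ #|[set j in S | (j < i)%N]%SET|
                * a [set i]%SET * b (S :\ i)%SET.
Proof.
move=> a1; rewrite ffunE sum_sub_set1 => [|I I1]; last by rewrite a1 // mulr0 mul0r.
apply: eq_bigr => i iS; congr (_ ^+ _ * _ * _).
rewrite -(card_imset [set j in S | (j < i)%N]%SET (f := fun j => (i, j))); last first.
  by move=> j k [].
apply: eq_card => -[u v]; rewrite !inE.
apply/idP/imsetP => /= [/andP[/andP[/eqP-> /andP[_ vS]] vi]|[j]].
  by exists v => //; rewrite inE vS.
rewrite inE => /andP[jS ji] [-> ->]; rewrite eqxx jS ji andbT.
by rewrite -val_eqE neq_ltn ji.
Qed.

Lemma wedge_form0 (p : {mpoly K[n]}) b S : wedge (form0 p) b S = p * b S.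
Proof.
rewrite ffunE (bigD1 finset.set0) ?finset.sub0set //= big1 => [|I /andP[_ I0]]; last first.
  by rewrite ffunE (negPf I0) mulr0 mul0r.
rewrite ffunE eqxx addr0 finset.setD0.
rewrite (_ : [set _ in _ | _]%SET = finset.set0) ?cards0 ?expr0 ?mul1r //.
by apply/setP => u; rewrite !inE.
Qed.

Lemma wedge_form01 b S : wedge b (form0 1) S = b S.
Proof.
rewrite ffunE (bigD1 S) //= big1 => [|I /andP[IS I0]]; last first.
  rewrite [form0 1 _]ffunE finset.setD_eq0; case: ifP => [SI|]; last by rewrite mulr0.
  by move: I0; rewrite finset.eqEsubset IS SI.
rewrite [form0 1 _]ffunE finset.setDv eqxx addr0 mulr1.
rewrite (_ : [set _ in _ | _]%SET = finset.set0) ?cards0 ?expr0 ?mul1r //.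
by apply/setP => u; rewrite !inE andbF.
Qed.

Lemma ext_deriv_form0 (p : {mpoly K[n]}) : ext_deriv (form0 p) = one_form (fun i => p^`M(i)).
Proof.
apply/ffunP => S; have [/cards1P[i ->]|S1] := boolP (#|S| == 1%N).
  rewrite one_formE ffunE big_set1 ffunE finset.setDv eqxx.
  rewrite (_ : [set _ in _ | _]%SET = finset.set0) ?cards0 ?expr0 ?mul1r //.
  by apply/setP => u; rewrite !inE; case: eqP => // ->; rewrite ltnn.
rewrite one_form_kform // ffunE big1 // => i iS; rewrite ffunE; case: eqP => [e|].
  by move: S1; rewrite (cardsD1 i) iS e cards0.
by rewrite mderiv0 mulr0.
Qed.

Lemma contract_one_form (X : vector_field K n) a : is_kform 1 a ->
  contract X a = 0 <-> \sum_i X i * a [set i]%SET = 0.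
Proof.
move=> a1; have e0 : contract X a finset.set0 = \sum_i X i * a [set i]%SET.
  rewrite ffunE; apply: eq_big => [i|i _]; first by rewrite inE.
  rewrite (_ : [set _ in _ | _]%SET = finset.set0) ?cards0 ?expr0 ?mul1r ?finset.setU0 //.
  by apply/setP => u; rewrite !inE.
split=> [h|h]; first by rewrite -e0 h ffunE.
apply/ffunP => S; rewrite [RHS]ffunE; have [->|S0] := eqVneq S finset.set0; first by rewrite e0.
rewrite ffunE big1 // => i iS; rewrite a1 ?mulr0 // cardsU1 iS.
by rewrite -cards_eq0 in S0; lia.
Qed.

Lemma Sing_one_form a : is_kform 1 a ->
  Sing a = [set x | forall i, (a [set i]%SET).@[x] = 0]%classic.
Proof.
move=> a1; apply/seteqP; split=> x /= h; first by move=> i; exact: h.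
move=> S; have [/cards1P[i ->] //|S1] := boolP (#|S| == 1%N).
by rewrite a1 // meval0.
Qed.

End OneForms.

Section Pullback.
Variables (K : fieldType) (n m : nat) (phi : n.-tuple {mpoly K[m]}).

Definition pull (f : 'I_n -> {mpoly K[n]}) (j : 'I_m) : {mpoly K[m]} :=
  \sum_i (f i \mPo phi) * (tnth phi i)^`M(j).

Lemma pullbackE (a : diff_form K n) : is_kform 1 a ->
  pullback phi a = one_form (pull (fun i => a [set i]%SET)).
Proof.
move=> a1; apply/ffunP => S; rewrite /pullback.
rewrite (eq_bigl (fun I : {set 'I_n} => I \subset finset.setT)) => [|I]; last first.
  by rewrite finset.subsetT.
rewrite sum_sub_set1 => [|I I1]; last first.
  by apply/ffunP => S'; rewrite wedge_form0 a1 // comp_mpoly0 mul0r ffunE.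
rewrite (eq_bigl predT) => [|i]; last by rewrite inE.
rewrite sum_ffunE.
under eq_bigr => i _.
  rewrite wedge_form0 (@big_pred1_id _ _ _ _ i) => [|j]; last by rewrite /= inE.
  rewrite wedge_form01 ext_deriv_form0.
  over.
have [/cards1P[j ->]|S1] := boolP (#|S| == 1%N).
  by rewrite one_formE; apply: eq_bigr => i _; rewrite one_formE.
by rewrite one_form_kform // big1 // => i _; rewrite one_form_kform // mulr0.
Qed.

End Pullback.

Notation f0 := (ord0 : 'I_3).
Notation f1 := (lift ord0 ord0 : 'I_3).
Notation f2 := (lift ord0 (lift ord0 ord0) : 'I_3).
Notation e0 := (ord0 : 'I_4).
Notation e1 := (lift ord0 ord0 : 'I_4).
Notation e2 := (lift ord0 (lift ord0 ord0) : 'I_4).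
Notation e3 := (lift ord0 (lift ord0 (lift ord0 ord0)) : 'I_4).

Lemma ord3P (j : 'I_3) : [\/ j = f0, j = f1 | j = f2].
Proof.
by case: j => -[|[|[|//]]] ?; [apply: Or31|apply: Or32|apply: Or33]; apply/val_inj.
Qed.

Lemma ord4P (j : 'I_4) : [\/ j = e0, j = e1, j = e2 | j = e3].
Proof.
by case: j => -[|[|[|[|//]]]] ?; [apply: Or41|apply: Or42|apply: Or43|apply: Or44];
  apply/val_inj.
Qed.

Lemma card_setId (I : finType) (A : {set I}) (P : pred I) :
  #|[set k in A | P k]%SET| = (\sum_k ((k \in A) && P k))%N.
Proof.
rewrite -sum1_card big_mkcond; apply: eq_bigr => k _.
by rewrite inE; case: (_ && _).
Qed.

Section Volume3.
Variable K : fieldType.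
Implicit Types S X : vector_field K 3.

(** The components of the vector product X x S. *)
Definition cross S X (j : 'I_3) : {mpoly K[3]} :=
  match val j with
  | 0 => S f2 * X f1 - S f1 * X f2
  | 1 => S f0 * X f2 - S f2 * X f0
  | _ => S f1 * X f0 - S f0 * X f1
  end.

Lemma contract_volume3 S X :
  contract S (contract X (volume_form K 3)) = one_form (cross S X).
Proof.
have vol (i k : 'I_3) (A : {set 'I_3}) : i \notin A -> k \notin (i |: A)%SET ->
    volume_form K 3 (k |: (i |: A))%SET = (#|A| == 1%N)%:R.
  move=> iA kA; rewrite ffunE finset.eqEcard finset.subsetT.
  rewrite cardsU1 kA cardsU1 iA.
  have := max_card (k |: (i |: A))%SET; rewrite card_ord.
  rewrite cardsU1 kA cardsU1 iA => h.
  by move: h; rewrite /= cardsT card_ord; case: #|A| => [|[|m]].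
apply/ffunP => A; rewrite ffunE.
under eq_bigr => i iA.
  rewrite ffunE; under eq_bigr => k kA do rewrite (vol i k A iA kA).
  over.
have [/cards1P[j ->]|A1] := boolP (#|A| == 1%N); last first.
  rewrite one_form_kform // big1 // => i _.
  by rewrite big1 ?mulr0 // => k _; rewrite mulr0.
rewrite one_formE.
under eq_bigr => i _ do under eq_bigr => k _ do rewrite !card_setId mulr1.
under eq_bigr => i _ do rewrite card_setId.
by case: (ord3P j) => ->; rewrite /cross /=;
  rewrite big_mkcond !big_ord_recl !big_ord0 /= !finset.inE -!val_eqE /=;
  rewrite big_mkcond !big_ord_recl !big_ord0 /= !finset.inE -!val_eqE /=;
  rewrite big_mkcond !big_ord_recl !big_ord0 /= !finset.inE -!val_eqE /=;
  ring.
Qed.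

End Volume3.

(** * Integrability of one-forms *)

Section Integrability.
Variables (K : fieldType) (n : nat).
Implicit Types f g : 'I_n -> {mpoly K[n]}.

(* The coefficient of dx_a /\ dx_b /\ dx_c in f /\ dg. *)
Definition wedge_d f g (a b c : 'I_n) : {mpoly K[n]} :=
  f a * ((g c)^`M(b) - (g b)^`M(c)) + f b * ((g a)^`M(c) - (g c)^`M(a))
  + f c * ((g b)^`M(a) - (g a)^`M(b)).

Lemma wedge_dC12 f g a b c : wedge_d f g a b c = - wedge_d f g b a c.
Proof. by rewrite /wedge_d; ring. Qed.

Lemma wedge_dC23 f g a b c : wedge_d f g a b c = - wedge_d f g a c b.
Proof. by rewrite /wedge_d; ring. Qed.

Lemma wedge_d12 f g a c : wedge_d f g a a c = 0.
Proof. by rewrite /wedge_d; ring. Qed.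

Lemma wedge_d23 f g a c : wedge_d f g a c c = 0.
Proof. by rewrite /wedge_d; ring. Qed.

Lemma wedge_d13 f g a c : wedge_d f g a c a = 0.
Proof. by rewrite /wedge_d; ring. Qed.

Lemma euler_homog D (p : {mpoly K[n]}) : p \is D.-homog ->
  \sum_i 'X_i * p^`M(i) = D%:R *: p.
Proof.
move=> /dhomogP pD; rewrite (mpolyE p) scaler_sumr.
under eq_bigr => i _ do rewrite raddf_sum mulr_sumr /=.
rewrite exchange_big /= big_seq [RHS]big_seq; apply: eq_bigr => m /pD /= <-.
rewrite scalerA mulrC -scalerA mdegE natr_sum scaler_suml scaler_sumr.
apply: eq_bigr => i _; rewrite mderivZ -scalerAr mderivX -scalerAr; congr (_ *: _).
have [->|mi] := eqVneq (m i) 0%N; first by rewrite !scale0r.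
by rewrite -mpolyXD addmC submK // lep1mP.
Qed.

End Integrability.

Lemma setC1D2 (d i j k : 'I_4) : uniq [:: d; i; j; k] ->
  (~: [set d] :\ i :\ j)%SET = [set k]%SET.
Proof.
rewrite /= !inE !negb_or andbT => /and3P[/and3P[di dj dk] /andP[ij ik] jk].
have := cardsC1 d; rewrite card_ord (cardsD1 i) (cardsD1 j (_ :\ i)) !inE.
rewrite ![i == _]eq_sym ![j == _]eq_sym di ij dj => -[]; rewrite add0n => c1.
apply/esym/eqP; rewrite finset.eqEcard finset.sub1set !inE cards1 c1 leqnn andbT.
by rewrite ![k == _]eq_sym jk ik dk.
Qed.

Section Integrability4.
Variable K : fieldType.

Lemma wedge_ext_deriv (a : diff_form K 4) d : is_kform 1 a ->
  let T := wedge_d (fun i => a [set i]%SET) (fun i => a [set i]%SET) in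
  wedge a (ext_deriv a) (~: [set d])%SET =
    match val d with 0 => T e1 e2 e3 | 1 => T e0 e2 e3 | 2 => T e0 e1 e3 | _ => T e0 e1 e2 end.
Proof.
move=> a1 T; rewrite wedge_one_form //.
under eq_bigr => i _ do rewrite ffunE.
under eq_bigr => i _ do under eq_bigr => k _ do rewrite !card_setId.
under eq_bigr => i _ do rewrite card_setId.
have E i j k : uniq [:: d; i; j; k] -> a (~: [set d] :\ i :\ j)%SET = a [set k]%SET.
  by move/setC1D2 ->.
rewrite /T /wedge_d.
move: E; case: (ord4P d) => -> E /=;
  rewrite big_mkcond !big_ord_recl !big_ord0 /= !finset.inE -!val_eqE /=;
  rewrite big_mkcond !big_ord_recl !big_ord0 /= !finset.inE -!val_eqE /=;
  rewrite big_mkcond !big_ord_recl !big_ord0 /= !finset.inE -!val_eqE /=;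
  rewrite big_mkcond !big_ord_recl !big_ord0 /= !finset.inE -!val_eqE /=.
- rewrite (E e1 e2 e3 isT) (E e1 e3 e2 isT) (E e2 e1 e3 isT) (E e2 e3 e1 isT)
    (E e3 e1 e2 isT) (E e3 e2 e1 isT); ring.
- rewrite (E e0 e2 e3 isT) (E e0 e3 e2 isT) (E e2 e0 e3 isT) (E e2 e3 e0 isT)
    (E e3 e0 e2 isT) (E e3 e2 e0 isT); ring.
- rewrite (E e1 e0 e3 isT) (E e1 e3 e0 isT) (E e0 e1 e3 isT) (E e0 e3 e1 isT)
    (E e3 e1 e0 isT) (E e3 e0 e1 isT); ring.
- rewrite (E e1 e2 e0 isT) (E e1 e0 e2 isT) (E e2 e1 e0 isT) (E e2 e0 e1 isT)
    (E e0 e1 e2 isT) (E e0 e2 e1 isT); ring.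
Qed.

Lemma integrableP (f : 'I_4 -> {mpoly K[4]}) :
  (forall a b c, wedge_d f f a b c = 0) ->
  wedge (one_form f) (ext_deriv (one_form f)) = 0.
Proof.
move=> h; apply/ffunP => S; rewrite [RHS]ffunE.
have f1 := one_form_kform f.
have [S3|S3] := eqVneq #|S| 3%N; last first.
  rewrite wedge_one_form // big1 // => i iS; rewrite [ext_deriv _ _]ffunE big1 ?mulr0 // => j jS.
  rewrite [one_form f (S :\ i :\ j)]f1 ?mderiv0 ?mulr0 //.
  have := cardsD1 i S; rewrite iS; have := cardsD1 j (S :\ i); rewrite jS.
  by move: S3; lia.
have /cards1P[d Sd] : #|~: S| == 1%N by have := cardsC S; rewrite card_ord; lia.
rewrite -[S]finset.setCK Sd wedge_ext_deriv //.
have e : (fun i => one_form f [set i]%SET) = f by apply/funext => i; rewrite one_formE.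
by rewrite e; case: (ord4P d) => -> /=; rewrite h.
Qed.

Lemma integrable_coef (a : diff_form K 4) : is_kform 1 a ->
  wedge a (ext_deriv a) = 0 ->
  wedge_d (fun i => a [set i]%SET) (fun i => a [set i]%SET) e0 e1 e2 = 0.
Proof. by move=> a1 h; have := wedge_ext_deriv e3 a1; rewrite h ffunE. Qed.

(* Contraction with the radial field reduces integrability to one coefficient. *)
Lemma wedge_d_radial (f : 'I_4 -> {mpoly K[4]}) D :
  (forall i, f i \is D.-homog) -> \sum_i 'X_i * f i = 0 ->
  wedge_d f f e0 e1 e2 = 0 -> forall a b c, wedge_d f f a b c = 0.
Proof.
move=> fD Rf f012.
have dR c : \sum_i 'X_i * (f i)^`M(c) = - f c.
  have : (\sum_i 'X_i * f i)^`M(c) = 0 by rewrite Rf mderiv0.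
  rewrite raddf_sum /= (bigD1 c) //= => e.
  apply/eqP; rewrite -addr_eq0 -[X in _ == X]e (bigD1 c) //=; apply/eqP.
  rewrite mderivM mderivX mnmE eqxx scale1r.
  have -> : (U_(c) - U_(c) = 0)%MM by apply/mnmP => k; rewrite !mnmE subnn.
  rewrite mpolyX0 mul1r [X in _ = _ + X](eq_bigr (fun i => 'X_i * (f i)^`M(c))) => [|i ic].
    by ring.
  by rewrite mderivM mderivX mnmE (negPf ic) scale0r mul0r add0r.
(* Contraction of f /\ df with the radial field R: i_R f = 0, while i_R df is the Lie derivative (D
   + 1) f, whose product with f is zero. For fixed b and c this leaves x_3 times an unknown
   coefficient, which therefore vanishes. *)
have RT b c : \sum_i 'X_i * wedge_d f f i b c = 0.
  have -> : \sum_i 'X_i * wedge_d f f i b c =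
      (\sum_i 'X_i * f i) * ((f c)^`M(b) - (f b)^`M(c))
      + f b * (\sum_i 'X_i * (f i)^`M(c) - \sum_i 'X_i * (f c)^`M(i))
      + f c * (\sum_i 'X_i * (f b)^`M(i) - \sum_i 'X_i * (f i)^`M(b)).
    rewrite -!sumrB mulr_suml !mulr_sumr -!big_split /=.
    by apply: eq_bigr => i _; rewrite /wedge_d; ring.
  rewrite Rf !dR !(euler_homog (fD _)) -!mul_mpolyC; ring.
have X0 (i : 'I_4) : 'X_i != 0 :> {mpoly K[4]}.
  by rewrite -msize_poly_eq0 msizeX.
have f312 : wedge_d f f e3 e1 e2 = 0.
  have := RT e1 e2; rewrite !big_ord_recl big_ord0 f012 wedge_d12 wedge_d13 !mulr0 !add0r addr0.
  by move/eqP; rewrite mulf_eq0 (negPf (X0 _)) => /eqP.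
have f302 : wedge_d f f e3 e0 e2 = 0.
  have := RT e0 e2; rewrite !big_ord_recl big_ord0 [wedge_d _ _ e1 _ _]wedge_dC12 f012.
  rewrite wedge_d12 wedge_d13 oppr0 !mulr0 !add0r addr0.
  by move/eqP; rewrite mulf_eq0 (negPf (X0 _)) => /eqP.
have f301 : wedge_d f f e3 e0 e1 = 0.
  have f201 : wedge_d f f e2 e0 e1 = 0 by rewrite wedge_dC12 wedge_dC23 f012 !oppr0.
  have := RT e0 e1; rewrite !big_ord_recl big_ord0 f201.
  rewrite wedge_d12 wedge_d13 !mulr0 !add0r addr0.
  by move/eqP; rewrite mulf_eq0 (negPf (X0 _)) => /eqP.
move=> a b c; case: (ord4P a) => ->; case: (ord4P b) => ->; case: (ord4P c) => ->;
  rewrite ?wedge_d12 ?wedge_d13 ?wedge_d23 //;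
  first [ done
    | by rewrite wedge_dC12 ?f012 ?f312 ?f302 ?f301 ?oppr0
    | by rewrite wedge_dC23 ?f012 ?f312 ?f302 ?f301 ?oppr0
    | by rewrite wedge_dC12 wedge_dC23 ?f012 ?f312 ?f302 ?f301 ?oppr0
    | by rewrite wedge_dC23 wedge_dC12 ?f012 ?f312 ?f302 ?f301 ?oppr0
    | by rewrite wedge_dC12 wedge_dC23 wedge_dC12 ?f012 ?f312 ?f302 ?f301 ?oppr0 ].
Qed.

End Integrability4.

Lemma pull_id (K : fieldType) n (f : 'I_n -> {mpoly K[n]}) :
  pull [tuple 'X_i | i < n] f = f.
Proof.
apply/funext => j; rewrite /pull (bigD1 j) //= big1 ?addr0 => [|i ij].
  rewrite comp_mpoly_id tnth_mktuple mderivX mnmE eqxx scale1r.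
  have -> : (U_(j) - U_(j) = 0)%MM by apply/mnmP => k; rewrite !mnmE subnn.
  by rewrite mpolyX0 mulr1.
by rewrite tnth_mktuple mderivX mnmE (negPf ij) scale0r mulr0.
Qed.

Lemma mderivX1 (K : comNzRingType) n (i j : 'I_n) :
  ('X_i : {mpoly K[n]})^`M(j) = (i == j)%:R.
Proof.
rewrite mderivX mnmE; case: eqP => [->|_]; last by rewrite scale0r.
rewrite scale1r; have -> : (U_(j) - U_(j) = 0)%MM by apply/mnmP => k; rewrite !mnmE subnn.
by rewrite mpolyX0.
Qed.

Lemma mderiv_sum (K : comNzRingType) n (I : Type) (r : seq I) (P : pred I)
    (F : I -> {mpoly K[n]}) j :
  (\sum_(i <- r | P i) F i)^`M(j) = \sum_(i <- r | P i) (F i)^`M(j).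
Proof. by elim/big_rec2: _ => [|i x y _ <-]; rewrite ?mderiv0 ?mderivD. Qed.

Lemma dhomog_mderiv (K : comNzRingType) n D (p : {mpoly K[n]}) i :
  p \is D.+1.-homog -> p^`M(i) \is D.-homog.
Proof.
move=> pD; apply/dhomogP => m; rewrite mcoeff_msupp mcoeff_deriv => h.
have : (m + U_(i))%MM \in msupp p.
  by rewrite mcoeff_msupp; apply: contraNneq h => ->; rewrite mul0rn.
by move/dhomogP: pD => /[apply] /=; rewrite mdegD mdeg1 addn1 => -[].
Qed.

Section PullComp.
Variables (K : fieldType) (n m k : nat).

Lemma pull_comp (t : n.-tuple {mpoly K[m]}) (u : m.-tuple {mpoly K[k]}) f :
  pull [tuple tnth t i \mPo u | i < n] f = pull u (pull t f).
Proof.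
apply/funext => j; rewrite /pull.
under [RHS]eq_bigr => l _ do rewrite rmorph_sum mulr_suml.
rewrite exchange_big; apply: eq_bigr => i _.
rewrite -comp_mpolyA tnth_mktuple mderiv_comp mulr_sumr.
by apply: eq_bigr => l _; rewrite rmorphM /= mulrA.
Qed.

Lemma pullD (t : n.-tuple {mpoly K[m]}) f g :
  pull t (fun i => f i + g i) = fun j => pull t f j + pull t g j.
Proof.
apply/funext => j; rewrite /pull -big_split.
by apply: eq_bigr => i _; rewrite rmorphD mulrDl.
Qed.

Lemma pullZ (t : n.-tuple {mpoly K[m]}) c f :
  pull t (fun i => c *: f i) = fun j => c *: pull t f j.
Proof.
apply/funext => j; rewrite /pull scaler_sumr.
by apply: eq_bigr => i _; rewrite comp_mpolyZ scalerAl.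
Qed.

End PullComp.

Section AlternatingSum.
Variables (R : comNzRingType) (I : finType).
Implicit Types (u v w : I -> R) (p : I -> R) (d : I -> I -> R).

Let swap23 (F : I -> I -> I -> R) :
  \sum_i \sum_j \sum_k F i j k = \sum_i \sum_j \sum_k F i k j.
Proof. by apply: eq_bigr => i _; rewrite exchange_big. Qed.

Let swap12 (F : I -> I -> I -> R) :
  \sum_i \sum_j \sum_k F i j k = \sum_i \sum_j \sum_k F j i k.
Proof. by rewrite exchange_big. Qed.

(** The expression is the 3-form with the vanishing coefficients of the hypothesis, evaluated on the
    vectors u, v, w. Renaming the summation indices gives all six sums the common factor u_i v_j
    w_k. *)
Lemma alternating_sum_eq0 u v w p d :
  (forall i j k, p i * (d j k - d k j) + p j * (d k i - d i k) + p k * (d i j - d j i) = 0) ->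
  let G u v w := \sum_i \sum_j \sum_k (u i * v j * w k) * (p i * d j k) in
  G u v w - G u w v + G v w u - G v u w + G w u v - G w v u = 0.
Proof.
move=> h G; pose c i j k := u i * v j * w k.
have -> : G u w v = \sum_i \sum_j \sum_k c i j k * (p i * d k j).
  by rewrite /G swap23; do 3 (apply: eq_bigr => ? _); rewrite /c; ring.
have -> : G v u w = \sum_i \sum_j \sum_k c i j k * (p j * d i k).
  by rewrite /G swap12; do 3 (apply: eq_bigr => ? _); rewrite /c; ring.
have -> : G v w u = \sum_i \sum_j \sum_k c i j k * (p j * d k i).
  by rewrite /G swap23 swap12; do 3 (apply: eq_bigr => ? _); rewrite /c; ring.
have -> : G w u v = \sum_i \sum_j \sum_k c i j k * (p k * d i j).
  by rewrite /G swap12 swap23; do 3 (apply: eq_bigr => ? _); rewrite /c; ring.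
have -> : G w v u = \sum_i \sum_j \sum_k c i j k * (p k * d j i).
  by rewrite /G swap23 swap12 swap23; do 3 (apply: eq_bigr => ? _); rewrite /c; ring.
rewrite /G.
rewrite -!sumrN -!big_split big1 // => i _ /=.
rewrite -!sumrN -!big_split big1 // => j _ /=.
rewrite -!sumrN -!big_split big1 // => k _ /=.
by rewrite -[RHS](mulr0 (c i j k)) -(h i j k) /c; ring.
Qed.

End AlternatingSum.

(** * Linear changes of coordinates and the affine chart *)

Section Linear.
Variable K : fieldType.
Implicit Types (A B : 'M[K]_4) (f : 'I_4 -> {mpoly K[4]}).

Definition lin A : 4.-tuple {mpoly K[4]} := [tuple \sum_j A i j *: 'X_j | i < 4].

Definition dehom : 4.-tuple {mpoly K[3]} :=
  [tuple oapp (fun l : 'I_3 => 'X_l) 1 (unlift ord_max i) | i < 4].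

Lemma lin_deriv A i j : (tnth (lin A) i)^`M(j) = (A i j)%:MP.
Proof.
rewrite tnth_mktuple raddf_sum /= (bigD1 j) //= big1 ?addr0 => [|k kj].
  by rewrite mderivZ mderivX1 eqxx -mul_mpolyC mulr1.
by rewrite mderivZ mderivX1 (negPf kj) scaler0.
Qed.

Lemma lin_comp A B : [tuple tnth (lin A) i \mPo lin B | i < 4] = lin (A *m B).
Proof.
apply/eq_from_tnth => i; rewrite !tnth_mktuple raddf_sum /=.
under eq_bigr => j _.
  rewrite comp_mpolyZ comp_mpolyXU -tnth_nth tnth_mktuple scaler_sumr; over.
rewrite exchange_big; apply: eq_bigr => l _.
rewrite mxE scaler_suml; apply: eq_bigr => j _.
by rewrite scalerA.
Qed.

Lemma lin1 : lin 1%:M = [tuple 'X_i | i < 4].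
Proof.
apply/eq_from_tnth => i; rewrite !tnth_mktuple (bigD1 i) //= big1 => [|j ji].
  by rewrite mxE eqxx scale1r addr0.
by rewrite mxE eq_sym (negPf ji) scale0r.
Qed.

Lemma chartE A : chart A = [tuple tnth (lin A) i \mPo dehom | i < 4].
Proof.
apply/eq_from_tnth => i; rewrite !tnth_mktuple raddf_sum /=.
by apply: eq_bigr => j _; rewrite comp_mpolyZ comp_mpolyXU -tnth_nth tnth_mktuple.
Qed.

Lemma pull_chart A f : pull (chart A) f = pull dehom (pull (lin A) f).
Proof. by rewrite chartE pull_comp. Qed.

Lemma pull_lin_mul A B f : pull (lin B) (pull (lin A) f) = pull (lin (A *m B)) f.
Proof. by rewrite -lin_comp pull_comp. Qed.

Lemma pull_lin1 f : pull (lin 1%:M) f = f.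
Proof. by rewrite lin1 pull_id. Qed.

Lemma pull_linE A f j : pull (lin A) f j = \sum_i A i j *: (f i \mPo lin A).
Proof. by apply: eq_bigr => i _; rewrite lin_deriv mulrC mul_mpolyC. Qed.

Lemma dehom_lift (j : 'I_3) : tnth dehom (lift ord_max j) = 'X_j.
Proof. by rewrite tnth_mktuple liftK. Qed.

Lemma dehom_max : tnth dehom ord_max = 1.
Proof. by rewrite tnth_mktuple unlift_none. Qed.

Lemma mderiv_dehom p j : (p \mPo dehom)^`M(j) = p^`M(lift ord_max j) \mPo dehom.
Proof.
rewrite mderiv_comp (bigD1 (lift ord_max j)) //= dehom_lift mderivX1 eqxx mulr1.
rewrite big1 ?addr0 // => i; case: (unliftP ord_max i) => [k|] -> ij.
  rewrite dehom_lift mderivX1; case: eqP => [kj|]; last by rewrite mulr0.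
  by rewrite kj eqxx in ij.
by rewrite dehom_max -mpolyC1 mderivC mulr0.
Qed.

Lemma pull_dehom f j : pull dehom f j = f (lift ord_max j) \mPo dehom.
Proof.
rewrite /pull (bigD1 (lift ord_max j)) //= dehom_lift mderivX1 eqxx mulr1.
rewrite big1 ?addr0 // => i; case: (unliftP ord_max i) => [k|] -> ij.
  rewrite dehom_lift mderivX1; case: eqP => [kj|]; last by rewrite mulr0.
  by rewrite kj eqxx in ij.
by rewrite dehom_max -mpolyC1 mderivC mulr0.
Qed.

Lemma dhomog_comp_lin A D (p : {mpoly K[4]}) : p \is D.-homog -> p \mPo lin A \is D.-homog.
Proof.
move=> /dhomogP pD; rewrite comp_mpolyEX big_seq; apply: rpred_sum => m /pD /= <-.
apply: rpredZ; rewrite comp_mpolyX mdegE.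
elim/big_ind2: _ => [|a x b y ha hb|i _]; [exact: dhomog1|exact: dhomogM|].
have h : tnth (lin A) i \is 1.-homog.
  rewrite tnth_mktuple; apply: rpred_sum => j _; apply: rpredZ.
  by rewrite dhomogX /= mdeg1.
by have := dhomogMn (m i) h; rewrite mul1n.
Qed.

Lemma pull_lin_homog A D f : (forall i, f i \is D.-homog) ->
  forall j, pull (lin A) f j \is D.-homog.
Proof.
move=> fD j; rewrite pull_linE; apply: rpred_sum => i _.
by apply/rpredZ/dhomog_comp_lin.
Qed.

Lemma pull_lin_radial A f : \sum_i 'X_i * f i = 0 -> \sum_j 'X_j * pull (lin A) f j = 0.
Proof.
move=> /(congr1 (comp_mpoly (lin A))); rewrite comp_mpoly0 raddf_sum /= => Rf.
rewrite -[RHS]Rf.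
under eq_bigr => j _ do rewrite pull_linE mulr_sumr.
rewrite exchange_big; apply: eq_bigr => i _.
rewrite rmorphM /= comp_mpolyXU -tnth_nth tnth_mktuple mulr_suml.
by apply: eq_bigr => j _; rewrite -scalerAr scalerAl.
Qed.

Lemma pull_lin_integrable A f : (forall a b c, wedge_d f f a b c = 0) ->
  forall a b c, wedge_d (pull (lin A) f) (pull (lin A) f) a b c = 0.
Proof.
move=> f0 a b c.
pose p i := f i \mPo lin A; pose d j k := (f k)^`M(j) \mPo lin A.
pose u a i : {mpoly K[4]} := (A i a)%:MP.
pose G a b c := \sum_i \sum_j \sum_k (u a i * u b j * u c k) * (p i * d j k).
have GE a' b' c' : pull (lin A) f a' * (pull (lin A) f c')^`M(b') = G a' b' c'.
  rewrite !pull_linE mulr_suml; apply: eq_bigr => i _.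
  rewrite exchange_big mderiv_sum mulr_sumr; apply: eq_bigr => k _.
  rewrite mderivZ mderiv_comp [A k c' *: _]scaler_sumr mulr_sumr; apply: eq_bigr => j _.
  rewrite lin_deriv -!mul_mpolyC -/(p i) -/(d j k) /u.
  by move: (p i) (d j k) => x y; ring.
have -> : wedge_d (pull (lin A) f) (pull (lin A) f) a b c =
    G a b c - G a c b + G b c a - G b a c + G c a b - G c b a.
  by rewrite -!GE /wedge_d; ring.
apply: alternating_sum_eq0 => i j k.
have /(congr1 (comp_mpoly (lin A))) := f0 i j k.
by rewrite comp_mpoly0 => e; rewrite -[RHS]e /wedge_d !(rmorphD, rmorphM, rmorphN).
Qed.

End Linear.

(** * Quasi-homogeneous forms *)

Section Dehomogenization.
Variable K : numFieldType.

(** By homogeneity [p] vanishes wherever the last coordinate is nonzero, so its product with that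
    coordinate vanishes everywhere. *)
Lemma dehom_eq0 D (p : {mpoly K[4]}) : p \is D.-homog -> p \mPo dehom K = 0 -> p = 0.
Proof.
move=> pD p0; have : p * 'X_ord_max = 0.
  apply: mpoly_eq0_meval => x; rewrite mevalM mevalXU.
  have [->|x3] := eqVneq (x ord_max) 0; first by rewrite mulr0.
  pose y (j : 'I_3) := x (lift ord_max j) / x ord_max.
  have py : p.@[fun i => (tnth (dehom K) i).@[y]] = 0.
    by rewrite -comp_mpoly_meval p0 meval0.
  rewrite (homog_mevalZ pD (c := x ord_max) (v := fun i => (tnth (dehom K) i).@[y])).
    by rewrite py mulr0 mul0r.
  move=> i; case: (unliftP ord_max i) => [j|] ->.
    by rewrite dehom_lift mevalXU /y mulrC divfK.
  by rewrite dehom_max meval1 mulr1.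
have X0 : 'X_ord_max != 0 :> {mpoly K[4]} by rewrite -msize_poly_eq0 msizeX.
by move/eqP; rewrite mulf_eq0 (negPf X0) orbF => /eqP.
Qed.

End Dehomogenization.

Section CrossIntegrable.
Variable K : fieldType.
Implicit Types S X : vector_field K 3.

(* omega /\ d omega is the determinant of S, X, [S, X]. *)
Lemma cross_integrable (p q r : nat) (l : K) X :
  lie_bracket (diag_field K p q r) X = l *: X ->
  wedge_d (cross (diag_field K p q r) X) (cross (diag_field K p q r) X) f0 f1 f2 = 0.
Proof.
set S := diag_field K p q r => SX.
pose B i := \sum_j (S j * (X i)^`M(j) - X j * (S i)^`M(j)).
have BE i : B i = l *: X i.
  have := congr1 (fun Y : vector_field K 3 => Y i) SX.
  by rewrite [LHS]ffunE [RHS]ffunE.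
have -> : wedge_d (cross S X) (cross S X) f0 f1 f2 =
    - (S f0 * (X f1 * B f2 - X f2 * B f1) + S f1 * (X f2 * B f0 - X f0 * B f2)
     + S f2 * (X f0 * B f1 - X f1 * B f0)).
  rewrite /B !big_ord_recl !big_ord0 /wedge_d /cross /= !mderivB !mderivM.
  by ring.
by rewrite !BE -!mul_mpolyC; ring.
Qed.

End CrossIntegrable.

Section QuasiHomogeneousForms.
Variables (K : numFieldType) (p q r : nat) (l : int) (e : nat).
Let S := diag_field K p q r.
Implicit Types (f g : 'I_4 -> {mpoly K[4]}) (A : 'M[K]_4).

(** The linear conditions on a member of the family, without the bound on its singular set. They
    define a vector space, in which curves can be drawn freely. *)
Definition qh_form f : Prop :=
  [/\ forall i, f i \is e.+1.-homog, \sum_i 'X_i * f i = 0 &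
      exists2 X : vector_field K 3, lie_bracket S X = l%:~R *: X &
        forall j, pull (dehom K) f j = cross S X j].

Lemma qh_formD f g : qh_form f -> qh_form g -> qh_form (fun i => f i + g i).
Proof.
move=> [fh fR [X SX fX]] [gh gR [Y SY gY]]; split.
- by move=> i; apply: rpredD.
- by under eq_bigr => i _ do rewrite mulrDr; rewrite big_split /= fR gR addr0.
exists (X + Y) => [|j].
  rewrite scalerDr -SX -SY; apply/ffunP => i; rewrite !ffunE -big_split.
  by apply: eq_bigr => j _; rewrite !ffunE mderivD /=; ring.
rewrite pullD fX gY /cross !ffunE.
by case: (val j) => [|[|k]]; ring.
Qed.

Lemma qh_formZ c f : qh_form f -> qh_form (fun i => c *: f i).
Proof.
move=> [fh fR [X SX fX]]; split.
- by move=> i; apply: rpredZ.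
- by under eq_bigr => i _ do rewrite -scalerAr; rewrite -scaler_sumr fR scaler0.
exists (c *: X) => [|j].
  rewrite scalerA mulrC -scalerA -SX; apply/ffunP => i; rewrite !ffunE scaler_sumr.
  apply: eq_bigr => j _; rewrite !ffunE !mderivZ.
  by rewrite -!mul_mpolyC; ring.
by rewrite pullZ fX /cross !ffunE; case: (val j) => [|[|k]];
  rewrite -!scalerAr scalerBr.
Qed.

(** On the chart the form is integrable by [cross_integrable]; homogeneity lifts this to the
    coefficient of dx_0 /\ dx_1 /\ dx_2, and the radial field gives the other coefficients. *)
Lemma qh_form_integrable f : qh_form f -> forall a b c, wedge_d f f a b c = 0.
Proof.
move=> [fh fR [X SX fX]]; apply: (wedge_d_radial fh fR).
have dh (i j : 'I_4) : (f i)^`M(j) \is e.-homog by apply: dhomog_mderiv.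
apply: (@dehom_eq0 _ (e.+1 + e)).
  by rewrite /wedge_d; do ?apply: rpredD; apply: dhomogM => //; apply: rpredB.
have L (j : 'I_3) (i : 'I_4) : val i = val j -> lift ord_max j = i.
  by move=> ij; apply/val_inj; rewrite ij /= /bump leqNgt ltn_ord.
have <- : wedge_d (pull (dehom K) f) (pull (dehom K) f) f0 f1 f2 =
    wedge_d f f e0 e1 e2 \mPo dehom K.
  rewrite /wedge_d !pull_dehom !mderiv_dehom.
  rewrite (L f0 e0) // (L f1 e1) // (L f2 e2) //.
  by rewrite !(rmorphD, rmorphM, rmorphN).
have -> : pull (dehom K) f = cross S X by apply/funext.
exact: cross_integrable SX.
Qed.

Lemma defining_form_properties (F : foliation K e) Omega : defining_forms F Omega ->
  [/\ is_kform 1 Omega, forall i, Omega [set i]%SET \is e.+1.-homog,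
      \sum_i 'X_i * Omega [set i]%SET = 0 &
      wedge_d (fun i => Omega [set i]%SET) (fun i => Omega [set i]%SET) e0 e1 e2 = 0].
Proof.
case: F => _ /= [Om [Om1 Omh Omi OmR _] ->] [c c0 <-].
have E i : (c *: Om) [set i]%SET = c *: Om [set i]%SET by rewrite ffunE.
split=> [I I1|i||].
- by rewrite ffunE Om1 // scaler0.
- by rewrite E; apply/rpredZ/Omh.
- have /(contract_one_form _ Om1) OmR' := OmR.
  rewrite -[RHS](scaler0 _ c) -[in RHS]OmR' scaler_sumr.
  by apply: eq_bigr => i _; rewrite E -scalerAr ffunE.
have := integrable_coef Om1 Omi; rewrite /wedge_d !E !mderivZ => h.
by rewrite -[RHS](scaler0 _ (c * c)) -[in RHS]h -!mul_mpolyC mpolyCM; ring.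
Qed.

Lemma foliation_form_one_form f :
  (forall i, f i \is e.+1.-homog) -> \sum_i 'X_i * f i = 0 ->
  (forall a b c, wedge_d f f a b c = 0) -> codim_ge 2 (Sing (one_form f)) ->
  foliation_form e (one_form f).
Proof.
move=> fh fR fi fc; split=> //.
- exact: one_form_kform.
- by move=> i; rewrite one_formE.
- exact: integrableP.
- apply/contract_one_form; first exact: one_form_kform.
  by rewrite -[RHS]fR; apply: eq_bigr => i _; rewrite one_formE ffunE.
Qed.

Definition foliation_of Omega (H : foliation_form e Omega) : foliation K e :=
  @Foliation K e _ (ex_intro2 _ _ Omega H erefl).

Lemma foliation_ofE Omega (H : foliation_form e Omega) :
  defining_forms (foliation_of H) Omega.
Proof. by exists 1; rewrite ?scale1r //=; exact: oner_neq0. Qed.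

Local Notation QH := (@quasi_homogeneous_foliations K p q r l e).

(** Parametrization of the family by invertible matrices and the vector space [qh_form]; the matrix
    is the inverse of that of the chart. *)
Lemma quasi_homogeneousP (F : foliation K e) : QH F <->
  exists A, A \in unitmx /\
  exists2 f, qh_form f & defining_forms F (one_form (pull (lin A) f)).
Proof.
split=> [[A [Au [Om FOm [X SX e']]]]|[A [Au [f [fh fR [X SX fX]] Ff]]]].
  have [Om1 Omh OmR _] := defining_form_properties FOm.
  pose f := pull (lin A) (fun i => Om [set i]%SET).
  exists (invmx A); split; first by rewrite unitmx_inv.
  exists f; last first.
    by rewrite pull_lin_mul mulmxV // pull_lin1 one_formK.
  split; [exact: pull_lin_homog|exact: pull_lin_radial|exists X => // j].
  rewrite /f -pull_chart.
  move: e'; rewrite pullbackE // contract_volume3 => /ffunP/(_ [set j]%SET).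
  by rewrite !one_formE.
exists (invmx A); split; first by rewrite unitmx_inv.
exists (one_form (pull (lin A) f)) => //; exists X => //.
rewrite pullbackE ?contract_volume3; last exact: one_form_kform.
apply: one_form_ext => j; rewrite -fX pull_chart; congr (pull _ _ j).
have -> : (fun i => one_form (pull (lin A) f) [set i]%SET) = pull (lin A) f.
  by apply/funext => i; rewrite one_formE.
by rewrite pull_lin_mul mulmxV // pull_lin1.
Qed.

End QuasiHomogeneousForms.

(** * A criterion for irreducible components *)

Lemma foliation_closedP (K : fieldType) e (Z : set (foliation K e)) :
  closed Z <-> exists2 I, I `<=` @homogeneous K e & Z = zero_locus (@foliation_vanish K e) I.
Proof.
split=> [/closed_openC [I IH eI]|[I IH ->]].
  by exists I => //; rewrite -eI setCK.
by rewrite -openC; exists I => //; rewrite setCK.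
Qed.

Section Curves.
Variables (K : numFieldType) (p q r : nat) (l : int) (e : nat).
Variables (a b w v : 'I_4 -> K).
Implicit Types (f : 'I_4 -> {mpoly K[4]}).

Definition combo (c : 'I_4 -> K) f := \sum_i c i *: f i.

(** A polynomial in the coefficients of [f] whose nonvanishing implies the codimension bound: it
    turns that bound into an open condition that can be followed along a curve. *)
Definition line_resultant f : K :=
  \det (sylvester e.+1 (on_line w v (combo a f)) (on_line w v (combo b f))).

Lemma line_resultant_codim f : (forall i, f i \is e.+1.-homog) ->
  line_resultant f != 0 -> codim_ge 2 (Sing (one_form f)).
Proof.
move=> fh; apply: codim_ge2_resultant => //.
- by apply: rpred_sum => i _; exact/rpredZ/fh.
- by apply: rpred_sum => i _; exact/rpredZ/fh.
move=> x; rewrite (Sing_one_form (one_form_kform f)) /= => h.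
by split; rewrite /combo rmorph_sum big1 // => i _; rewrite /= mevalZ -[f i]one_formE h mulr0.
Qed.

Local Notation QH := (@quasi_homogeneous_foliations K p q r l e).

Variables (A : K -> 'M[K]_4) (f : K -> 'I_4 -> {mpoly K[4]}).
Hypothesis Areg : forall i j, polynomial1 (fun t => A t i j).
Hypothesis freg : forall i, reg_mpoly (@polynomial1 K) (fun t => f t i).
Hypothesis fqh : forall t, qh_form p q r l e (f t).

Let g t := pull (lin (A t)) (f t).
Let reg := polynomial1_algebra K.

Let fh t i : f t i \is e.+1.-homog. Proof. by case: (fqh t). Qed.

Let msize_homog (h : {mpoly K[4]}) : h \is e.+1.-homog -> (msize h <= e.+2)%N.
Proof.
move=> /dhomogP hh; rewrite leqNgt; apply/negP => lt.
have h0 : h != 0 by apply/eqP => h0; rewrite h0 msize0 in lt.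
by move: lt; rewrite -mlead_deg // hh ?mlead_supp // ltnn.
Qed.

Let greg j : reg_mpoly (@polynomial1 K) (fun t => g t j).
Proof.
apply: reg_mpoly_ext; first by move=> t; rewrite /g pull_linE.
apply: (reg_mpoly_sum reg) => i _; apply: (reg_mpolyZ reg) => //.
apply: (reg_mpoly_comp reg (b := e.+2)) => // [t|k]; first exact: msize_homog.
apply: reg_mpoly_ext; first by move=> t; rewrite tnth_mktuple.
apply: (reg_mpoly_sum reg) => m _; apply: (reg_mpolyZ reg) => //.
exact: reg_mpolyC.
Qed.

Let gh t j : g t j \is e.+1.-homog. Proof. exact: pull_lin_homog. Qed.

(** A polynomial in t; where it is nonzero, the curve is in the family. *)
Definition good t := \det (A t) * line_resultant (g t).

Lemma good_polynomial : polynomial1 good.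
Proof.
apply: (regM reg); first exact: reg_det.
apply: (reg_det reg) => i j.
have cr c : reg_poly (@polynomial1 K) (fun t => on_line w v (combo c (g t))).
  apply: (reg_poly_mmap reg (b := e.+2)) => [t||k].
  - by apply: msize_homog; apply: rpred_sum => k _; apply/rpredZ/gh.
  - apply: (reg_mpoly_sum reg) => k _; apply: (reg_mpolyZ reg) => //; exact: (regC reg).
  - exact: reg_polyC.
have sh c k : polynomial1 (fun t => (on_line w v (combo c (g t)) * 'X^k)`_j).
  by apply: (reg_polyM reg) => //; exact: reg_polyC.
case ij : (split i) => [k|k].
  by apply: reg_ext (sh a k) => t; rewrite mxE ij.
by apply: reg_ext (sh b k) => t; rewrite mxE ij.
Qed.

Lemma good_foliation t : good t != 0 ->
  exists H : foliation_form e (one_form (g t)), QH (foliation_of H).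
Proof.
rewrite /good mulf_eq0 negb_or => /andP[dA res].
have [_ fR _] := fqh t; have fi := qh_form_integrable (fqh t).
have H : foliation_form e (one_form (g t)).
  apply: foliation_form_one_form => //.
  - exact: pull_lin_radial.
  - exact: pull_lin_integrable.
  - exact: line_resultant_codim.
exists H; apply/quasi_homogeneousP; exists (A t); split.
  by rewrite unitmxE unitfE.
by exists (f t) => //; exact: foliation_ofE.
Qed.

Lemma coords_curve : exists gam : 'I_(ncoords e) -> {poly K},
  forall t k, (gam k).[t] = @coords K e (one_form (g t)) k.
Proof.
have h k : exists c : {poly K}, forall t, c.[t] = @coords K e (one_form (g t)) k.
  have [c cE] := greg (enum_val k).1 (enum_val k).2.
  by exists c => t; rewrite -cE /coords one_formE.
by have [gam gamE] := choice h; exists gam => t k.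
Qed.

(** The product of [P] along the curve with the nonzero polynomial [good] vanishes at every t, so it
    is the zero polynomial. *)
Lemma curve_vanish t0 (gam : 'I_(ncoords e) -> {poly K}) (P : {mpoly K[ncoords e]}) :
  good t0 != 0 -> (forall t k, (gam k).[t] = @coords K e (one_form (g t)) k) ->
  (forall Omega (H : foliation_form e Omega), QH (foliation_of H) ->
     P.@[@coords K e Omega] = 0) ->
  along gam P = 0.
Proof.
move=> t0g gamE PQ; have [d dE] := good_polynomial.
have d0 : d != 0 by apply: contraNneq t0g => d0; rewrite dE d0 horner0.
have : d * along gam P = 0.
  apply: poly_eq0_horner => t; rewrite hornerM.
  have [->|] := eqVneq d.[t] 0; first by rewrite mul0r.
  rewrite -dE => /good_foliation[H /PQ].
  by rewrite horner_along (meval_eq _ (gamE t)) => ->; rewrite mulr0.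
by move/eqP; rewrite mulf_eq0 (negPf d0) => /eqP.
Qed.

End Curves.

(** * Irreducibility of the family *)

Section Irreducibility.
Variables (K : numFieldType) (p q r : nat) (l : int) (e : nat).
Variables (a b w v : 'I_4 -> K) (f0 : 'I_4 -> {mpoly K[4]}).
Hypothesis f0qh : qh_form p q r l e f0.
Hypothesis f0res : line_resultant e a b w v f0 != 0.

Local Notation QH := (@quasi_homogeneous_foliations K p q r l e).

Let two : (2 : K) != 0. Proof. by rewrite pnatr_eq0. Qed.

(** Lagrange interpolation at the nodes 0, 1, 2. *)
Let interp (V : lmodType K) (x y z : V) (t : K) : V :=
  ((t - 1) * (t - 2) / 2) *: x - (t * (t - 2)) *: y + (t * (t - 1) / 2) *: z.

Let interp0 (V : lmodType K) (x y z : V) : interp x y z 0 = x.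
Proof.
rewrite /interp !mul0r !scale0r subr0 addr0 -[RHS]scale1r; congr (_ *: _).
by field.
Qed.

Let interp1 (V : lmodType K) (x y z : V) : interp x y z 1 = y.
Proof.
rewrite /interp subrr mulr0 !mul0r !scale0r addr0 sub0r mul1r -scaleNr -[RHS]scale1r.
by congr (_ *: _); ring.
Qed.

Let interp2 (V : lmodType K) (x y z : V) : interp x y z 2 = z.
Proof.
rewrite /interp subrr !mulr0 mul0r !scale0r subrr add0r -[RHS]scale1r; congr (_ *: _).
by field.
Qed.

Let interp_reg c0 c1 c2 : polynomial1 (fun t : K =>
  ((t - 1) * (t - 2) / 2) * c0 - (t * (t - 2)) * c1 + (t * (t - 1) / 2) * c2).
Proof.
exists ((2^-1 * c0) *: (('X - 1) * ('X - 2%:P)) - c1 *: ('X * ('X - 2%:P))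
        + (2^-1 * c2) *: ('X * ('X - 1))) => t.
rewrite !(hornerD, hornerN, hornerZ, hornerM, hornerX, hornerC); ring.
Qed.

(** Two members are joined by a polynomial curve that takes their data at t = 0 and t = 1. The
    chosen resultant may vanish at both of them, so the curve is also made to pass through the
    identity and [f0] at t = 2, where [good] is nonzero. A product of equations that vanishes on the
    family then vanishes along the curve, hence one factor does. *)
Lemma irreducible_quasi_homogeneous : irreducible_set QH.
Proof.
have curve A1 A2 f1 f2 : qh_form p q r l e f1 -> qh_form p q r l e f2 ->
  let A := interp A1 A2 1%:M in
  let f t i := interp (f1 i) (f2 i) (f0 i) t in
  [/\ forall i j, polynomial1 (fun t => A t i j),
      forall i, reg_mpoly (@polynomial1 K) (fun t => f t i),
      forall t, qh_form p q r l e (f t) &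
      good e a b w v A f 2 != 0].
  move=> h1 h2 A f; split=> [i j|i m|t|].
  - by apply: reg_ext (interp_reg (A1 i j) (A2 i j) (1%:M i j)) => t; rewrite !mxE.
  - apply: reg_ext (interp_reg (f1 i)@_m (f2 i)@_m (f0 i)@_m) => t.
    by rewrite !(mcoeffD, mcoeffN, mcoeffZ).
  - rewrite /f /interp.
    have := qh_formD (qh_formD (qh_formZ ((t - 1) * (t - 2) / 2) h1)
      (qh_formZ (- (t * (t - 2))) h2)) (qh_formZ (t * (t - 1) / 2) f0qh).
    by congr qh_form; apply/funext => i; rewrite scaleNr.
  - rewrite /good /A interp2 det1 mul1r pull_lin1.
    by have -> : f 2 = f0 by apply/funext => i; rewrite /f interp2.
split.
  have [Areg freg fqh g2] := curve 1%:M 1%:M f0 f0 f0qh f0qh.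
  by have [H QF] := good_foliation fqh g2; exists (foliation_of H).
move=> B1 B2 /foliation_closedP[I1 I1h ->] /foliation_closedP[I2 I2h ->] QB.
apply: contrapT => /not_orP[].
move=> /existsNP[F1 /not_implyP[QF1 /existsNP[P1 /not_implyP[IP1 vP1]]]].
move=> /existsNP[F2 /not_implyP[QF2 /existsNP[P2 /not_implyP[IP2 vP2]]]].
have /quasi_homogeneousP[A1 [A1u [f1 f1qh Ff1]]] := QF1.
have /quasi_homogeneousP[A2 [A2u [f2 f2qh Ff2]]] := QF2.
have [Areg freg fqh g2] := curve A1 A2 f1 f2 f1qh f2qh.
set A := interp A1 A2 1%:M in Areg g2; set f := (fun t i => interp _ _ _ t) in freg fqh g2.
have [gam gamE] := coords_curve Areg freg fqh.
have := curve_vanish Areg freg fqh g2 gamE (P := P1 * P2).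
rewrite rmorphM /= => /(_ _)/eqP; rewrite mulf_eq0 => h.
have {h} : (along gam P1 == 0) || (along gam P2 == 0).
  apply: h => Om H QH0; rewrite mevalM.
  have [/(_ _ IP1)|/(_ _ IP2)] := QB _ QH0.
    by move=> /(foliation_vanishP (I1h _ IP1) (foliation_ofE H)) ->; rewrite mul0r.
  by move=> /(foliation_vanishP (I2h _ IP2) (foliation_ofE H)) ->; rewrite mulr0.
case/orP => /eqP h.
- apply: vP1; apply/(foliation_vanishP (I1h _ IP1) Ff1).
  rewrite -[RHS](horner0 0) -h horner_along; apply: meval_eq => k.
  rewrite gamE /A interp0; congr (@coords K e (one_form (pull _ _)) k).
  by apply/funext => i; rewrite /f interp0.
- apply: vP2; apply/(foliation_vanishP (I2h _ IP2) Ff2).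
  rewrite -[RHS](horner0 1) -h horner_along; apply: meval_eq => k.
  rewrite gamE /A interp1; congr (@coords K e (one_form (pull _ _)) k).
  by apply/funext => i; rewrite /f interp1.
Qed.

End Irreducibility.

(** * First-order expansions of polynomial curves *)

Section FirstOrder.
Variables (K : numFieldType) (n : nat).
Implicit Types (h : K -> {mpoly K[n]}) (x y : {mpoly K[n]}).
Let reg := polynomial1_algebra K.

(** The remainder is itself polynomial in t, so products of expansions are again expansions and the
    term in t can be read off as a coefficient. *)
Definition jet1 h x y := exists2 rho, reg_mpoly (@polynomial1 K) rho &
  forall t, h t = x + t *: y + t ^+ 2 *: rho t.

Let regX : polynomial1 (id : K -> K).
Proof. by exists 'X => t; rewrite hornerX. Qed.

Lemma jet1_ext h h' x y : (forall t, h' t = h t) -> jet1 h x y -> jet1 h' x y.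
Proof. by move=> /funext ->. Qed.

Lemma jet1_const x : jet1 (fun=> x) x 0.
Proof.
exists (fun=> 0) => [|t]; first exact: (reg_mpolyC reg).
by rewrite !scaler0 !addr0.
Qed.

Lemma jet1D h h' x x' y y' : jet1 h x y -> jet1 h' x' y' ->
  jet1 (fun t => h t + h' t) (x + x') (y + y').
Proof.
move=> [rho R E] [rho' R' E']; exists (fun t => rho t + rho' t).
  exact: (reg_mpolyD reg).
by move=> t; rewrite E E' -!mul_mpolyC; ring.
Qed.

Lemma jet1M h h' x x' y y' : jet1 h x y -> jet1 h' x' y' ->
  jet1 (fun t => h t * h' t) (x * x') (y * x' + x * y').
Proof.
move=> [rho R E] [rho' R' E'].
exists (fun t => y * y' + (x + t *: y) * rho' t + rho t * (x' + t *: y')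
                 + t ^+ 2 *: (rho t * rho' t)); last first.
  by move=> t; rewrite E E' -!mul_mpolyC; ring.
have lin z z' : reg_mpoly (@polynomial1 K) (fun t => z + t *: z' : {mpoly K[n]}).
  apply: (reg_mpolyD reg); first exact: (reg_mpolyC reg).
  by apply: (reg_mpolyZ reg) => //; exact: (reg_mpolyC reg).
do ?apply: (reg_mpolyD reg).
- exact: (reg_mpolyC reg).
- exact: (reg_mpolyM reg).
- exact: (reg_mpolyM reg).
- apply: (reg_mpolyZ reg); last exact: (reg_mpolyM reg).
  by exists ('X ^+ 2) => t; rewrite hornerXn.
Qed.

Lemma jet1Z c h x y : jet1 h x y -> jet1 (fun t => c *: h t) (c *: x) (c *: y).
Proof.
move=> /(jet1M (jet1_const c%:MP)); rewrite mul0r add0r !mul_mpolyC.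
by apply: jet1_ext => t; rewrite mul_mpolyC.
Qed.

Lemma jet1_shift h x y : jet1 h x y -> jet1 (fun t => t *: h t) 0 x.
Proof.
move=> [rho R E]; exists (fun t => y + t *: rho t) => [|t].
  apply: (reg_mpolyD reg); first exact: (reg_mpolyC reg).
  exact: (reg_mpolyZ reg).
by rewrite E -!mul_mpolyC; ring.
Qed.

Lemma jet1_sum (I : Type) (s : seq I) (F : I -> K -> {mpoly K[n]}) (x y : I -> {mpoly K[n]}) :
  (forall i, jet1 (F i) (x i) (y i)) ->
  jet1 (fun t => \sum_(i <- s) F i t) (\sum_(i <- s) x i) (\sum_(i <- s) y i).
Proof.
move=> h; elim: s => [|i s IHs].
  by rewrite !big_nil; apply: jet1_ext (jet1_const 0) => t; rewrite big_nil.
by rewrite !big_cons; apply: jet1_ext (jet1D (h i) IHs) => t; rewrite big_cons.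
Qed.

Lemma jet1_comp (u : K -> n.-tuple {mpoly K[n]}) (z : 'I_n -> {mpoly K[n]}) x :
  (forall i, jet1 (fun t => tnth (u t) i) 'X_i (z i)) ->
  jet1 (fun t => x \mPo u t) x (\sum_i x^`M(i) * z i).
Proof.
move=> hu; elim/mpolyind: x => [|c m x _ _ IHx].
  rewrite big1 => [|i _]; last by rewrite mderiv0 mul0r.
  by apply: jet1_ext (jet1_const 0) => t; rewrite comp_mpoly0.
under eq_bigr => i _ do rewrite mderivD mderivZ mulrDl -scalerAl.
rewrite big_split /= -scaler_sumr.
apply: (jet1_ext (h := fun t => c *: ('X_[m] \mPo u t) + (x \mPo u t))).
  by move=> t; rewrite comp_mpolyD comp_mpolyZ.
apply: jet1D => //; apply: jet1Z => {c x IHx}.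
have [d] := ubnP (mdeg m); elim: d m => // d IHd m md.
have [->|m0] := eqVneq m 0%MM.
  rewrite mpolyX0 big1 => [|i _]; last by rewrite -mpolyC1 mderivC mul0r.
  by apply: jet1_ext (jet1_const 1) => t; rewrite comp_mpoly1.
have [i mi] : exists i, m i != 0%N.
  apply/existsP; apply: contraNT m0; rewrite negb_exists => /forallP h.
  by apply/eqP/mnmP => i; rewrite mnm0E; apply/eqP; move: (h i); rewrite negbK.
have em : m = (U_(i) + (m - U_(i)))%MM by rewrite addmC submK // lep1mP.
have {}md : (mdeg (m - U_(i)) < d)%N by move: md; rewrite {1}em mdegD mdeg1; lia.
rewrite {}em; move: {m m0 mi}(_ - _)%MM md => m /IHd IHm.
have -> : \sum_k ('X_[U_(i) + m])^`M(k) * z k =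
    z i * 'X_[m] + 'X_i * \sum_k ('X_[m])^`M(k) * z k.
  rewrite mulr_sumr; under eq_bigr => k _ do rewrite mpolyXD mderivM mulrDl -!mulrA.
  rewrite big_split /=; congr (_ + _).
  rewrite (bigD1 i) //= big1 => [|k ki]; last by rewrite mderivX1 eq_sym (negPf ki) mul0r.
  by rewrite mderivX1 eqxx mul1r addr0 mulrC.
rewrite mpolyXD; apply: jet1_ext (jet1M (hu i) IHm) => t.
by rewrite rmorphM /= comp_mpolyXU -tnth_nth.
Qed.

End FirstOrder.

Section TangentVectors.
Variable K : numFieldType.
Implicit Types (f : 'I_4 -> {mpoly K[4]}) (M : 'M[K]_4).

(* The Lie derivative of f along the linear vector field with matrix M. *)
Definition lie_linear M f j : {mpoly K[4]} :=
  \sum_k (f j)^`M(k) * (\sum_i M k i *: 'X_i) + \sum_k M k j *: f k.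

Lemma jet1_pull M f f' j :
  jet1 (fun t => pull (lin (1%:M + t *: M)) (fun i => f i + t *: f' i) j)
    (f j) (lie_linear M f j + f' j).
Proof.
have hu i : jet1 (fun t => tnth (lin (1%:M + t *: M)) i) 'X_i (\sum_k M i k *: 'X_k).
  apply: (jet1_ext (h := fun t => 'X_i + t *: \sum_k M i k *: 'X_k)).
    move=> t; rewrite -[X in _ = X + _](comp_mpoly_id 'X_i) comp_mpolyXU -tnth_nth -lin1.
    rewrite !tnth_mktuple scaler_sumr -big_split; apply: eq_bigr => k _.
    by rewrite !mxE scalerDl scalerA.
  rewrite -[X in jet1 _ X]addr0 -[X in jet1 _ _ X]add0r.
  by apply: jet1D; [exact: jet1_const|apply: jet1_shift (jet1_const _)].
apply: (jet1_ext (h := fun t => \sum_i ((i == j)%:R *: (f i \mPo lin (1%:M + t *: M))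
     + t *: (M i j *: (f i \mPo lin (1%:M + t *: M)))
     + t *: ((i == j)%:R *: (f' i \mPo lin (1%:M + t *: M))
             + t *: (M i j *: (f' i \mPo lin (1%:M + t *: M))))))).
  move=> t; rewrite pull_linE; apply: eq_bigr => i _.
  by rewrite !mxE comp_mpolyD comp_mpolyZ -!mul_mpolyC !(mpolyCD, mpolyCM); ring.
have delta (F : 'I_4 -> {mpoly K[4]}) : \sum_i (i == j)%:R *: F i = F j.
  rewrite (bigD1 j) //= eqxx scale1r big1 ?addr0 // => i /negPf ->.
  by rewrite scale0r.
rewrite -[X in jet1 _ X](delta f).
have -> : lie_linear M f j + f' j =
    \sum_i ((i == j)%:R *: (\sum_k (f i)^`M(k) * \sum_l M k l *: 'X_l)
            + M i j *: f i + (i == j)%:R *: f' i).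
  by rewrite !big_split /= !delta.
apply: jet1_sum => i; rewrite -[X in jet1 _ X]addr0 -[X in jet1 _ (X + _)]addr0.
apply: jet1D; last first.
  apply: jet1_shift; rewrite -[X in jet1 _ X]addr0; apply: jet1D.
    exact/jet1Z/(jet1_comp _ hu).
  exact/jet1_shift/jet1Z/(jet1_comp _ hu).
apply: jet1D; first exact/jet1Z/(jet1_comp _ hu).
exact/jet1_shift/jet1Z/(jet1_comp _ hu).
Qed.

End TangentVectors.

(** * Equations of foliations and their differentials *)

Section Equations.
Variables (K : numFieldType) (e : nat).
Local Notation N := (ncoords e).
Implicit Types (x y : 'I_N -> K) (m : 'X_{1..4}).

Definition idx (k : 'I_N) : coord_index e := enum_val k.
Definition rank_idx (c : coord_index e) : 'I_N := enum_rank c.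

Lemma idxK : cancel rank_idx idx. Proof. exact: enum_rankK. Qed.

(** The basis form x^m dx_i of the coordinate [k]. *)
Definition coord_form (k : 'I_N) (i : 'I_4) : {mpoly K[4]} :=
  if (idx k).1 == i then 'X_[(idx k).2] else 0.

Definition form_of x (i : 'I_4) : {mpoly K[4]} := \sum_k x k *: coord_form k i.

Lemma form_of_coef x k : (form_of x (idx k).1)@_((idx k).2) = x k.
Proof.
rewrite /form_of raddf_sum /= (bigD1 k) //= mcoeffZ /coord_form eqxx mcoeffX eqxx mulr1.
rewrite big1 ?addr0 // => k' k'k; rewrite mcoeffZ /coord_form.
case: eqP => [e1'|_]; last by rewrite mcoeff0 mulr0.
rewrite mcoeffX; case: eqP => [e2'|_]; last by rewrite mulr0.
case/eqP: k'k; apply: enum_val_inj; apply/eqP.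
by rewrite -pair_eqE /pair_eq /= e1' eqxx /= bmeqP e2'.
Qed.

Lemma form_of_coef0 x i m : (e.+2 <= mdeg m)%N -> (form_of x i)@_m = 0.
Proof.
move=> em; rewrite /form_of raddf_sum big1 // => k _ /=.
rewrite mcoeffZ /coord_form; case: eqP => _; last by rewrite mcoeff0 mulr0.
rewrite mcoeffX; case: eqP => [e'|]; last by rewrite mulr0.
by have := bmdeg (idx k).2; rewrite e' ltnNge em.
Qed.

Lemma coordK x i m (h : (mdeg m < e.+2)%N) :
  (form_of x i)@_m = x (rank_idx (i, BMultinom h)).
Proof. by have := form_of_coef x (rank_idx (i, BMultinom h)); rewrite idxK. Qed.

Lemma form_of_coords (a : diff_form K 4) :
  (forall i, a [set i]%SET \is e.+1.-homog) ->
  form_of (@coords K e a) = fun i => a [set i]%SET.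
Proof.
move=> ah; apply/funext => i; apply/mpolyP => m.
have [em|em] := leqP e.+2 (mdeg m).
  rewrite form_of_coef0 // (dhomog_nemf_coeff (ah i)) //=.
  by apply/eqP => e'; move: em; rewrite e' ltnn.
by rewrite (coordK _ _ em) /coords -/(idx _) idxK.
Qed.

Definition degree_eqs : seq {mpoly K[N]} :=
  [seq 'X_k | k <- enum [pred k : 'I_N | mdeg (idx k).2 != e.+1]].

Definition radial_eq m : {mpoly K[N]} :=
  \sum_k (\sum_i 'X_i * coord_form k i)@_m *: 'X_k.

Definition integrability_eq m : {mpoly K[N]} :=
  \sum_k \sum_k' (wedge_d (coord_form k) (coord_form k') e0 e1 e2)@_m *: ('X_k * 'X_k').

(** The codimension bound is an open condition and gives no equation. Integrability enters through
    the single coefficient of dx_0 /\ dx_1 /\ dx_2, as in [integrability_rows]. The bounds e + 4 and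
    e + e + 4 exceed the degrees e + 2 and 2 e + 1 of the homogeneous identities. *)
Definition foliation_eqs : seq {mpoly K[N]} :=
  degree_eqs ++ [seq radial_eq (bmnm m) | m : 'X_{1..4 < e + 4}]
  ++ [seq integrability_eq (bmnm m) | m : 'X_{1..4 < e + e + 4}].

Lemma meval_radial_eq m x : (radial_eq m).@[x] = (\sum_i 'X_i * form_of x i)@_m.
Proof.
rewrite rmorph_sum /=; under eq_bigr => k _ do rewrite mevalZ mevalXU.
rewrite /form_of; under [in RHS]eq_bigr => i _ do rewrite mulr_sumr.
rewrite exchange_big raddf_sum; apply: eq_bigr => k _ /=.
rewrite mulrC -mcoeffZ scaler_sumr; congr (_@_m).
by apply: eq_bigr => i _; rewrite scalerAr.
Qed.

Lemma wedge_d_bilinear (I J : finType) (F : I -> 'I_4 -> {mpoly K[4]})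
    (G : J -> 'I_4 -> {mpoly K[4]}) (x : I -> K) (y : J -> K) a b c :
  wedge_d (fun i => \sum_k x k *: F k i) (fun i => \sum_k y k *: G k i) a b c =
  \sum_k \sum_k' (x k * y k') *: wedge_d (F k) (G k') a b c.
Proof.
have E i j l : (\sum_k x k *: F k i) * ((\sum_k y k *: G k j)^`M(l)) =
    \sum_k \sum_k' (x k * y k') *: (F k i * (G k' j)^`M(l)).
  rewrite mderiv_sum mulr_suml; apply: eq_bigr => k _.
  rewrite mulr_sumr; apply: eq_bigr => k' _.
  by rewrite mderivZ -scalerAl -scalerAr scalerA.
rewrite /wedge_d !mulrBr !E -!sumrB -!big_split; apply: eq_bigr => k _ /=.
rewrite -!sumrB -!big_split; apply: eq_bigr => k' _ /=.
by rewrite -!scalerBr -!scalerDr !mulrBr.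
Qed.

Lemma meval_integrability_eq m x :
  (integrability_eq m).@[x] = (wedge_d (form_of x) (form_of x) e0 e1 e2)@_m.
Proof.
rewrite wedge_d_bilinear [RHS]raddf_sum [LHS]rmorph_sum; apply: eq_bigr => k _ /=.
rewrite [RHS]raddf_sum [LHS]rmorph_sum; apply: eq_bigr => k' _ /=.
by rewrite mevalZ mevalM !mevalXU mcoeffZ mulrC.
Qed.

Lemma foliation_eqs_vanish (F : foliation K e) (Omega : diff_form K 4) g :
  defining_forms F Omega -> g \in foliation_eqs -> g.@[@coords K e Omega] = 0.
Proof.
move=> /defining_form_properties[O1 Oh OR Oi].
rewrite !mem_cat => /or3P[/mapP[k]|/mapP[m _ ->]|/mapP[m _ ->]].
- rewrite mem_enum => /= dk ->; rewrite mevalXU /coords -/(idx _).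
  by rewrite (dhomog_nemf_coeff (Oh _)).
- by rewrite meval_radial_eq form_of_coords // OR mcoeff0.
- by rewrite meval_integrability_eq form_of_coords // Oi mcoeff0.
Qed.

Lemma mderivX_meval k x y : \sum_i ('X_k : {mpoly K[N]})^`M(i).@[x] * y i = y k.
Proof.
rewrite (bigD1 k) //= mderivX1 eqxx meval1 mul1r big1 ?addr0 // => i ik.
by rewrite mderivX1 eq_sym (negPf ik) meval0 mul0r.
Qed.

Lemma radial_eq_differential m x y :
  \sum_i (radial_eq m)^`M(i).@[x] * y i = (\sum_i 'X_i * form_of y i)@_m.
Proof.
rewrite -meval_radial_eq rmorph_sum /=.
under eq_bigr => i _ do rewrite mderiv_sum rmorph_sum mulr_suml /=.
rewrite exchange_big; apply: eq_bigr => k _ /=.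
under eq_bigr => i _ do rewrite mderivZ mevalZ -mulrA.
by rewrite -mulr_sumr mderivX_meval mevalZ mevalXU.
Qed.

Lemma integrability_eq_differential m x y :
  \sum_i (integrability_eq m)^`M(i).@[x] * y i =
  (wedge_d (form_of x) (form_of y) e0 e1 e2
   + wedge_d (form_of y) (form_of x) e0 e1 e2)@_m.
Proof.
rewrite !wedge_d_bilinear -big_split raddf_sum /=.
under eq_bigr => i _ do rewrite mderiv_sum rmorph_sum mulr_suml /=.
rewrite exchange_big; apply: eq_bigr => k _ /=.
under eq_bigr => i _ do rewrite mderiv_sum rmorph_sum mulr_suml /=.
rewrite exchange_big -big_split raddf_sum; apply: eq_bigr => k' _ /=.
rewrite [RHS]mcoeffD ![in RHS]mcoeffZ; set W := (wedge_d _ _ _ _ _)@_m.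
have E i : ((W *: ('X_k * 'X_k'))^`M(i)).@[x] * y i =
    W * x k' * (('X_k)^`M(i).@[x] * y i) + W * x k * (('X_k')^`M(i).@[x] * y i).
  by rewrite mderivZ mevalZ mderivM mevalD !mevalM !mevalXU; ring.
under eq_bigr => i _ do rewrite E.
by rewrite big_split /= -!mulr_sumr !mderivX_meval; ring.
Qed.

End Equations.

(** If P(x) is nonzero, so is P(c x) = c^h P(x); hence [s] vanishes at c x for every nonzero c, and
    the polynomial in c with coefficients s_d(x) is zero. *)
Lemma homog_component (K : numFieldType) n (s P : {mpoly K[n]}) h (x : 'I_n -> K) :
  P \is h.-homog -> (forall c, c != 0 -> (s * P).@[fun i => c * x i] = 0) ->
  forall d, (pihomog mdeg d s).@[x] = 0 \/ P.@[x] = 0.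
Proof.
move=> Ph hs d; have [->|Px] := eqVneq (P.@[x]) 0; [by right|left].
pose u : {poly K} := \poly_(d < msize s) (pihomog mdeg d s).@[x].
have u0 : u * 'X = 0.
  apply: poly_eq0_horner => c; rewrite hornerM hornerX.
  have [->|c0] := eqVneq c 0; first by rewrite mulr0.
  have := hs c c0; rewrite mevalM (homog_mevalZ Ph (c := c) (v := x)) // => /eqP.
  rewrite !mulf_eq0 expf_eq0 (negPf c0) andbF (negPf Px) !orbF => /eqP sc.
  suff -> : u.[c] = s.@[fun i => c * x i] by rewrite sc mul0r.
  rewrite [in RHS](pihomog_partitionE (mf := mdeg) (leqnn (msize s))) horner_poly rmorph_sum.
  apply: eq_bigr => k _ /=.
  by rewrite (homog_mevalZ (pihomogP _ k s) (c := c) (v := x) (w := fun i => c * x i)) // mulrC.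
have {u0} u0 : u = 0 by move/eqP: u0; rewrite mulf_eq0 polyX_eq0 orbF => /eqP.
have [ds|sd] := ltnP d (msize s).
  by have := coef_poly (msize s) (fun d => (pihomog mdeg d s).@[x]) d; rewrite -/u u0 coef0 ds.
suff -> : pihomog mdeg d s = 0 by rewrite meval0.
apply/mpolyP => m; rewrite pihomog_mcoeff mcoeff0; case: eqP => // md.
by apply/memN_msupp_eq0/msize_mdeg_ge; rewrite md.
Qed.

(** * The criterion for the closure of the family *)

Section Component.
Variables (K : numFieldType) (p q r : nat) (l : int) (e : nat).
Variables (a b w v : 'I_4 -> K) (f0 : 'I_4 -> {mpoly K[4]}).
Hypothesis f0qh : qh_form p q r l e f0.
Hypothesis f0res : line_resultant e a b w v f0 != 0.

Hypothesis tangent : forall eta : 'I_4 -> {mpoly K[4]},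
  (forall i, eta i \is e.+1.-homog) -> \sum_i 'X_i * eta i = 0 ->
  wedge_d f0 eta e0 e1 e2 + wedge_d eta f0 e0 e1 e2 = 0 ->
  exists M : 'M[K]_4, exists2 f1, qh_form p q r l e f1 &
    forall j, eta j = lie_linear M f0 j + f1 j.

Local Notation QH := (@quasi_homogeneous_foliations K p q r l e).
Local Notation cc := (@coords K e).

Let F0 : exists2 H : foliation_form e (one_form f0), QH (foliation_of H) & True.
Proof.
have reg := polynomial1_algebra K.
have [] := @good_foliation K p q r l e a b w v (fun=> 1%:M) (fun=> f0) (fun=> f0qh) 0.
  by rewrite /good det1 mul1r pull_lin1.
by rewrite pull_lin1 => H QH0; exists H.
Qed.

(** The equations on [tau] say that [eta] is homogeneous, is annihilated by the radial field and
    solves the linearized integrability condition. With [M] and [f1] from the hypothesis [tangent],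
    the curve pulls f0 + t f1 back by 1 + t M. *)
Let tangent_curve (P : {mpoly K[ncoords e]}) (tau : 'I_(ncoords e) -> K) :
  (forall Omega (H : foliation_form e Omega), QH (foliation_of H) -> P.@[cc Omega] = 0) ->
  (forall g, g \in foliation_eqs K e -> \sum_i g^`M(i).@[cc (one_form f0)] * tau i = 0) ->
  exists gam : 'I_(ncoords e) -> {poly K}, [/\ forall i, (gam i)`_0 = cc (one_form f0) i,
     forall i, (gam i)`_1 = tau i,
     forall g, g \in foliation_eqs K e -> along gam g = 0 & along gam P = 0].
Proof.
move=> PQ tau0; pose eta := form_of tau.
have f0h i : f0 i \is e.+1.-homog by case: f0qh.
have etah i : eta i \is e.+1.-homog.
  apply/dhomogP => m; rewrite mcoeff_msupp => h; apply/eqP; apply: contraNT h => md.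
  have [em|em] := leqP e.+2 (mdeg m); first by rewrite form_of_coef0.
  rewrite (coordK _ _ em); set k := rank_idx _.
  rewrite -(mderivX_meval k (cc (one_form f0)) tau) tau0 //.
  rewrite mem_cat; apply/orP; left; apply: map_f.
  by rewrite mem_enum inE /k idxK.
have etaR : \sum_i 'X_i * eta i = 0.
  apply/mpolyP => m; rewrite mcoeff0.
  have [em|em] := ltnP (mdeg m) (e + 4).
    rewrite -(radial_eq_differential m (cc (one_form f0))) tau0 //.
    by rewrite !mem_cat; apply/orP; right; apply/orP; left; apply/mapP;
      exists (BMultinom em); rewrite ?mem_enum.
  have : \sum_i 'X_i * eta i \is (1 + e.+1).-homog.
    by apply: rpred_sum => i _; apply: dhomogM => //; rewrite dhomogX /= mdeg1.
  by move=> /dhomog_nemf_coeff -> //=; apply/eqP; lia.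
have f0E : form_of (cc (one_form f0)) = f0.
  rewrite form_of_coords => [|i]; last by rewrite one_formE.
  by apply/funext => i; rewrite one_formE.
have etaI : wedge_d f0 eta e0 e1 e2 + wedge_d eta f0 e0 e1 e2 = 0.
  apply/mpolyP => m; rewrite mcoeff0.
  have [em|em] := ltnP (mdeg m) (e + e + 4).
    rewrite -{1 2}f0E -(integrability_eq_differential m) tau0 //.
    by rewrite !mem_cat; apply/orP; right; apply/orP; right; apply/mapP;
      exists (BMultinom em); rewrite ?mem_enum.
  have wh (g h : 'I_4 -> {mpoly K[4]}) : (forall i, g i \is e.+1.-homog) ->
      (forall i, h i \is e.+1.-homog) -> wedge_d g h e0 e1 e2 \is (e.+1 + e).-homog.
    move=> gh hh; have dh (i j : 'I_4) : (h i)^`M(j) \is e.-homog by apply: dhomog_mderiv.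
    by rewrite /wedge_d; do ?apply: rpredD; apply: dhomogM => //; apply: rpredB.
  have : wedge_d f0 eta e0 e1 e2 + wedge_d eta f0 e0 e1 e2 \is (e.+1 + e).-homog.
    by apply: rpredD; apply: wh.
  by move=> /dhomog_nemf_coeff -> //=; apply/eqP; lia.
have [M [f1 f1qh etaE]] := tangent etah etaR etaI.
pose A (t : K) := 1%:M + t *: M; pose f (t : K) i := f0 i + t *: f1 i.
have regX : polynomial1 (id : K -> K) by exists 'X => t; rewrite hornerX.
have reg := polynomial1_algebra K.
have Areg i j : polynomial1 (fun t => A t i j).
  apply: (reg_ext (f := fun t => 1%:M i j + t * M i j)); first by move=> t; rewrite !mxE.
  by apply: (regD reg); [exact: (regC reg)|apply: (regM reg); last exact: (regC reg)].
have freg i : reg_mpoly (@polynomial1 K) (fun t => f t i).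
  apply: (reg_mpolyD reg); first exact: (reg_mpolyC reg).
  by apply: (reg_mpolyZ reg) => //; exact: (reg_mpolyC reg).
have fqh t : qh_form p q r l e (f t) by exact: (qh_formD f0qh (qh_formZ t f1qh)).
have A0 : A 0 = 1%:M by rewrite /A scale0r addr0.
have f00 : f 0 = f0 by apply/funext => i; rewrite /f scale0r addr0.
have g0 : good e a b w v A f 0 != 0 by rewrite /good A0 f00 det1 mul1r pull_lin1.
have [gam gamE] := coords_curve Areg freg fqh.
have h k : exists rho : {poly K},
    gam k = (cc (one_form f0) k)%:P + tau k *: 'X + 'X^2 * rho.
  have [rho rhor rhoE] := jet1_pull M f0 f1 (idx k).1.
  have [c cE] := rhor (idx k).2.
  exists c; apply/eqP; rewrite -subr_eq0; apply/eqP/poly_eq0_horner => t.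
  rewrite !(hornerD, hornerN, hornerM, hornerZ, hornerX, hornerC, hornerXn) gamE.
  rewrite /coords -/(idx k) !one_formE /A /f rhoE -etaE !(mcoeffD, mcoeffZ) cE.
  by rewrite /eta form_of_coef; ring.
exists gam; split=> [k|k|g gG|].
- have [rho ->] := h k.
  by rewrite !coefD coefC coefZ coefX coefXnM /= mulr0 !addr0.
- have [rho ->] := h k.
  by rewrite !coefD coefC coefZ coefX coefXnM /= mulr1 add0r addr0.
- by apply: (curve_vanish Areg freg fqh g0 gamE)  => Om H _;
  exact: foliation_eqs_vanish (foliation_ofE H) gG.
- exact: (curve_vanish Areg freg fqh g0 gamE).
Qed.

Theorem component_criterion : irreducible_component (closure QH).
Proof.
have irrQ := irreducible_quasi_homogeneous f0qh f0res.
split; first exact: irreducible_closure.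
move=> B [_ irrB] QB; apply/seteqP; split=> //; rewrite closureE => F BF C [].
move=> /foliation_closedP[I Ih ->] QI P IP.
have [h Ph] := Ih _ IP.
have PQ Om (H : foliation_form e Om) : QH (foliation_of H) -> P.@[cc Om] = 0.
  by move=> /QI/(_ _ IP)/(foliation_vanishP (Ih _ IP) (foliation_ofE H)).
have [s s0 sP] := tangent_criterion (fun tau => @tangent_curve P tau PQ).
(* A homogeneous component of [s] nonzero at [f0] has a closed zero locus among foliations that
   misses the base point; [B] is covered by this locus and that of [P], so it lies in the latter. *)
have [d sd] : exists d, (pihomog mdeg d s).@[cc (one_form f0)] != 0.
  apply: contrapT => /forallNP hd; move/eqP: s0; apply.
  rewrite (pihomog_partitionE (mf := mdeg) (leqnn (msize s))) rmorph_sum big1 // => k _.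
  by apply/eqP/negPn/negP/hd.
have hd : @homogeneous K e (pihomog mdeg d s) by exists d; exact: pihomogP.
pose Z Q := zero_locus (@foliation_vanish K e) [set Q].
have Zc Q : @homogeneous K e Q -> closed (Z Q).
  by move=> Qh; apply/foliation_closedP; exists [set Q] => // _ ->.
have [||F' BF'|BZ|BZ] := irrB (Z (pihomog mdeg d s)) (Z P).
- exact: Zc.
- exact/Zc/Ih.
- have [Om F'Om] := defining_forms_neq0 F'.
  have Om' c : c != 0 -> defining_forms F' (c *: Om).
    case: (F') F'Om => _ /= [Om1 H ->] [c1 c10 <-] c0.
    by exists (c * c1); rewrite ?scalerA //=; exact: mulf_neq0.
  have hc c : c != 0 -> (s * P).@[fun k => c * cc Om k] = 0.
    move=> c0; rewrite -(sP (cc (c *: Om))); last first.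
      by move=> g; apply: foliation_eqs_vanish (Om' c c0).
    by apply: meval_eq => k; rewrite coordsZ.
  case: (homog_component Ph hc d) => h0; [left|right] => Q ->.
    by apply/(foliation_vanishP hd F'Om).
  by apply/(foliation_vanishP (Ih _ IP) F'Om).
- have [H QF0 _] := F0.
  have := BZ _ (QB _ (subset_closure QF0)) _ erefl.
  move=> /(foliation_vanishP hd (foliation_ofE H)) e'.
  by move: sd; rewrite e' eqxx.
- exact: BZ BF _ erefl.
Qed.

End Component.

(** * Soundness of the integer computations *)

Section Soundness.
Variable K : numFieldType.

Definition zK (z : Z) : K := (int_of_Z z)%:~R.

Lemma zKD x y : zK (Z.add x y) = zK x + zK y.
Proof. by rewrite /zK -[Z.add x y]/(x + y) rmorphD rmorphD. Qed.

Lemma zKM x y : zK (Z.mul x y) = zK x * zK y.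
Proof. by rewrite /zK -[Z.mul x y]/(x * y) rmorphM rmorphM. Qed.

Lemma zKN x : zK (Z.opp x) = - zK x.
Proof. by rewrite /zK -[Z.opp x]/(- x) rmorphN rmorphN. Qed.

Lemma zKB x y : zK (Z.sub x y) = zK x - zK y.
Proof. by rewrite -zKN -zKD. Qed.

Lemma zK0 : zK Z0 = 0. Proof. by []. Qed.

Lemma zK1 : zK (Zpos xH) = 1. Proof. by []. Qed.

Lemma zK_eq0 z : (zK z == 0) = Z.eqb z Z0.
Proof.
rewrite /zK intr_eq0 -[0 : int]/(int_of_Z Z0) (can_eq int_of_ZK).
by apply/eqP/idP => [->//|/Z.eqb_spec].
Qed.

Lemma zK_nat n : zK (Z.of_nat n) = n%:R.
Proof. by rewrite /zK; have -> : int_of_Z (Z.of_nat n) = n :> int by lia. Qed.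

Variable val : seq nat -> K.

Definition row_eval (r : row) : K := \sum_(x <- r) zK x.2 * val x.1.

Lemma row_eval_cons x r : row_eval (x :: r) = zK x.2 * val x.1 + row_eval r.
Proof. by rewrite /row_eval big_cons. Qed.

Lemma row_eval_nil : row_eval [::] = 0.
Proof. by rewrite /row_eval big_nil. Qed.

Lemma row_eval_cat r s : row_eval (r ++ s) = row_eval r + row_eval s.
Proof. by rewrite /row_eval big_cat. Qed.

Lemma row_eval_add k c r : row_eval (row_add k c r) = zK c * val k + row_eval r.
Proof.
elim: r => [|[k' c'] r IHr] /=.
  case: Z.eqb_spec => [->|_]; first by rewrite row_eval_nil zK0 mul0r addr0.
  by rewrite row_eval_cons.
case: eqP => [<-|_]; last by rewrite !row_eval_cons IHr addrCA.
case: Z.eqb_spec => [e|_]; rewrite !row_eval_cons /= addrA -mulrDl -zKD //.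
by rewrite e zK0 mul0r add0r.
Qed.

Lemma row_eval_collect r : row_eval (row_collect r) = row_eval r.
Proof. by elim: r => //= x r IHr; rewrite row_eval_add IHr row_eval_cons. Qed.

Lemma row_eval_comb a r b s :
  row_eval (row_comb a r b s) = zK a * row_eval r + zK b * row_eval s.
Proof.
elim: r => [|x r IHr] /=.
  rewrite /row_comb /= row_eval_nil mulr0 add0r /row_eval big_map mulr_sumr.
  by apply: eq_bigr => x _; rewrite zKM mulrA.
by rewrite row_eval_add IHr row_eval_cons zKM mulrDr addrA mulrA.
Qed.

(** The content divides every coefficient and is nonzero in [K], of characteristic 0, so it can be
    cancelled. *)
Lemma row_eval_primitive r : row_eval r = 0 -> row_eval (row_primitive r) = 0.
Proof.
rewrite /row_primitive; set g := foldr _ _ _; case: Z.eqb_spec => // g0 r0.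
have gr x : x \in r -> zK g * zK (Z.div x.2 g) = zK x.2.
  move=> xr; have [q xq] : Z.divide g x.2.
    rewrite /g; elim: r xr {g g0 r0} => //= y r IHr.
    rewrite inE => /predU1P[->|/IHr]; first exact: Z.gcd_divide_l.
    by apply: Z.divide_trans; exact: Z.gcd_divide_r.
  by rewrite -zKM xq Z.div_mul // Z.mul_comm.
have : zK g * row_eval [seq (x.1, Z.div x.2 g) | x <- r] = 0.
  rewrite -r0 /row_eval big_map mulr_sumr big_seq [RHS]big_seq.
  by apply: eq_bigr => x xr; rewrite mulrA gr.
move/eqP; rewrite mulf_eq0 zK_eq0 => /orP[/Z.eqb_spec //|/eqP].
by [].
Qed.

Lemma row_eval_split k r :
  row_eval r = zK (row_split k r).1 * val k + row_eval (row_split k r).2.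
Proof.
elim: r => [|[k' c] r IHr] /=; first by rewrite row_eval_nil zK0 mul0r addr0.
case: eqP => [->|_]; first by rewrite row_eval_cons.
case: (row_split k r) IHr => c0 r0 /= IHr.
by rewrite !row_eval_cons IHr addrCA.
Qed.

Lemma find_pivotP k rs c p rs' : find_pivot k rs = Some (c, p, rs') ->
  (forall r, r \in rs -> row_eval r = 0) ->
  [/\ zK c != 0, zK c * val k + row_eval p = 0 & forall r, r \in rs' -> row_eval r = 0].
Proof.
elim: rs c p rs' => //= r rs IHrs c p rs'.
case er : (row_split k r) => [c1 r1]; case c10 : (Z.eqb c1 Z0).
  case ep : (find_pivot k rs) => [[[c2 p2] rs2]|] // [<- <- <-] h.
  have [|h1 h2 h3] := IHrs _ _ _ ep; first by move=> s sr; apply: h; rewrite inE sr orbT.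
  split=> // s; rewrite inE => /predU1P[->|/h3 //].
  by apply: h; rewrite mem_head.
move=> [<- <- <-] h; split; first by rewrite zK_eq0 c10.
  by have := row_eval_split k r; rewrite er /= h ?mem_head.
by move=> s sr; apply: h; rewrite inE sr orbT.
Qed.

(** A pivot row that passes the test of [free_keys] involves, besides its own key, later keys only;
    these vanish by induction, hence so does the key. A pivot row that fails the test is dropped and
    its key counted as free, which only enlarges the set of unknowns assumed to vanish. *)
Lemma free_keysP ks rs : (forall r, r \in rs -> row_eval r = 0) ->
  (forall k, k \in free_keys ks rs -> val k = 0) -> forall k, k \in ks -> val k = 0.
Proof.
elim: ks rs => //= k ks IHks rs rs0.
case ep : (find_pivot k rs) => [[[c p] rs']|] h; last first.
  have k0 : val k = 0 by apply: h; rewrite mem_head.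
  move=> k'; rewrite inE => /predU1P[->//|]; apply: IHks rs0 _ k' => k' k'f.
  by apply: h; rewrite inE k'f orbT.
have [c0 cp rs'0] := find_pivotP ep rs0.
move: h; case: ifP => [pk|_] h; last first.
  have k0 : val k = 0 by apply: h; rewrite mem_head.
  move=> k'; rewrite inE => /predU1P[->//|]; apply: IHks rs'0 _ k' => k' k'f.
  by apply: h; rewrite inE k'f orbT.
have ks0 : forall k', k' \in ks -> val k' = 0.
  apply: IHks h => r; rewrite mem_filter => /andP[_ /mapP[s sr ->]].
  have s0 := rs'0 s sr; rewrite /eliminate.
  have := row_eval_split k s; case: (row_split k s) => c' s' /= es.
  case: ifP => // _; apply: row_eval_primitive; rewrite row_eval_comb zKN.
  have -> : row_eval s' = - (zK c' * val k).
    by apply/eqP; rewrite -addr_eq0 addrC -es s0.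
  have -> : row_eval p = - (zK c * val k).
    by apply/eqP; rewrite -addr_eq0 addrC cp.
  by ring.
move=> k'; rewrite inE => /predU1P[->|/ks0 //]; apply/eqP.
have p0 : row_eval p = 0.
  rewrite /row_eval big_seq big1 // => x /(allP pk) /ks0 ->.
  by rewrite mulr0.
by move/eqP: cp; rewrite p0 addr0 mulf_eq0 (negPf c0).
Qed.

End Soundness.

(** * Interpretation of exponent lists and monomial members of the family *)

Definition o4 (i : nat) : 'I_4 :=
  match i with 0 => e0 | 1 => e1 | 2 => e2 | _ => e3 end.

Lemma o4K (i : 'I_4) : o4 i = i.
Proof. by case: (ord4P i) => ->. Qed.

Definition mon (s : seq nat) : 'X_{1..4} := [multinom nth 0%N s i | i < 4].

Lemma mon_add s t : mon (exp_add s t) = (mon s + mon t)%MM.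
Proof. by apply/mnmP => i; rewrite !mnmE nth_mkseq. Qed.

Lemma mon_unit i : (i < 4)%N -> mon (exp_unit i) = U_(o4 i)%MM.
Proof.
move=> i4; apply/mnmP => j; rewrite !mnmE nth_mkseq // -[ i]/(val (Ordinal i4)) -val_eqE /=.
by have := o4K (Ordinal i4) => /= ->.
Qed.

Lemma exp_subP s t : if exp_sub s t is Some u then mon s = (mon u + mon t)%MM
  else ~~ (mon t <= mon s)%MM.
Proof.
rewrite /exp_sub; case: ifPn => [/allP h|h].
  apply/mnmP => i; rewrite !mnmE nth_mkseq // subnK //; apply: h.
  by rewrite mem_iota /= ltn_ord.
apply: contra h => /mnm_lepP h; apply/allP => i; rewrite mem_iota add0n => /andP[_ i4].
by have := h (Ordinal i4); rewrite !mnmE.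
Qed.

Section Forms.
Variable K : numFieldType.
Local Notation zK := (zK K).

Definition form_val (V : row) (j : 'I_4) : {mpoly K[4]} :=
  \sum_(x <- V | o4 (head 0%N x.1) == j) zK x.2 *: 'X_[mon (behead x.1)].

Lemma form_val_coef V j m :
  (form_val V j)@_m =
  row_eval (fun k => ((o4 (head 0%N k) == j) && (mon (behead k) == m))%:R) V.
Proof.
rewrite /form_val /row_eval raddf_sum big_mkcond; apply: eq_bigr => x _ /=.
by rewrite mcoeffZ mcoeffX; case: eqP => //= _; rewrite mulr0.
Qed.

Lemma form_val_cat V V' j : form_val (V ++ V') j = form_val V j + form_val V' j.
Proof. by rewrite /form_val big_cat. Qed.

Lemma form_val_collect V j : form_val (row_collect V) j = form_val V j.
Proof. by apply/mpolyP => m; rewrite !form_val_coef row_eval_collect. Qed.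

Lemma form_val_scale c V j :
  form_val [seq (x.1, Z.mul c x.2) | x <- V] j = zK c *: form_val V j.
Proof.
rewrite /form_val big_map scaler_sumr; apply: eq_bigr => x _.
by rewrite zKM scalerA.
Qed.

Section MonomialForm.
Variables (p q r l d : nat) (n : seq nat) (c : 'I_4).
Let w := weights p q r.
Hypothesis nd : mdeg (mon n) = d.
Hypothesis nl : (p * nth 0 n 0 + q * nth 0 n 1 + r * nth 0 n 2 = l + nth 0 w c)%N.

Let mu : {mpoly K[4]} := 'X_[mon n].
Let W (i : nat) : K := (nth 0%N w i)%:R.

Let formE j : form_val (monomial_form w n c) j =
  \sum_(x <- faces | (x.1.2 == c) && (x.1.1 == j))
     (W x.2.2 - W x.2.1) *: (mu * ('X_(o4 x.2.1) * 'X_(o4 x.2.2))).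
Proof.
rewrite /form_val big_map big_filter_cond big_seq_cond [RHS]big_seq_cond.
have ok : all (fun x : nat * nat * (nat * nat) =>
  [&& (x.1.1 < 4), (x.2.1 < 4) & (x.2.2 < 4)])%N faces by [].
apply: eq_big => [x|x /andP[/(allP ok)/and3P[x1 x2 x3] _]].
  case xf : (x \in faces) => //=; congr (_ && _).
  have /and3P[x1 _ _] := allP ok _ xf.
  by rewrite -[x.1.1]/(val (Ordinal x1)) o4K.
by rewrite /= !mon_add !mon_unit // !mpolyXD zKB !zK_nat.
Qed.

Let mud : {mpoly K[3]} := mu \mPo dehom K.
Let Sd := diag_field K p q r.

Let X_mderiv (i : 'I_4) : 'X_i * mu^`M(i) = (nth 0%N n i)%:R *: mu.
Proof.
rewrite /mu mderivX -scalerAr mnmE.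
have [->|ni] := eqVneq (nth 0%N n i) 0%N; first by rewrite !scale0r.
by rewrite -mpolyXD addmC submK // lep1mP mnmE.
Qed.

Let X_mderiv_dehom (i : 'I_3) : 'X_i * mud^`M(i) = (nth 0%N n i)%:R *: mud.
Proof.
rewrite /mud mderiv_dehom -dehom_lift.
have -> : tnth (dehom K) (lift ord_max i) = 'X_(lift ord_max i) \mPo dehom K.
  by rewrite comp_mpolyXU -tnth_nth.
rewrite -rmorphM /= X_mderiv comp_mpolyZ; congr (_%:R *: _).
by rewrite /= /bump leqNgt ltn_ord.
Qed.

Lemma monomial_form_homog j : form_val (monomial_form w n c) j \is d.+2.-homog.
Proof.
rewrite formE; apply: rpred_sum => x _; apply: rpredZ.
have X1 (i : 'I_4) : ('X_i : {mpoly K[4]}) \is 1.-homog by rewrite dhomogX /= mdeg1.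
have -> : d.+2 = (d + (1 + 1))%N by lia.
apply: dhomogM; last exact: dhomogM.
by rewrite dhomogX /= nd.
Qed.

Lemma monomial_form_radial : \sum_j 'X_j * form_val (monomial_form w n c) j = 0.
Proof.
pose y i : {mpoly K[4]} := 'X_(o4 i).
have -> : \sum_j 'X_j * form_val (monomial_form w n c) j =
   \sum_(j < 4) y j * \sum_(x <- faces) if (x.1.2 == c) && (x.1.1 == j)
     then (W x.2.2 - W x.2.1) *: (mu * (y x.2.1 * y x.2.2)) else 0.
  by apply: eq_bigr => j _; rewrite formE big_mkcond /y o4K.
rewrite !big_ord_recl big_ord0 /faces.
move: y (W) {+}mu => y W' m.
by case: (ord4P c) => ->; rewrite !big_cons !big_nil /= -!mul_mpolyC; ring.
Qed.

(** The affine field of x^n d/dx_c: where the last coordinate is 1, its derivation is congruent to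
    minus the Euler field of C^3 modulo the radial field. The global change of sign makes [cross]
    agree with the signs of [faces]. *)
Let X0 : vector_field K 3 := [ffun i : 'I_3 =>
  if (c < 3)%N then - (if val i == val c then mud else 0) else mud * 'X_i].

Let D (g : {mpoly K[3]}) : {mpoly K[3]} := \sum_i Sd i * g^`M(i).

Let SdE (i : 'I_3) : Sd i = W i *: 'X_i.
Proof. by rewrite ffunE; case: (ord3P i) => ->. Qed.

Let D_mud : D mud = (l%:R + W c) *: mud.
Proof.
rewrite /D; under eq_bigr => i _ do rewrite SdE -scalerAl X_mderiv_dehom scalerA.
rewrite -scaler_suml !big_ord_recl big_ord0 /W /= addr0 addrA.
by rewrite -!natrM -!natrD -nl.
Qed.

Let D_X (i : 'I_3) : D 'X_i = W i *: 'X_i.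
Proof.
rewrite /D (bigD1 i) //= mderivX1 eqxx mulr1 SdE big1 ?addr0 // => j ji.
by rewrite mderivX1 eq_sym (negPf ji) mulr0.
Qed.

Let D_M g h : D (g * h) = D g * h + g * D h.
Proof.
rewrite /D mulr_suml mulr_sumr -big_split; apply: eq_bigr => i _ /=.
by rewrite mderivM mulrDr mulrA mulrCA.
Qed.

(** By the weight condition S has eigenvalue l + w_c on [mud], and the bracket with d/dx_c subtracts
    w_c. For the last index w_c = 0, and the Euler field commutes with S. *)
Let X0_bracket : lie_bracket Sd X0 = (l%:Z)%:~R *: X0.
Proof.
apply/ffunP => i; rewrite [LHS]ffunE [RHS]ffunE big_split /= -/(D _) sumrN.
have -> : \sum_j X0 j * (Sd i)^`M(j) = W i *: X0 i.
  rewrite (bigD1 i) //= SdE mderivZ mderivX1 eqxx big1 => [|j ji].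
    by rewrite addr0 -scalerAr mulr1.
  by rewrite mderivZ mderivX1 eq_sym (negPf ji) scaler0 mulr0.
rewrite ffunE; case: ifPn => c3.
  have -> g : D (- g) = - D g.
    by rewrite /D -sumrN; apply: eq_bigr => j _; rewrite mderivN mulrN.
  case: eqP => [->|_].
    by rewrite D_mud scalerDl !scalerN opprK opprD -addrA addNr addr0.
  by rewrite oppr0 !scaler0 subr0 /D big1 ?oppr0 // => j _; rewrite mderiv0 mulr0.
have W0 : W c = 0.
  by move: c3; rewrite -leqNgt /W; case: (ord4P c) => ->.
by rewrite D_M D_mud D_X W0 addr0 -scalerAr addrK scalerAl.
Qed.

Lemma monomial_form_qh : qh_form p q r l d.+1 (form_val (monomial_form w n c)).
Proof.
split; [exact: monomial_form_homog|exact: monomial_form_radial|].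
exists X0 => // j; rewrite pull_dehom formE.
pose y i : {mpoly K[3]} := 'X_(o4 i) \mPo dehom K.
have yE (k : 'I_3) (i : nat) : o4 i = lift ord_max k -> y i = 'X_k.
  by move=> ik; rewrite /y ik comp_mpolyXU -tnth_nth dehom_lift.
have y0 : y 0%N = 'X_f0 by apply: yE; apply/val_inj.
have y1 : y 1%N = 'X_f1 by apply: yE; apply/val_inj.
have y2 : y 2 = 'X_f2 by apply: yE; apply/val_inj.
have y3 : y 3 = 1.
  by rewrite /y comp_mpolyXU -tnth_nth -dehom_max; congr (tnth _ _); apply/val_inj.
have -> : (\sum_(x <- faces | (x.1.2 == c) && (x.1.1 == lift ord_max j))
     (W x.2.2 - W x.2.1) *: (mu * ('X_(o4 x.2.1) * 'X_(o4 x.2.2)))) \mPo dehom K =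
   \sum_(x <- faces) if (x.1.2 == c) && (x.1.1 == lift ord_max j)
     then (W x.2.2 - W x.2.1) *: (mud * (y x.2.1 * y x.2.2)) else 0.
  by rewrite -big_mkcond raddf_sum; apply: eq_bigr => x _; rewrite /= comp_mpolyZ !rmorphM.
rewrite /cross !SdE /X0 !ffunE /faces.
have W3 : W 3 = 0 by [].
move: {+}mud => m; move: (W) W3 => W' W3.
case: (ord4P c) => ->; case: (ord3P j) => ->; rewrite !big_cons !big_nil /=;
  rewrite ?y0 ?y1 ?y2 ?y3 ?W3 -!mul_mpolyC; ring.
Qed.

End MonomialForm.
End Forms.

Lemma exponentsP k d s : (s \in exponents k d) = (size s == k) && (sumn s == d).
Proof.
elim: k d s => [|k IHk] d s.
  by case: d => [|d]; rewrite ?inE; case: s => [|x s] //=.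
apply/flattenP/andP => [[_ /mapP[a + ->] /mapP[m + ->]]|[/eqP sk /eqP sd]].
  rewrite mem_iota add0n ltnS /= IHk => ad /andP[/eqP -> /eqP ->].
  by rewrite eqxx subnK.
case: s sk sd => // x s [sk] sd.
exists [seq (d - sumn s)%N :: m | m <- exponents k (sumn s)].
  by apply/mapP; exists (sumn s) => //; rewrite mem_iota add0n ltnS -sd leq_addl.
apply/mapP; exists s; first by rewrite IHk sk !eqxx.
by rewrite -sd addnK.
Qed.

Lemma mdeg_mon s : size s = 4%N -> mdeg (mon s) = sumn s.
Proof.
move=> s4; rewrite mdegE sumnE (big_nth 0%N) s4 big_mkord.
by apply: eq_bigr => i _; rewrite mnmE.
Qed.

Lemma exponents_mon m : exists2 s, s \in exponents 4 (mdeg m) & mon s = m.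
Proof.
have ms : mon (mkseq (fun i => m (o4 i)) 4) = m.
  by apply/mnmP => i; rewrite mnmE nth_mkseq // o4K.
exists (mkseq (fun i => m (o4 i)) 4) => //.
by rewrite exponentsP size_mkseq -mdeg_mon ?size_mkseq // ms !eqxx.
Qed.

Lemma mon_inj s t : size s = 4%N -> size t = 4%N -> mon s = mon t -> s = t.
Proof.
move=> s4 t4 st; apply: (@eq_from_nth _ 0%N); rewrite s4 ?t4 // => i i4.
by have := congr1 (fun m : 'X_{1..4} => m (Ordinal i4)) st; rewrite !mnmE.
Qed.

Lemma o4_eq i (j : 'I_4) : (o4 i == j) = (minn i 3 == j).
Proof. by rewrite -val_eqE; case: i => [|[|[|[|i]]]]. Qed.

Section Soundness.
Variable K : numFieldType.
Local Notation zK := (zK K).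
Implicit Types (P V : row) (eta : 'I_4 -> {mpoly K[4]}).

Definition poly_val P : {mpoly K[4]} := \sum_(x <- P) zK x.2 *: 'X_[mon x.1].

Lemma poly_val_cat P P' : poly_val (P ++ P') = poly_val P + poly_val P'.
Proof. by rewrite /poly_val big_cat. Qed.

Lemma poly_val_component V (j : 'I_4) : poly_val (component j V) = form_val K V j.
Proof.
by rewrite /poly_val /form_val big_map big_filter; apply: eq_bigl => x; rewrite o4_eq.
Qed.

Lemma poly_val_opp P : poly_val (poly_opp P) = - poly_val P.
Proof.
rewrite /poly_val big_map -sumrN; apply: eq_bigr => x _.
by rewrite zKN scaleNr.
Qed.

Lemma poly_val_deriv k P : (k < 4)%N -> poly_val (poly_deriv k P) = (poly_val P)^`M(o4 k).
Proof.
move=> k4; elim: P => [|x P IHP]; first by rewrite /poly_val !big_nil mderiv0.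
rewrite /poly_deriv /= poly_val_cat -/(poly_deriv k P) IHP /poly_val [in RHS]big_cons.
rewrite mderivD; congr (_ + _); rewrite mderivZ mderivX.
have -> : mon x.1 (o4 k) = nth 0%N x.1 k.
  by rewrite mnmE; congr nth; have := o4K (Ordinal k4) => /= ->.
have := exp_subP x.1 (exp_unit k); rewrite mon_unit //.
case: exp_sub => [t ->|].
  by rewrite big_seq1 zKM zK_nat addmK scalerA mulrC.
rewrite big_nil lep1mP negbK mnmE => /eqP.
have -> : nth 0%N x.1 (o4 k) = nth 0%N x.1 k.
  by congr nth; have := o4K (Ordinal k4) => /= ->.
by move=> ->; rewrite scale0r scaler0.
Qed.

Definition coef_val eta (k : seq nat) : K := (eta (o4 (head 0%N k)))@_(mon (behead k)).

Lemma mcoeffMX_notin (g : {mpoly K[4]}) m u : ~~ (m <= u)%MM -> ('X_[m] * g)@_u = 0.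
Proof.
move=> mu; elim/mpolyind: g => [|c v g _ _ IHg]; first by rewrite mulr0 mcoeff0.
rewrite mulrDr mcoeffD IHg addr0 -scalerAr mcoeffZ -mpolyXD mcoeffX.
case: eqP => [e|]; last by rewrite mulr0.
by move: mu; rewrite -e lem_addr.
Qed.

Lemma row_eval_mul_row eta P m f (g : {mpoly K[4]}) :
  (forall n z, zK (f n z).2 * coef_val eta (f n z).1 = zK z * g@_(mon n)) ->
  row_eval (coef_val eta) (mul_row P m f) = (poly_val P * g)@_(mon m).
Proof.
move=> fg; elim: P => [|x P IHP].
  by rewrite row_eval_nil /poly_val big_nil mul0r mcoeff0.
rewrite /mul_row /= row_eval_cat -/(mul_row P m f) IHP /poly_val big_cons mulrDl mcoeffD.
congr (_ + _); rewrite -scalerAl mcoeffZ.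
have := exp_subP m x.1; case: exp_sub => [n ->|nx].
  by rewrite row_eval_cons row_eval_nil addr0 fg [_ * g]mulrC addmC mcoeffMX.
by rewrite row_eval_nil mcoeffMX_notin ?mulr0.
Qed.

Lemma row_eval_radial eta m :
  row_eval (coef_val eta) (radial_row m) = (\sum_i 'X_i * eta i)@_(mon m).
Proof.
have E (i : nat) : (i < 4)%N -> row_eval (coef_val eta)
    (if exp_sub m (exp_unit i) is Some n then [:: (i :: n, Zpos xH)] else [::]) =
    ('X_(o4 i) * eta (o4 i))@_(mon m).
  move=> i4; have := exp_subP m (exp_unit i); rewrite mon_unit //.
  case: exp_sub => [n ->|nx]; last by rewrite row_eval_nil mcoeffMX_notin.
  rewrite row_eval_cons row_eval_nil addr0 [_ * eta _]mulrC.
  by rewrite addmC mcoeffMX /coef_val /= zK1 mul1r.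
rewrite raddf_sum !big_ord_recl big_ord0 /=.
by rewrite /radial_row /= !row_eval_cat !E // row_eval_nil.
Qed.

Lemma row_eval_wedge eta (O Q : row) m a b c : (a < 4)%N -> (b < 4)%N -> (c < 4)%N ->
  row_eval (coef_val eta) (wedge_row O Q m a b c) =
  (poly_val O * ((eta (o4 c))^`M(o4 b) - (eta (o4 b))^`M(o4 c))
   + poly_val Q * eta (o4 a))@_(mon m).
Proof.
move=> a4 b4 c4; rewrite /wedge_row !row_eval_cat.
have nE n i : (i < 4)%N -> mon n (o4 i) = nth 0%N n i.
  by move=> i4; rewrite mnmE; congr nth; have := o4K (Ordinal i4) => /= ->.
rewrite (@row_eval_mul_row _ _ _ _ (eta (o4 c))^`M(o4 b)); last first.
  move=> n z; cbv [fst snd]; rewrite zKM zK_nat mcoeff_deriv /coef_val /= mon_add mon_unit // nE //.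
  by rewrite -mulrA mulr_natl.
rewrite (@row_eval_mul_row _ _ _ _ (- (eta (o4 b))^`M(o4 c))); last first.
  move=> n z; cbv [fst snd]; rewrite zKN zKM zK_nat mcoeffN mcoeff_deriv /coef_val /=.
  rewrite mon_add mon_unit // nE //.
  by rewrite mulrN mulNr -mulrA mulr_natl.
rewrite (@row_eval_mul_row _ _ _ _ (eta (o4 a))) //.
by rewrite -!mcoeffD addrA -mulrDr.
Qed.

Lemma row_eval_integrability eta V d row : row \in integrability_rows V d ->
  wedge_d (form_val K V) eta e0 e1 e2 + wedge_d eta (form_val K V) e0 e1 e2 = 0 ->
  row_eval (coef_val eta) row = 0.
Proof.
move=> /mapP[m _ ->] h; rewrite row_eval_collect row_eval_cat row_eval_wedge //.
rewrite row_eval_cat !row_eval_wedge //.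
rewrite -!mcoeffD; set f := form_val K V in h *.
have C (j : 'I_4) : poly_val (component j V) = f j by exact: poly_val_component.
rewrite !poly_val_cat !poly_val_opp !poly_val_deriv //.
rewrite (C e0) (C e1) (C e2) -[RHS](mcoeff0 _ (mon m)) -h; congr (_@_(mon m)).
by rewrite /wedge_d /=; ring.
Qed.

(** On proper keys the passage to an index and a multinomial is injective, so extracting a
    coefficient amounts to comparing keys. *)
Lemma coef_val_form V k : proper_key k -> all (fun x => proper_key x.1) V ->
  coef_val (form_val K V) k = row_eval (fun k' => (k' == k)%:R) V.
Proof.
move=> /andP[/eqP k5 k4] /allP Vp; rewrite /coef_val form_val_coef /row_eval.
rewrite big_seq [RHS]big_seq; apply: eq_bigr => x /Vp /andP[/eqP x5 x4]; congr (_ * _%:R).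
case: k k5 k4 => // i s [s4] /= i4; case: x.1 x5 x4 => // j t [t4] /= j4.
rewrite eqseq_cons; congr (_ && _).
  have [oi oj] := (o4K (Ordinal i4), o4K (Ordinal j4)).
  by rewrite /= in oi oj; rewrite oi oj -val_eqE.
by apply/eqP/eqP => [|-> //]; apply: mon_inj.
Qed.

Lemma form_keysP d eta : (forall i, eta i \is d.-homog) ->
  (forall k, k \in form_keys d -> coef_val eta k = 0) -> forall i, eta i = 0.
Proof.
move=> etah h i; apply/mpolyP => m; rewrite mcoeff0.
have [md|md] := eqVneq (mdeg m) d; last by rewrite (dhomog_nemf_coeff (etah i)).
have [s sm <-] := exponents_mon m.
have := h (val i :: s); rewrite /coef_val /= o4K; apply.
apply/allpairsP; exists (val i, s); split; rewrite ?mem_iota //= -md //.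
Qed.

End Soundness.

(** * Tangent vectors to the family *)

Section Jets.
Variables (K : numFieldType) (n : nat).

Lemma jet1_deriv (h : K -> {mpoly K[n]}) x y i :
  jet1 h x y -> jet1 (fun t => (h t)^`M(i)) x^`M(i) y^`M(i).
Proof.
move=> [rho R E]; exists (fun t => (rho t)^`M(i)) => [m|t].
  have [c cE] := R (m + U_(i))%MM; exists (c *+ (m i).+1) => t.
  by rewrite mcoeff_deriv hornerMn cE.
by rewrite E !mderivD !mderivZ.
Qed.

Lemma jet1_eq0 (x y : {mpoly K[n]}) : jet1 (fun=> 0) x y -> y = 0.
Proof.
move=> [rho R E]; apply/mpolyP => m; rewrite mcoeff0.
have [c cE] := R m.
have P0 : (x@_m)%:P + y@_m *: 'X + 'X^2 * c = 0 :> {poly K}.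
  apply: poly_eq0_horner => t.
  rewrite !(hornerD, hornerM, hornerZ, hornerX, hornerC, hornerXn) -cE.
  by have := congr1 (mcoeff m) (E t); rewrite mcoeff0 !mcoeffD !mcoeffZ mulrC => <-.
have := congr1 (fun P : {poly K} => P`_1) P0.
by rewrite !coefD coefC coefZ coefX coefXnM coef0 /= mulr1 add0r addr0.
Qed.

End Jets.

Section TangentSpace.
Variables (K : numFieldType) (p q r : nat) (l : int) (e : nat).
Variable f0 : 'I_4 -> {mpoly K[4]}.
Hypothesis f0qh : qh_form p q r l e f0.
Implicit Type eta : 'I_4 -> {mpoly K[4]}.

Definition tangent_to_family eta := exists M : 'M[K]_4,
  exists2 f1, qh_form p q r l e f1 & forall j, eta j = lie_linear M f0 j + f1 j.

Lemma lie_linearD M N j : lie_linear (M + N) f0 j = lie_linear M f0 j + lie_linear N f0 j.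
Proof.
rewrite /lie_linear [RHS]addrACA; congr (_ + _); rewrite -big_split; apply: eq_bigr => k _ /=.
  rewrite -mulrDr -big_split; congr (_ * _); apply: eq_bigr => i _ /=.
  by rewrite mxE scalerDl.
by rewrite mxE scalerDl.
Qed.

Lemma lie_linearZ c M j : lie_linear (c *: M) f0 j = c *: lie_linear M f0 j.
Proof.
rewrite /lie_linear scalerDr !scaler_sumr; congr (_ + _); apply: eq_bigr => k _ /=.
  rewrite scalerAr scaler_sumr; congr (_ * _); apply: eq_bigr => i _.
  by rewrite mxE scalerA.
by rewrite mxE scalerA.
Qed.

Lemma tangent0 : tangent_to_family (fun=> 0).
Proof.
exists (0 *: 0); exists (fun i => 0 *: f0 i); first exact: qh_formZ.
by move=> j; rewrite lie_linearZ !scale0r addr0.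
Qed.

Lemma tangent_lin c eta eta' : tangent_to_family eta -> tangent_to_family eta' ->
  tangent_to_family (fun i => c *: eta i + eta' i).
Proof.
move=> [M [f fq E]] [M' [f' fq' E']]; exists (c *: M + M').
exists (fun i => c *: f i + f' i); first exact: (qh_formD (qh_formZ c fq) fq').
by move=> j; rewrite E E' lie_linearD lie_linearZ scalerDr addrACA.
Qed.

Lemma tangent_combo (I : Type) (s : seq I) (c : I -> K) (F : I -> 'I_4 -> {mpoly K[4]}) :
  (forall i, tangent_to_family (F i)) ->
  tangent_to_family (fun j => \sum_(i <- s) c i *: F i j).
Proof.
move=> h; elim: s => [|i s IHs].
  by under eq_fun do rewrite big_nil; exact: tangent0.
by under eq_fun do rewrite big_cons; exact: tangent_lin.
Qed.

Lemma tangent_qh eta : qh_form p q r l e eta -> tangent_to_family eta.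
Proof.
move=> eq; exists (0 *: 0); exists eta => // j.
by rewrite lie_linearZ scale0r add0r.
Qed.

Lemma tangent_lie M : tangent_to_family (lie_linear M f0).
Proof.
exists M; exists (fun i => 0 *: f0 i); first exact: qh_formZ.
by move=> j; rewrite scale0r addr0.
Qed.

(** The curve of forms behind a tangent vector satisfies the radial and integrability equations for
    every t, so the terms of first order in t vanish. *)
Lemma tangent_equations eta : tangent_to_family eta ->
  [/\ forall i, eta i \is e.+1.-homog, \sum_i 'X_i * eta i = 0 &
      wedge_d f0 eta e0 e1 e2 + wedge_d eta f0 e0 e1 e2 = 0].
Proof.
move=> [M [f1 f1qh E]].
pose g t := pull (lin (1%:M + t *: M)) (fun i => f0 i + t *: f1 i).
have gE j : jet1 (fun t => g t j) (f0 j) (eta j) by rewrite E; exact: jet1_pull.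
have gqh t : qh_form p q r l e (fun i => f0 i + t *: f1 i).
  exact: (qh_formD f0qh (qh_formZ t f1qh)).
split=> [i||].
- have [f0h _ _] := f0qh; have [f1h _ _] := f1qh.
  rewrite E /lie_linear; apply: rpredD; last exact: f1h.
  apply: rpredD; apply: rpred_sum => k _; last by apply: rpredZ; exact: f0h.
  have Xh : (\sum_j M k j *: 'X_j : {mpoly K[4]}) \is 1.-homog.
    by apply: rpred_sum => j _; apply: rpredZ; rewrite dhomogX /= mdeg1.
  by have := dhomogM (dhomog_mderiv k (f0h i)) Xh; rewrite addn1.
- apply: (@jet1_eq0 _ _ (\sum_i 'X_i * f0 i)).
  apply: (jet1_ext (h := fun t => \sum_i 'X_i * g t i)) => [t|].
    by rewrite pull_lin_radial //; case: (gqh t).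
  apply: jet1_sum => i; rewrite -[X in jet1 _ _ X]add0r -[X in jet1 _ _ (X + _)](mul0r (f0 i)).
  by apply: jet1M => //; exact: jet1_const.
have gint t : wedge_d (g t) (g t) e0 e1 e2 = 0.
  by apply: pull_lin_integrable; exact: qh_form_integrable (gqh t).
apply: (@jet1_eq0 _ _ (wedge_d f0 f0 e0 e1 e2)).
apply: (jet1_ext (h := fun t => wedge_d (g t) (g t) e0 e1 e2)) => // {gint}.
have D i j : jet1 (fun t => (g t i)^`M(j)) (f0 i)^`M(j) (eta i)^`M(j) by exact: jet1_deriv.
have T a b c : jet1 (fun t => g t a * ((g t c)^`M(b) - (g t b)^`M(c)))
    (f0 a * ((f0 c)^`M(b) - (f0 b)^`M(c)))
    (eta a * ((f0 c)^`M(b) - (f0 b)^`M(c)) + f0 a * ((eta c)^`M(b) - (eta b)^`M(c))).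
  apply: jet1M => //; apply: (jet1_ext (h := fun t => (g t c)^`M(b) + -1 *: (g t b)^`M(c))).
    by move=> t; rewrite scaleN1r.
  rewrite -!scaleN1r; apply: jet1D => //; exact: jet1Z.
have := jet1D (jet1D (T e0 e1 e2) (T e1 e2 e0)) (T e2 e0 e1).
congr jet1.
rewrite /wedge_d; ring.
Qed.

End TangentSpace.

Section Base.
Variable K : numFieldType.
Local Notation zK := (zK K).

Lemma form_val_lie V k i j : (k < 4)%N -> (i < 4)%N ->
  form_val K (lie_form V k i) j = lie_linear (delta_mx (o4 k) (o4 i)) (form_val K V) j.
Proof.
move=> k4 i4; have fk (f : nat -> row) : form_val K (flatten [seq f j | j <- iota 0 4]) j =
    \sum_(j' < 4) form_val K (f j') j.
  by rewrite !big_ord_recl big_ord0 /= !form_val_cat /form_val big_nil.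
rewrite fk /lie_linear; under eq_bigr => j' _ do rewrite form_val_cat.
have tagged (j' : 'I_4) P : form_val K [seq (val j' :: x.1, x.2) | x <- P] j =
    if j' == j then poly_val K P else 0.
  rewrite /form_val big_map; case: eqP => [->|jj].
    by apply: eq_bigl => x /=; rewrite o4K eqxx.
  by rewrite big_pred0 // => x /=; rewrite o4K; apply/eqP.
have shift P : poly_val K [seq (exp_add x.1 (exp_unit i), x.2) | x <- P] =
    poly_val K P * 'X_(o4 i).
  rewrite /poly_val big_map mulr_suml; apply: eq_bigr => x _ /=.
  by rewrite mon_add mon_unit // mpolyXD -scalerAl.
rewrite big_split /=; congr (_ + _).
  rewrite (bigD1 j) //= [X in _ + X]big1 ?addr0 => [|j' /negPf jj]; last first.
    by have := tagged j' [seq (exp_add x.1 (exp_unit i), x.2) | x <- poly_deriv k (component j' V)];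
       rewrite -map_comp jj.
  have := tagged j [seq (exp_add x.1 (exp_unit i), x.2) | x <- poly_deriv k (component j V)].
  rewrite -map_comp eqxx => ->; rewrite shift poly_val_deriv // poly_val_component.
  rewrite (bigD1 (o4 k)) //= [X in _ + X]big1 ?addr0 => [|k' kk]; last first.
    by rewrite big1 ?mulr0 // => i' _; rewrite mxE (negPf kk) scale0r.
  congr (_ * _); rewrite (bigD1 (o4 i)) //= big1 ?addr0 => [|i' ii]; last first.
    by rewrite mxE (negPf ii) andbF scale0r.
  by rewrite mxE !eqxx scale1r.
have kE : poly_val K (component k V) = form_val K V (o4 k).
  by rewrite -poly_val_component; congr (poly_val _ (component _ _));
    exact: (esym (congr1 val (o4K (Ordinal k4)))).
have iE (j' : 'I_4) : (j' == i :> nat) = (j' == o4 i).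
  by have := congr1 val (o4K (Ordinal i4)); rewrite /= -val_eqE /= => ->.
rewrite (bigD1 j) //= big1 ?addr0 => [|j' /negPf jj]; last first.
  by case: eqP => [_|_]; [rewrite tagged jj|rewrite /form_val big_nil].
rewrite (bigD1 (o4 k)) //= [X in _ + X]big1 ?addr0 => [|k' kk]; last first.
  by rewrite mxE (negPf kk) scale0r.
rewrite mxE eqxx iE; case: eqP => _.
  by rewrite tagged eqxx scale1r kE.
by rewrite /form_val big_nil scale0r.
Qed.

Variables (p q r l d : nat).
Local Notation qh := (@qh_form K p q r l d.+1).

Lemma weight_basisP x : x \in weight_basis p q r l d ->
  qh (form_val K (monomial_form (weights p q r) x.1 x.2)).
Proof.
rewrite mem_filter => /andP[/eqP wx /allpairsP[[n c] [nd c4 xE]]].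
move: nd c4 wx; rewrite {}xE exponentsP mem_iota => /andP[/eqP n4 /eqP nd] /andP[_ c4] wx.
by apply: (@monomial_form_qh K p q r l d n (Ordinal c4)); rewrite ?mdeg_mon.
Qed.

Lemma base_form_qh : ~~ nilp (weight_basis p q r l d) -> qh (form_val K (base_form p q r l d)).
Proof.
rewrite /nilp -lt0n => /(mem_nth ([::], 0%N)); set x0 := nth _ _ _ => x0B.
have -> : form_val K (base_form p q r l d) = fun j =>
    \sum_(x <- zip (iota 0 (size (weight_basis p q r l d))) (weight_basis p q r l d))
      zK (Z.pow 2 (Z.of_nat x.1)) *: form_val K (monomial_form (weights p q r) x.2.1 x.2.2) j.
  apply/funext => j; rewrite /base_form form_val_collect.
  elim: (zip _ _) => [|x s IHs]; first by rewrite /form_val !big_nil.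
  by rewrite big_cons /= form_val_cat IHs form_val_scale.
set s := zip _ _.
have : {subset [seq x.2 | x <- s] <= weight_basis p q r l d}.
  by move=> x; rewrite -/(unzip2 s) unzip2_zip ?size_iota.
elim: s => [_|x s IHs sB].
  (* The empty sum is 0 times the member given by the first basis element. *)
  have := qh_formZ 0 (weight_basisP x0B).
  by congr qh_form; apply/funext => j; rewrite big_nil scale0r.
under eq_fun do rewrite big_cons.
apply: (qh_formD (qh_formZ _ (weight_basisP (sB _ (mem_head _ _)))) (IHs _)).
by move=> y ys; apply: sB; rewrite inE ys orbT.
Qed.

End Base.

(** * Soundness of the tangency test *)

Section Check.
Variable K : numFieldType.

(** The matrix of the coefficients of [J] at the keys of [C] has full column rank: read as equations
    on a vector indexed by [C], the forms of [J] have only the zero solution, which is what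
    elimination without free key shows. *)
Lemma interpolate (C : seq (seq nat)) (J : seq row) (w : seq nat -> K) :
  uniq C -> all proper_key C -> all (all (fun x => proper_key x.1)) J ->
  nilp (free_keys C [seq row_collect [seq x <- T | x.1 \in C] | T <- J]) ->
  exists u : 'I_(size J) -> K, forall k, k \in C ->
    \sum_i u i * coef_val (form_val K (nth [::] J i)) k = w k.
Proof.
move=> uC /allP Cp /allP Jp CJ.
pose A : 'M[K]_(size J, size C) :=
  \matrix_(i, k) coef_val (form_val K (nth [::] J i)) (nth [::] C k).
suff Af : row_full A.
  have /submxP[u uA] := submx_full (\row_k w (nth [::] C k)) Af.
  exists (fun i => u 0 i) => k kC; have kC' : (index k C < size C)%N by rewrite index_mem.
  have := congr1 (fun B : 'rV_(size C) => B 0 (Ordinal kC')) uA.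
  rewrite !mxE /= nth_index // => ->; apply: eq_bigr => i _.
  by rewrite mxE /= nth_index.
rewrite -col_leq_rank -mxrank_tr row_leq_rank -kermx_eq0; apply/rowV0P => v /sub_kermxP vA.
(* Outside [C] the index equals [size C], so [insub] fails and the value is 0. *)
pose val (k : seq nat) : K := if insub (index k C) is Some i then v 0 i else 0.
have valE (k : 'I_(size C)) : val (nth [::] C k) = v 0 k.
  by rewrite /val index_uniq // valK.
apply/rowP => k; rewrite mxE -valE.
apply: (free_keysP (rs := [seq row_collect [seq x <- T | x.1 \in C] | T <- J])
  _ _ (mem_nth _ (ltn_ord k))); last first.
  by rewrite (nilP CJ).
move=> _ /mapP[T TJ ->]; rewrite row_eval_collect.
have iJ : (index T J < size J)%N by rewrite index_mem.
have := congr1 (fun B : 'rV_(size J) => B 0 (Ordinal iJ)) vA.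
rewrite !mxE => <-; rewrite /row_eval big_filter.
transitivity (\sum_(j < size C) \sum_(x <- T)
  (x.1 == nth [::] C j)%:R * (zK K x.2 * val (nth [::] C j))).
  rewrite exchange_big /= big_mkcond; apply: eq_bigr => x _.
  case: ifPn => [xC|xC]; last first.
    rewrite big1 // => j _; case: eqP => [e|_]; last by rewrite mul0r.
    by rewrite e mem_nth in xC.
  have jC : (index x.1 C < size C)%N by rewrite index_mem.
  rewrite (bigD1 (Ordinal jC)) //= nth_index // eqxx mul1r big1 ?addr0 // => j ij.
  case: eqP => [e|_]; last by rewrite mul0r.
  by case/eqP: ij; apply/val_inj; rewrite /= e index_uniq.
apply: eq_bigr => j _; rewrite !mxE /= nth_index // (coef_val_form _ (Cp _ _) (Jp _ TJ)) ?mem_nth //.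
rewrite valE /row_eval mulr_sumr; apply: eq_bigr => x _.
by rewrite mulrCA mulrA mulrC.
Qed.

(** A combination [th] of the known tangent vectors agrees with [eta] on [C]. The difference solves
    the linearized equations and vanishes on [C], so it is zero. *)
Lemma tangent_checkP p q r l d (eta : 'I_4 -> {mpoly K[4]}) : tangent_check p q r l d ->
  let f0 := form_val K (base_form p q r l d) in qh_form p q r l d.+1 f0 ->
  (forall i, eta i \is d.+2.-homog) -> \sum_i 'X_i * eta i = 0 ->
  wedge_d f0 eta e0 e1 e2 + wedge_d eta f0 e0 e1 e2 = 0 ->
  tangent_to_family p q r l d.+1 f0 eta.
Proof.
move=> + f0 f0qh etah etaR etaI; rewrite /tangent_check; cbv zeta.
set V := base_form _ _ _ _ _; set rs := _ ++ _; set J := _ ++ _.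
set C := free_keys _ _ => /and4P[uC Cp Jp CJ].
have JT T : T \in J -> tangent_to_family p q r l d.+1 f0 (form_val K T).
  rewrite mem_cat => /orP[/mapP[x xB ->]|/allpairsP[[k i] [k4 i4 ->]]].
    by apply: tangent_qh; exact: weight_basisP.
  move: k4 i4; rewrite !mem_iota => /andP[_ k4] /andP[_ i4].
  have -> : form_val K (lie_form V k i) = lie_linear (delta_mx (o4 k) (o4 i)) f0.
    by apply/funext => j; rewrite form_val_lie.
  exact: tangent_lie.
have [u uE] := interpolate (coef_val eta) uC Cp Jp CJ.
pose th j := \sum_i u i *: form_val K (nth [::] J i) j.
have thT : tangent_to_family p q r l d.+1 f0 th.
  by apply: tangent_combo => // i; apply: JT; rewrite mem_nth.
have [thh thR thI] := tangent_equations f0qh thT.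
suff E j : eta j = th j.
  have -> : eta = th by apply/funext.
  exact: thT.
apply/eqP; rewrite -subr_eq0; apply/eqP; move: j.
pose del j := eta j - th j; rewrite -/(del _).
apply: (@form_keysP K d.+2) => [i|]; first by apply: rpredB; [exact: etah|exact: thh].
have delv k : coef_val del k = coef_val eta k - coef_val th k by rewrite /coef_val mcoeffB.
apply: (@free_keysP K (coef_val del) _ rs) => [row|k kC]; last first.
  rewrite delv -uE // /th /coef_val raddf_sum; apply/eqP; rewrite subr_eq0; apply/eqP.
  by apply: eq_bigr => i _; rewrite /= mcoeffZ.
rewrite mem_cat => /orP[/mapP[m _ ->]|rV].
  rewrite row_eval_radial /del; under eq_bigr => i _ do rewrite mulrBr.
  by rewrite sumrB etaR thR subr0 mcoeff0.
apply: (row_eval_integrability rV); rewrite -[RHS](subrr 0) -{1}etaI -thI /del -/f0.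
by rewrite /wedge_d !mderivB; ring.
Qed.

End Check.

(** * Soundness of the resultant test *)

Section LineCheck.
Variable K : numFieldType.
Local Notation zK := (zK K).

Definition poly_of (s : seq Z) : {poly K} := foldr (fun c P => (zK c)%:P + 'X * P) 0 s.

Lemma coef_poly_of s i : (poly_of s)`_i = zK (nth Z0 s i).
Proof.
elim: s i => [|c s IHs] i; first by rewrite coef0 nth_nil.
by rewrite /= coefD coefC coefXM; case: i => [|i] /=; rewrite ?addr0 ?add0r ?IHs.
Qed.

Lemma poly_of_add s t : poly_of (list_add s t) = poly_of s + poly_of t.
Proof.
elim: s t => [|x s IHs] [|y t] /=; rewrite ?add0r ?addr0 //.
by rewrite IHs zKD polyCD; ring.
Qed.

Lemma poly_of_scale c s : poly_of (list_scale c s) = zK c *: poly_of s.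
Proof.
elim: s => [|x s IHs] /=; first by rewrite scaler0.
by rewrite IHs zKM polyCM -!mul_polyC; ring.
Qed.

Let w (i : 'I_4) : K := 1.
Let v (i : 'I_4) : K := (nth 0%N direction i)%:R.

Lemma poly_of_line_monomial n : poly_of (line_monomial n) = on_line w v 'X_[mon n].
Proof.
rewrite /on_line /along mmapX /mmap1.
have -> : \prod_(i < 4) ((w i)%:P + v i *: 'X) ^+ mon n i =
    \prod_(i <- iota 0 4) (1 + (nth 0%N direction i)%:R *: 'X : {poly K}) ^+ nth 0%N n i.
  rewrite (_ : iota 0 4 = index_iota 0 4) // big_mkord.
  by apply: eq_bigr => i _; rewrite mnmE.
rewrite /line_monomial; elim: (iota 0 4) => [|i s IHs].
  by rewrite big_nil /= mulr0 addr0.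
rewrite big_cons /= -IHs; elim: (nth 0%N n i) => [|k IHk]; first by rewrite expr0 mul1r.
rewrite iterS poly_of_add /= poly_of_scale IHk zK_nat exprS polyC0 -!mul_polyC.
by ring.
Qed.

Let coefs (c : seq nat) (i : 'I_4) : K := (nth 0%N c i)%:R.

Lemma poly_of_line_coefs c V :
  poly_of (line_coefs c V) = on_line w v (combo (coefs c) (form_val K V)).
Proof.
have -> : combo (coefs c) (form_val K V) =
    \sum_(x <- V) zK (Z.mul (Z.of_nat (nth 0%N c (minn (head 0%N x.1) 3))) x.2)
      *: 'X_[mon (behead x.1)].
  rewrite /combo /form_val; under eq_bigr => i _ do rewrite big_mkcond scaler_sumr.
  rewrite exchange_big; apply: eq_bigr => x _.
  rewrite (bigD1 (o4 (head 0%N x.1))) //= eqxx big1 ?addr0 => [|i /negPf ix]; last first.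
    by rewrite eq_sym ix scaler0.
  rewrite scalerA zKM zK_nat /coefs; congr (_%:R * _ *: _); congr nth.
  by apply/eqP; rewrite eq_sym -o4_eq.
elim: V => [|x V IHV]; first by rewrite big_nil /on_line raddf0.
rewrite big_cons /= poly_of_add poly_of_scale IHV poly_of_line_monomial.
by rewrite /on_line rmorphD /= /along mmapZ mul_polyC.
Qed.

(** A vector in the kernel of the Sylvester matrix satisfies each row as a linear equation, and
    elimination without free unknown forces it to be zero. *)
Lemma sylvester_rowsP D s t :
  nilp (free_keys [seq [:: b] | b <- iota 0 (D + D)] (sylvester_rows D s t)) ->
  \det (sylvester D (poly_of s) (poly_of t)) != 0.
Proof.
move=> /nilP sD; rewrite -det_tr; apply/det0P => -[u /eqP u0 uS]; apply: u0.
pose val (k : seq nat) : K := if insub (head 0%N k) is Some i then u 0 i else 0.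
have valE (b : 'I_(D + D)) : val [:: nat_of_ord b] = u 0 b by rewrite /val /= valK.
have h k : k \in [seq [:: b] | b <- iota 0 (D + D)] -> val k = 0.
  apply: (free_keysP (rs := sylvester_rows D s t)); last by rewrite sD.
  move=> _ /allpairsP[[x k'] [xst k'D ->]] /=.
  move: k'D; rewrite mem_iota add0n => /andP[_ k'D].
  have [a aE] : exists a : 'I_(D + D), forall b, sylvester D (poly_of s) (poly_of t) a b =
      zK (nth Z0 (nseq k' Z0 ++ x) b).
    have xE b : zK (nth Z0 (nseq k' Z0 ++ x) b) = (poly_of x * 'X^k')`_b.
      by rewrite coefMXn coef_poly_of nth_cat size_nseq nth_nseq; case: ifP => // ->.
    move: xst; rewrite !inE /= => /orP[] /eqP xE'.
      exists (lshift D (Ordinal k'D)) => b.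
      by rewrite mxE (unsplitK (inl _)) xE xE'.
    exists (rshift D (Ordinal k'D)) => b.
    by rewrite mxE (unsplitK (inr _)) xE xE'.
  have := congr1 (fun B : 'rV_(D + D) => B 0 a) uS; rewrite !mxE => <-.
  rewrite row_eval_collect /row_eval big_map (_ : iota 0 _ = index_iota 0 (D + D)).
    rewrite big_mkord; apply: eq_bigr => b _.
    by rewrite mxE aE mulrC; congr (_ * _); exact: valE.
  by rewrite /index_iota subn0.
apply/rowP => b; rewrite mxE -valE; apply: h.
by apply: map_f; rewrite mem_iota /= add0n ltn_ord.
Qed.

Lemma line_checkP e V : line_check e.+1 V ->
  line_resultant e (coefs combo1) (coefs combo2) w v (form_val K V) != 0.
Proof. by move=> /sylvester_rowsP; rewrite !poly_of_line_coefs. Qed.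

End LineCheck.

(** * The listed weights *)

Lemma check_component (K : numFieldType) p q r l d :
  component_check p q r l d ->
  irreducible_component (closure (@quasi_homogeneous_foliations K p q r l d.+1)).
Proof.
move=> /and3P[B0 tg ln]; have res := line_checkP K ln.
have f0qh := base_form_qh K B0.
by apply: (component_criterion f0qh res) => eta etah etaR etaI; exact: (tangent_checkP tg).
Qed.

Theorem corollary4p8 (R : realType) :
  (forall p q r l : nat,
     (p, q, r, l) \in [:: (7, 6, 4, 8); (7, 3, 2, 4); (6, 5, 2, 4);
                          (4, 3, 2, 4); (4, 2, 1, 2); (3, 2, 1, 2)]%N ->
     irreducible_component
       (closure (@quasi_homogeneous_foliations R[i] p q r l%:Z 3)))
  /\
  (forall p q r l : nat,
     (p, q, r, l) \in [:: (13, 12, 9, 27); (13, 8, 6, 18); (13, 4, 3, 9);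
                          (12, 7, 3, 9); (9, 8, 6, 18); (9, 6, 4, 12);
                          (9, 4, 3, 9); (9, 3, 2, 6); (8, 3, 2, 6);
                          (6, 5, 3, 9); (6, 3, 2, 6); (4, 3, 2, 6);
                          (3, 2, 1, 3)]%N ->
     irreducible_component
       (closure (@quasi_homogeneous_foliations R[i] p q r l%:Z 4))).
Proof.
split=> p q r l pqrl; apply: check_component; move: p q r l pqrl.
  (* Foliations of degree 3 come from fields of degree 2 on C^4; running the tests settles each
     weight. *)
  suff /allP h : all (fun x => component_check x.1.1.1 x.1.1.2 x.1.2 x.2 2)
      [:: (7, 6, 4, 8); (7, 3, 2, 4); (6, 5, 2, 4); (4, 3, 2, 4); (4, 2, 1, 2);
          (3, 2, 1, 2)]%N by move=> p q r l /h.
  by vm_compute.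
suff /allP h : all (fun x => component_check x.1.1.1 x.1.1.2 x.1.2 x.2 3)
    [:: (13, 12, 9, 27); (13, 8, 6, 18); (13, 4, 3, 9); (12, 7, 3, 9); (9, 8, 6, 18);
        (9, 6, 4, 12); (9, 4, 3, 9); (9, 3, 2, 6); (8, 3, 2, 6); (6, 5, 3, 9);
        (6, 3, 2, 6); (4, 3, 2, 6); (3, 2, 1, 3)]%N by move=> p q r l /h.
by vm_compute.
Qed.
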